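(* Let $\Omega\subset\mathbb{R}^N$ be a Poincaré admissible domain. Consider the four reduced negative Laplacians $\mathring{\mathcal L},\mathcal L_{\mathtt D},\mathcal L_{\mathtt N},\mathcal L$ defined in the context. Then each of the following eleven compositions (with $D(XY)=\{u\in D(Y):Yu\in D(X)\}$), all acting as $u\mapsto\Delta^2u$, is a bijection from its domain onto the indicated target space, and its inverse is bounded with respect to the $\mathsf L^2(\Omega)$-norms: (i) $\mathcal L\mathring{\mathcal L}$ with domain $\{u\in\mathring{\mathsf H}^2(\Omega):\Delta u\in\widetilde{\mathsf H}(\Delta,\Omega)\}$, onto $\mathsf L^2(\Omega)$; (ii) $\mathring{\mathcal L}\mathcal L$ with domain $\{u\in\widetilde{\mathsf H}(\Delta,\Omega):\Delta u\in\mathring{\mathsf H}^2(\Omega)\}$, onto $\widetilde{\mathsf L}^2(\Omega)$; (iii) $\mathcal L\mathcal L$ with domain $\{u\in\widetilde{\mathsf H}(\Delta,\Omega):\Delta u\in\widetilde{\mathsf H}(\Delta,\Omega)\}$, onto $\mathsf L^2(\Omega)$; (iv) $\mathcal L_{\mathtt D}\mathcal L$ with domain $\{u\in\widetilde{\mathsf H}(\Delta,\Omega):\Delta u\in D(\mathcal L_{\mathtt D})\}$, onto $\mathsf L^2(\Omega)$; (v) $\mathcal L_{\mathtt N}\mathcal L$ with domain $\{u\in\widetilde{\mathsf H}(\Delta,\Omega):\Delta u\in D(\mathcal L_{\mathtt N})\}$, onto $\widehat{\mathsf L}^2(\Omega)$; (vi) $\mathcal L\mathcal L_{\mathtt N}$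 with domain $\{u\in D(\mathcal L_{\mathtt N}):\Delta u\in\widetilde{\mathsf H}(\Delta,\Omega)\}$, onto $\mathsf L^2(\Omega)$; (vii) $\mathcal L_{\mathtt N}\mathcal L_{\mathtt N}$ with domain $\{u\in D(\mathcal L_{\mathtt N}):\Delta u\in D(\mathcal L_{\mathtt N})\}$, onto $\widehat{\mathsf L}^2(\Omega)$; (viii) $\mathring{\mathcal L}\mathcal L_{\mathtt D}$ with domain $\{u\in D(\mathcal L_{\mathtt D}):\Delta u\in\mathring{\mathsf H}^2(\Omega)\}$, onto $\widetilde{\mathsf L}^2(\Omega)$; (ix) $\mathcal L\mathcal L_{\mathtt D}$ with domain $\{u\in D(\mathcal L_{\mathtt D}):\Delta u\in\widetilde{\mathsf H}(\Delta,\Omega)\}$, onto $\mathsf L^2(\Omega)$; (x) $\mathcal L_{\mathtt D}\mathcal L_{\mathtt D}$ with domain $\{u\in D(\mathcal L_{\mathtt D}):\Delta u\in D(\mathcal L_{\mathtt D})\}$, onto $\mathsf L^2(\Omega)$; (xi) $\mathcal L_{\mathtt N}\mathcal L_{\mathtt D}$ with domain $\{u\in D(\mathcal L_{\mathtt D}):\Delta u\in D(\mathcal L_{\mathtt N})\}$, onto $\widehat{\mathsf L}^2(\Omega)$. In each case the inverse of $XY$ is $Y^{-1}X^{-1}$; equivalently, for each right-hand side $f$ in the target space there is exactly one $u$ in the indicated domain with $\Delta^2u=f$ in $\Omega$.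
   Context: A domain is a (nonempty) connected open set $\Omega\subset\mathbb{R}^N$, $N\in\mathbb{N}$. $\Omega$ is called Poincaré admissible if it is bounded and there is $c_{\mathsf p}>0$ with $\|\varphi\|_{\mathsf L^2(\Omega)}\le c_{\mathsf p}\|\nabla\varphi\|_{\mathsf L^2(\Omega)}$ for all $\varphi\in\widehat{\mathsf H}^1(\Omega):=\mathsf H^1(\Omega)\cap\mathbb{R}^\perp$ (no further boundary regularity is assumed). All differential operators are distributional; $\perp$ is orthogonality in $\mathsf L^2(\Omega)$; $\mathbb{R}$ denotes the constant functions. $\mathring{\mathsf H}^k(\Omega)$ and $\mathring{\mathsf H}(\operatorname{div},\Omega)$ are the closures of compactly supported smooth functions (resp. vector fields) in $\mathsf H^k(\Omega)$ and in $\mathsf H(\operatorname{div},\Omega)$ (with graph norm). $\mathsf H(\Delta,\Omega):=\{\varphi\in\mathsf L^2(\Omega):\Delta\varphi\in\mathsf L^2(\Omega)\}$, $\mathbb{H}:=\{\varphi\in\mathsf L^2(\Omega):\Delta\varphi=0\}$, $\widehat{\mathsf L}^2(\Omega):=\mathsf L^2(\Omega)\cap\mathbb{R}^\perp$, $\widetilde{\mathsf L}^2(\Omega):=\mathsf L^2(\Omega)\cap\mathbb{H}^\perp$, $\widetilde{\mathsf H}(\Delta,\Omega):=\mathsf H(\Delta,\Omega)\cap\mathbb{H}^\perp$. The four reduced negative Laplacians all act as $\varphi\mapsto-\Delta\varphi$: $\mathring{\mathcal L}:D(\mathring{\mathcal L})=\mathring{\mathsf H}^2(\Omega)\subset\mathsf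 L^2(\Omega)\to\widetilde{\mathsf L}^2(\Omega)$; $\mathcal L_{\mathtt D}:D(\mathcal L_{\mathtt D})=\{\varphi\in\mathring{\mathsf H}^1(\Omega):\Delta\varphi\in\mathsf L^2(\Omega)\}\subset\mathsf L^2(\Omega)\to\mathsf L^2(\Omega)$; $\mathcal L_{\mathtt N}:D(\mathcal L_{\mathtt N})=\{\varphi\in\widehat{\mathsf H}^1(\Omega):\nabla\varphi\in\mathring{\mathsf H}(\operatorname{div},\Omega)\}\subset\widehat{\mathsf L}^2(\Omega)\to\widehat{\mathsf L}^2(\Omega)$; $\mathcal L:D(\mathcal L)=\widetilde{\mathsf H}(\Delta,\Omega)\subset\widetilde{\mathsf L}^2(\Omega)\to\mathsf L^2(\Omega)$. *)

(* Defs.v *)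
From HB Require Import structures.
From mathcomp Require Import all_boot all_order all_algebra.
From mathcomp Require Import all_classical all_reals all_analysis.
From mathcomp Require Import measurable_realfun.

Set Implicit Arguments.
Unset Strict Implicit.
Unset Printing Implicit Defensive.

Import Order.TTheory GRing.Theory Num.Theory.
Import numFieldTopology.Exports numFieldNormedType.Exports.

Local Open Scope classical_set_scope.
Local Open Scope ring_scope.

(** * Lebesgue measure on R^n *)

Definition rV_display : measure_display. Proof. exact: default_measure_display. Qed.

Section rV_measurable.
Context {R : realType} {n : nat}.

Let coord (i : 'I_n) (v : 'rV[R]_n) : measurableTypeR R := v 0 i.

(** The product sigma-algebra, i.e. the Borel one: see [open_measurable_rV]. *)
HB.instance Definition _ := @isMeasurable.Build rV_display 'rV[R]_n
  (g_sigma_preimage coord) (@sigma_algebra0 _ setT _)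
  (@sigma_algebraC _ _) (@sigma_algebra_bigcup _ setT _).

Lemma measurable_coord (i : 'I_n) :
  measurable_fun [set: 'rV[R]_n] (fun v => v 0 i : measurableTypeR R).
Proof.
move=> _ Y mY; rewrite setTI; apply: sub_sigma_algebra => /=.
rewrite -bigcup_seq/=; exists i => /=; first by rewrite mem_index_enum.
by exists Y => //; rewrite setTI.
Qed.

Lemma measurable_fun_rVP d (T : measurableType d) (f : T -> 'rV[R]_n) :
  measurable_fun [set: T] f <->
  forall i, measurable_fun [set: T] (fun x => f x 0 i : measurableTypeR R).
Proof.
split=> [mf i|mf].
  exact: (measurableT_comp (measurable_coord i) mf).
apply: (@measurability _ _ _ _ _ _
  (\big[setU/set0]_(i < n) preimage_set_system setT (coord i) measurable)) => //.
move=> _ [B + <-].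
rewrite -bigcup_seq/= => -[i _ [C mC <-]].
by have := mf i measurableT C mC; rewrite !setTI.
Qed.

Lemma open_measurable_rV (A : set 'rV[R]_n) : open A -> measurable A.
Proof.
move=> oA.
pose c (q : 'rV[rat]_n * nat) : 'rV[R]_n := map_mx ratr q.1.
pose B (q : 'rV[rat]_n * nat) : set 'rV[R]_n :=
  [set y | ball (c q) (q.2.+1%:R^-1) y /\ ball (c q) (q.2.+1%:R^-1) `<=` A].
have -> : A = \bigcup_q B q.
  apply/seteqP; split=> [x Ax|x [q _ []]]; last by move=> xq; apply.
  have /nbhs_ballP[e /= e0 xeA] : nbhs x A by exact: open_nbhs_nbhs.
  have e20 : 0 < e / 2 by rewrite divr_gt0.
  have [k ke] : exists k : nat, k.+1%:R^-1 < e / 2 :> R.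
    near \oo => k; exists k; near: k.
    exact: (near_infty_natSinv_lt (PosNum e20)).
  have k0 : 0 < k.+1%:R^-1 :> R by rewrite invr_gt0.
  have qP i : exists q : rat, `|ratr q - x 0 i| < k.+1%:R^-1.
    have [q] := @rat_in_itvoo R (x 0 i - k.+1%:R^-1) (x 0 i + k.+1%:R^-1)
      ltac:(by rewrite ltrBlDr -addrA ltrDl addr_gt0).
    by rewrite in_itv/= => /andP[q1 q2]; exists q; rewrite ltr_distl q1.
  exists (\row_i (xget 0 [set q : rat | `|ratr q - x 0 i| < k.+1%:R^-1]), k) => //.
  have cx : ball (c (\row_i (xget 0 [set q : rat | `|ratr q - x 0 i| < k.+1%:R^-1]), k))
      k.+1%:R^-1 x.
    split=> // i j; rewrite !mxE ord1.
    have [q qx] := qP j.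
    by have := @xgetPex _ 0 [set q : rat | `|ratr q - x 0 j| < k.+1%:R^-1] (ex_intro _ q qx).
  split=> // y yc; apply: xeA.
  have := ball_triangle (ball_sym cx) yc; apply: le_ball.
  by rewrite (splitr e) lerD// ltW.
apply: countable_bigcupT_measurable => [|q]; first exact: countableP.
have [qA|qA] := pselect (ball (c q) q.2.+1%:R^-1 `<=` A); last first.
  rewrite (_ : B q = set0)//.
  by apply/seteqP; split=> // y [].
rewrite (_ : B q = \bigcap_(i in [set: 'I_n])
    (fun v : 'rV[R]_n => v 0 i) @^-1` (ball (c q 0 i) q.2.+1%:R^-1)).
  apply: fin_bigcap_measurable => // i _.
  rewrite -[X in measurable X]setTI; apply: measurable_coord => //.
  by apply: open_measurable; exact: ball_open.
apply/seteqP; split=> [y [[_ yq] _] i _ /=|y yq]; first exact: yq.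
split=> //; split; first by rewrite invr_gt0.
by move=> i j; rewrite ord1; exact: yq.
Unshelve. all: by end_near. Qed.

End rV_measurable.

Section lebesgue_rV.
Context {R : realType}.

Definition rV_cons n (p : measurableTypeR R * 'rV[R]_n) : 'rV[R]_n.+1 :=
  row_mx (p.1 : R)%:M p.2.

Lemma measurable_rV_cons n : measurable_fun setT (@rV_cons n).
Proof.
apply/measurable_fun_rVP => i.
have [j ->|j ->] := @split_ordP 1 n i.
- rewrite [X in measurable_fun _ X](_ : _ = fst)//.
  apply/funext => p; rewrite /rV_cons.
  by rewrite (@row_mxEl _ 1 1 n) !ord1 mxE eqxx.
- rewrite [X in measurable_fun _ X](_ : _ =
    (fun v : 'rV[R]_n => v 0 j : measurableTypeR R) \o snd).
    apply: measurableT_comp; first exact: measurable_coord.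
    exact: measurable_snd.
  by apply/funext => p; rewrite /rV_cons (@row_mxEr _ 1 1 n).
Qed.

HB.instance Definition _ n :=
  isMeasurableFun.Build _ _ _ _ (@rV_cons n) (@measurable_rV_cons n).

Section rV_cons_measure.
Context n (m : {sigma_finite_measure set 'rV[R]_n -> \bar R}).

Definition rV_cons_measure : set 'rV[R]_n.+1 -> \bar R :=
  pushforward (@lebesgue_measure R \x m)%E (@rV_cons n).


Let rV_cons_measure0 : rV_cons_measure set0 = 0%E.
Proof. exact: measure0. Qed.

Let rV_cons_measure_ge0 A : (0 <= rV_cons_measure A)%E.
Proof. exact: measure_ge0. Qed.

Let rV_cons_measure_sigma_additive : semi_sigma_additive rV_cons_measure.
Proof. exact: measure_semi_sigma_additive. Qed.

HB.instance Definition _ := isMeasure.Build _ _ _ rV_cons_measure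
  rV_cons_measure0 rV_cons_measure_ge0 rV_cons_measure_sigma_additive.

Lemma rV_cons_measure_sigma_finite : sigma_finite setT rV_cons_measure.
Proof.
have /sigma_finiteP[F [TF ndF Foo]] := sigma_finiteT (@lebesgue_measure R).
have /sigma_finiteP[G [TG ndG Goo]] := sigma_finiteT m.
pose h (v : 'rV[R]_n.+1) : measurableTypeR R * 'rV[R]_n :=
  (v 0 0, @rsubmx _ _ 1 n v).
have mh : measurable_fun setT h.
  apply/measurable_fun_pairP; split=> /=.
    exact: measurable_coord.
  apply/measurable_fun_rVP => i /=.
  rewrite [X in measurable_fun _ X](_ : _ =
    fun v : 'rV[R]_n.+1 => v 0 (@rshift 1 n i) : measurableTypeR R).
    exact: measurable_coord.
  by apply/funext => v; rewrite mxE.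
have hK : cancel (@rV_cons n) h.
  move=> [x v]; rewrite /h /rV_cons /= row_mxKr; congr pair.
  rewrite (_ : 0 = @lshift 1 n 0); last exact/val_inj.
  by rewrite (@row_mxEl _ 1 1 n) mxE eqxx.
exists (fun k => h @^-1` (F k `*` G k)).
  apply/seteqP; split=> // v _.
  have [i _ Fi] : (\bigcup_i F i) (h v).1 by rewrite -TF.
  have [j _ Gj] : (\bigcup_i G i) (h v).2 by rewrite -TG.
  exists (maxn i j) => //; split.
  - by move: Fi; exact/subsetPset/ndF/leq_maxl.
  - by move: Gj; exact/subsetPset/ndG/leq_maxr.
move=> k; have [mF muF] := Foo k; have [mG muG] := Goo k; split.
  by rewrite -[X in measurable X]setTI; apply: mh => //; exact: measurableX.
rewrite /rV_cons_measure /pushforward -comp_preimage.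
rewrite (_ : h \o _ = id); last exact/funext.
rewrite preimage_id product_measure1E//.
by rewrite lte_mul_pinfty// ge0_fin_numE.
Qed.

HB.instance Definition _ := Measure_isSigmaFinite.Build _ _ _
  rV_cons_measure rV_cons_measure_sigma_finite.

End rV_cons_measure.

(** The N-fold product of the one-dimensional Lebesgue measure. *)
Fixpoint lebesgue_rV n : {sigma_finite_measure set 'rV[R]_n -> \bar R} :=
  match n with
  | 0 => dirac (0 : 'rV[R]_0)
  | n.+1 => rV_cons_measure (lebesgue_rV n)
  end.

End lebesgue_rV.

(** * Passing between square-integrable functions and their L^2 classes *)

Section L2_classes.
Context d (T : measurableType d) (R : realType).
Variable mu : {measure set T -> \bar R}.

Local Notation L2 := (LspaceType2 mu).
Local Notation classes := {mfun_ mu, T >-> measurableTypeR R}.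

Lemma L2_fun_subproof (u : L2) : (u : T -> R) \in Lfun mu 2%:E.
Proof.
rewrite inE; apply/andP; split; rewrite inE/=; last exact: Lebesgue_finite.
exact: (@measurable_funPT _ _ _ _ (repr (u : classes))).
Qed.

Definition L2_fun (u : L2) : LfunType mu (lee1n 2) :=
  Lfun_Sub _ (L2_fun_subproof u).

Section class_of.
Variable f : LfunType mu (lee1n 2).

(* [LspaceType] is built over [measurableTypeR R], [LfunType] over the canonical
   measurable structure of [R]: the two are convertible up to their display. *)
Let f_mfun : isMeasurableFun _ _ _ (measurableTypeR R) (f : T -> R) :=
  isMeasurableFun.Build _ _ _ (measurableTypeR R) (f : T -> R)
    (measurable_funPT f).

Let mf : {mfun T >-> measurableTypeR R} :=
  HB.pack_for {mfun T >-> measurableTypeR R} (f : T -> R) f_mfun.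

Let f_class : classes := \pi_classes%qT mf.

Let f_class_ae : f_class = f %[ae mu].
Proof.
have : (repr f_class == mf %[mod classes])%qT by rewrite reprK.
by rewrite eqmodE => /asboolP.
Qed.

Lemma L2_class_subproof : finite_norm mu 2%:E f_class.
Proof.
rewrite /finite_norm; suff -> : ('N[mu]_2%:E[EFin \o f_class] = 'N[mu]_2%:E[EFin \o f])%E.
  exact: Lfunction_finite.
have mfc : measurable_fun setT (f_class : T -> R).
  exact: (@measurable_funPT _ _ _ _ (repr f_class)).
rewrite unlock; congr (_ `^ _)%E; apply: ge0_ae_eq_integral => //.
- apply/measurable_EFinP => /=.
  apply: (@measurableT_comp _ _ _ _ _ _ (@powR R ^~ 2)) => //.
  exact: measurableT_comp.
- apply/measurable_EFinP => /=.
  apply: (@measurableT_comp _ _ _ _ _ _ (@powR R ^~ 2)) => //.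
  exact: measurableT_comp.
- by move=> x _; exact: poweR_ge0.
- by move=> x _; exact: poweR_ge0.
by apply: filterS f_class_ae => x /(_ Logic.I) fx _ /=; rewrite fx.
Qed.

Definition L2_class : L2 :=
  HB.pack_for L2 f_class (isFinLebesgue.Build _ _ _ mu _ (lee1n 2) f_class L2_class_subproof).

Lemma L2_classK : L2_class = f %[ae mu].
Proof. exact: f_class_ae. Qed.
End class_of.

Lemma L2_eqP (u v : L2) : u = v <-> u = v %[ae mu].
Proof.
split=> [->|uv]; first exact: (ae_eq_refl mu setT).
suff : (u : classes) = (v : classes).
  case: u v {uv} => [u [[pu]]] [v [[pv]]] /= uv.
  by rewrite uv in pu *; rewrite (Prop_irrelevance pu pv).
have /ae_eqP : (u : classes) = (v : classes) %[ae mu] by [].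
by rewrite -[RHS]reprK -[LHS]reprK => /eqP.
Qed.

End L2_classes.

(** * Domains and test functions *)

Section test_functions.
Context {R : realType} {N : nat}.
Implicit Types (phi : 'rV[R]_N -> R) (i : 'I_N).

Record domain := Domain {
  domain_set :> set 'rV[R]_N ;
  domain_nonempty : domain_set !=set0 ;
  domain_connected : connected domain_set ;
  domain_open : open domain_set }.

Definition partial i phi : 'rV[R]_N -> R := 'D_(delta_mx 0 i) phi.

(** [partials [:: i1; ...; im] phi] is the iterated partial derivative
    d_i1 ... d_im phi. *)
Definition partials (s : seq 'I_N) phi := foldr partial phi s.

Definition laplacian phi : 'rV[R]_N -> R :=
  fun x => \sum_i partial i (partial i phi) x.

Definition smooth phi := forall s : seq 'I_N,
  continuous (partials s phi) /\
  forall i x, derivable (partials s phi) x (delta_mx 0 i).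

Definition test_function (Omega : domain) phi :=
  [/\ smooth phi, compact (closure [set x | phi x != 0]) &
      closure [set x | phi x != 0] `<=` Omega].

End test_functions.
Arguments domain : clear implicits.
Arguments domain_open {R N} d [t].

(** * Weak derivatives, Sobolev spaces and the reduced Laplacians *)

Section Sobolev.
Context {R : realType} {N : nat} (Omega : domain R N).

Definition lebesgue_on : {measure set 'rV[R]_N -> \bar R} :=
  mrestr (@lebesgue_rV R N) (open_measurable_rV (domain_open Omega)).
Local Notation mu := lebesgue_on.

(** L^2(Omega), as a.e.-classes of functions on R^N for the Lebesgue measure
    restricted to Omega; equality in [L2] is Leibniz equality, see [L2_eqP]. *)
Definition L2 := LspaceType2 mu.

HB.instance Definition _ := gen_eqMixin L2.
HB.instance Definition _ := gen_choiceMixin L2.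

Definition L2norm (f : 'rV[R]_N -> R) : R := fine ('N[mu]_2%:E[EFin \o f])%E.

(** The L^2 inner product, also used to test against smooth functions. *)
Definition pairing (f g : 'rV[R]_N -> R) : R := \int[mu]_x (f x * g x).

Definition L2zero : L2 := L2_class 0.
Definition L2opp (u : L2) : L2 := L2_class (- L2_fun u).

Definition orth (A : set L2) : set L2 := [set u | forall v, A v -> pairing u v = 0].

Definition constants : set L2 := [set u | exists c : R, u = cst c %[ae mu]].

(** For [u : L2] the functions [wpartials], [wlaplacian] and [wdiv] below select
    the L^2 function representing the distributional derivative, and return 0
    if that distribution is not in L^2. *)

Definition is_wpartials (s : seq 'I_N) (u g : L2) :=
  forall phi, test_function Omega phi ->
    pairing u (partials s phi) = (-1) ^+ size s * pairing g phi.

Definition wpartials s (u : L2) : L2 := xget L2zero [set g | is_wpartials s u g].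

(** [Delta^k u = f] in the sense of distributions. *)
Definition is_wlaplacian (k : nat) (u f : L2) :=
  forall phi, test_function Omega phi ->
    pairing u (iter k laplacian phi) = pairing f phi.

Definition wlaplacian (u : L2) : L2 := xget L2zero [set f | is_wlaplacian 1 u f].

Definition is_wdiv (v : 'I_N -> L2) (f : L2) :=
  forall phi, test_function Omega phi ->
    \sum_i pairing (v i) (partial i phi) = - pairing f phi.

Definition wdiv (v : 'I_N -> L2) : L2 := xget L2zero [set f | is_wdiv v f].

Definition wgrad (u : L2) : 'I_N -> L2 := fun i => wpartials [:: i] u.

Definition Hk (k : nat) : set L2 :=
  [set u | forall s, (size s <= k)%N -> exists g, is_wpartials s u g].

(** The H^k norm of [u - phi], mixed derivatives being counted once for each
    ordering of the variables (for k = 2, the Frobenius norm of the Hessian). *)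
Definition Hdist k (u : L2) (phi : 'rV[R]_N -> R) : R :=
  Num.sqrt (\sum_(m < k.+1) \sum_(s : m.-tuple 'I_N)
    L2norm (fun x => wpartials s u x - partials s phi x) ^+ 2).

Definition Hk0 k : set L2 :=
  [set u | Hk k u /\ forall e : R, 0 < e ->
    exists2 phi, test_function Omega phi & Hdist k u phi < e].

Definition Hdiv : set ('I_N -> L2) := [set v | exists f, is_wdiv v f].

(** The graph norm of [v - Phi] in H(div). *)
Definition Hdiv_dist (v : 'I_N -> L2) (Phi : 'I_N -> 'rV[R]_N -> R) : R :=
  Num.sqrt (\sum_i L2norm (fun x => v i x - Phi i x) ^+ 2 +
    L2norm (fun x => wdiv v x - \sum_i partial i (Phi i) x) ^+ 2).

Definition Hdiv0 : set ('I_N -> L2) :=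
  [set v | Hdiv v /\ forall e : R, 0 < e ->
    exists2 Phi : 'I_N -> 'rV[R]_N -> R,
      forall i, test_function Omega (Phi i) & Hdiv_dist v Phi < e].

Definition HLap : set L2 := [set u | exists f, is_wlaplacian 1 u f].

Definition harmonic : set L2 := [set u | is_wlaplacian 1 u L2zero].

Definition L2hat : set L2 := orth constants.
Definition H1hat : set L2 := Hk 1 `&` orth constants.
Definition L2tilde : set L2 := orth harmonic.
Definition HLaptilde : set L2 := HLap `&` orth harmonic.

Definition Poincare_admissible :=
  bounded_set (Omega : set 'rV[R]_N) /\
  exists2 c : R, 0 < c & forall u : L2, H1hat u ->
    L2norm u <= c * Num.sqrt (\sum_i L2norm (wgrad u i) ^+ 2).

(** ** Partially defined operators on L^2 *)

Record operator := Operator {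
  op_dom : set L2 ;
  op_cod : set L2 ;
  op_act :> L2 -> L2 }.

Definition op_comp (X Y : operator) : operator :=
  Operator [set u | op_dom Y u /\ op_dom X (Y u)] (op_cod X) (X \o Y).

(** Meaningful only if [X] is injective on its domain. *)
Definition op_inv (X : operator) : operator :=
  Operator (X @` op_dom X) (op_dom X) ('pinv_(fun=> L2zero) (op_dom X) X).

Definition op_eq (X Y : operator) :=
  op_dom X = op_dom Y /\ {in op_dom X, X =1 Y}.

Definition neg_laplacian (u : L2) : L2 := L2opp (wlaplacian u).

Definition Lap0 := Operator (Hk0 2) L2tilde neg_laplacian.
Definition LapD := Operator (Hk0 1 `&` HLap) setT neg_laplacian.
Definition LapN :=
  Operator (H1hat `&` [set u | Hdiv0 (wgrad u)]) L2hat neg_laplacian.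
Definition Lap := Operator HLaptilde setT neg_laplacian.

(** The composition [X Y] has domain [D] and target space [F], acts as the
    distributional bilaplacian, and is a bijection from [D] onto [F] with
    bounded inverse [Y^-1 X^-1]. *)
Definition bilaplacian_iso (X Y : operator) (D F : set L2) :=
  let XY := op_comp X Y in
  [/\ op_dom XY = D /\ op_cod XY = F,
      forall u, D u -> is_wlaplacian 2 u (XY u),
      set_bij D F XY,
      exists C : R, forall f, F f -> L2norm (op_inv XY f) <= C * L2norm f &
      [/\ set_inj (op_dom X) X, set_inj (op_dom Y) Y,
          op_eq (op_inv XY) (op_comp (op_inv Y) (op_inv X)) &
          forall f, F f -> exists! u, D u /\ is_wlaplacian 2 u f]].

End Sobolev.

Arguments L2hat {R N} Omega _.
Arguments L2tilde {R N} Omega _.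
Arguments HLaptilde {R N} Omega _.
Arguments Hk0 {R N} Omega k _.
Arguments Lap0 {R N} Omega.
Arguments LapD {R N} Omega.
Arguments LapN {R N} Omega.
Arguments Lap {R N} Omega.

(* Main.v *)
Require Import Defs.
From HB Require Import structures.
From mathcomp Require Import all_boot all_order all_algebra.
From mathcomp Require Import all_classical all_reals all_analysis.
From mathcomp Require Import measurable_realfun.
From mathcomp Require Import ring lra.

Set Implicit Arguments.
Unset Strict Implicit.
Unset Printing Implicit Defensive.
Import Order.TTheory GRing.Theory Num.Theory.
Import numFieldTopology.Exports numFieldNormedType.Exports.
Local Open Scope classical_set_scope.
Local Open Scope ring_scope.

(** Every reduced Laplacian [X] maps its domain bijectively onto its target, with
    [|u| <= C |Delta u|], and the domain of the outer operator lies in the target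
    of the inner one (for Neumann because constants are harmonic), so that the
    inverses compose.  For [LapD] and [LapN] the bijection is the Riesz theorem for
    the Dirichlet form, coercive by the Friedrichs inequality (integrate
    [x_i phi^2] by parts) resp. by the Poincare inequality; that [grad u] lies in
    [Hdiv0] iff [u] is a variational Neumann solution is the bipolar theorem for
    the graphs of [grad] and [- div].  The range of [Lap0] is closed since
    [|d_i d_j phi| <= |Delta phi|] for test functions, and it is the orthogonal
    of the harmonic functions.  A preimage under [Lap] is [u - p], where [u] is
    the Dirichlet solution and [p] its projection on the harmonic functions. *)

(** * Minimisation and projection in Hilbert spaces *)

(** Nothing is known about the boundary, so traces, elliptic regularity and compact embeddings are
    out of reach. Every statement about [Hk0] or [Hdiv0] is therefore an identity or estimate for
    test functions that is carried through a closure, and every weak derivative is handled as a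
    family of pairings that is stable under L^2 limits. Weak derivatives are selected by choice, so
    even the linearity of [wlaplacian] depends on uniqueness, that is, on the density of test
    functions in L^2. Density is obtained without convolution: products of one-dimensional bumps
    increase to indicators of open boxes, boxes generate the Borel sets, and countably many boxes
    exhaust the domain. One Riesz theorem for possibly degenerate forms on a subspace serves three
    times: for the L^2 product (projection on the harmonic functions), for the Dirichlet form
    (Dirichlet and Neumann problems), and for pairs of a field and a function (bipolar argument). *)

Lemma discriminant_le (R : realFieldType) (a b c : R) : 0 <= a ->
  (forall t, 0 <= t ^+ 2 * a + 2 * t * b + c) -> b ^+ 2 <= a * c.
Proof.
rewrite le_eqVlt => /predU1P[<-|a0] H.
  have [->|b0] := eqVneq b 0; first by rewrite expr0n mul0r.
  (* With leading coefficient 0 the polynomial is affine; this point makes it equal to -1. *)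
  have := H (- (c + 1) / (2 * b)).
  have -> : (- (c + 1) / (2 * b)) ^+ 2 * 0 + 2 * (- (c + 1) / (2 * b)) * b + c = -1.
    by field.
  lra.
have := H (- b / a).
have -> : (- b / a) ^+ 2 * a + 2 * (- b / a) * b + c = (a * c - b ^+ 2) / a.
  by field; rewrite gt_eqF.
by rewrite pmulr_lge0 ?invr_gt0// subr_ge0.
Qed.

(** The left-hand side of the conclusion bounds the square of a combination a x + y. The two
    tolerances are chosen so that each summand stays below e / 2; the [+ 1] covers [a = 0]. *)
Lemma linear_small (R : realFieldType) (a p q e : R) : 0 <= p ->
  p < e / (2 * (2 * a ^+ 2 + 1)) -> q < e / 4 -> 2 * a ^+ 2 * p + 2 * q < e.
Proof.
have a2 := sqr_ge0 a; have ka : 0 < 2 * (2 * a ^+ 2 + 1) by lra.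
by move=> p0; rewrite ltr_pdivlMr// => pe qe; nra.
Qed.

Lemma scale_addBl (R : pzRingType) (V : lmodType R) a (x y s t : V) :
  a *: x + y - (a *: s + t) = a *: (x - s) + (y - t).
Proof. by rewrite scalerBr opprD addrACA. Qed.

Section forms.
Context {R : realType} {V : lmodType R}.
Implicit Types (W S : set V) (b : V -> V -> R).

Definition subspace W := W 0 /\ forall a x y, W x -> W y -> W (a *: x + y).

(** The axioms are relative to [W] because [grad_form] is additive only on [Hk 1]: outside it, the
    selected weak derivatives take a default value. *)
Definition form_on W b :=
  [/\ forall x y, W x -> W y -> b x y = b y x,
      forall a x y z, W x -> W y -> W z -> b (a *: x + y) z = a * b x z + b y z &
      forall x, W x -> 0 <= b x x].

Definition linear_on W (l : V -> R) :=
  forall a x y, W x -> W y -> l (a *: x + y) = a * l x + l y.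

(** Convergence, completeness and closure all use squared distances, so that a bare form suffices
    and no norm has to be built from it. *)
Definition form_cvg b (u : nat -> V) (x : V) :=
  forall e : R, 0 < e -> exists n0, forall n, (n0 <= n)%N -> b (u n - x) (u n - x) < e.

Definition form_cauchy b (u : nat -> V) :=
  forall e : R, 0 < e -> exists n0, forall m n, (n0 <= m)%N -> (n0 <= n)%N ->
    b (u m - u n) (u m - u n) < e.

Definition form_complete W b :=
  forall u, (forall n, W (u n)) -> form_cauchy b u -> exists2 x, W x & form_cvg b u x.

Definition form_closure b S : set V :=
  [set x | forall e : R, 0 < e -> exists2 s, S s & b (x - s) (x - s) < e].

Section subspace_theory.
Variables (W : set V) (sW : subspace W).

Lemma subspaceZ a x : W x -> W (a *: x).
Proof. by move=> Wx; have := sW.2 a x 0 Wx sW.1; rewrite addr0. Qed.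

Lemma subspaceD x y : W x -> W y -> W (x + y).
Proof. by move=> Wx Wy; have := sW.2 1 x y Wx Wy; rewrite scale1r. Qed.

Lemma subspaceN x : W x -> W (- x).
Proof. by move=> Wx; rewrite -scaleN1r; exact: subspaceZ. Qed.

Lemma subspaceB x y : W x -> W y -> W (x - y).
Proof. by move=> Wx Wy; apply: subspaceD => //; exact: subspaceN. Qed.

Lemma linear_on0 l : linear_on W l -> l 0 = 0.
Proof. by move=> /(_ 1 0 0 sW.1 sW.1); rewrite scaler0 addr0; lra. Qed.

Lemma linear_onZ l a x : linear_on W l -> W x -> l (a *: x) = a * l x.
Proof.
by move=> lW Wx; have := lW a x 0 Wx sW.1; rewrite addr0 (linear_on0 lW) addr0.
Qed.

Lemma linear_onD l x y : linear_on W l -> W x -> W y -> l (x + y) = l x + l y.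
Proof. by move=> lW Wx Wy; have := lW 1 x y Wx Wy; rewrite scale1r mul1r. Qed.

Section form_theory.
Variables (b : V -> V -> R) (fb : form_on W b).

Lemma formC x y : W x -> W y -> b x y = b y x. Proof. by case: fb => + _ _; exact. Qed.

Lemma form_ge0 x : W x -> 0 <= b x x. Proof. by case: fb => _ _; exact. Qed.

Lemma form_linearl z : W z -> linear_on W (b^~ z).
Proof. by case: fb => _ bL _ Wz a x y Wx Wy; exact: bL. Qed.

Lemma form_linearr z : W z -> linear_on W (b z).
Proof.
move=> Wz a x y Wx Wy; rewrite formC// ?form_linearl// ?(formC Wz)//.
exact: sW.2.
Qed.

Lemma formBl x y z : W x -> W y -> W z -> b (x - y) z = b x z - b y z.
Proof.
by move=> Wx Wy Wz; rewrite -scaleN1r addrC (form_linearl Wz)// addrC mulN1r.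
Qed.

Lemma form_sqr a c x y : W x -> W y ->
  b (a *: x + c *: y) (a *: x + c *: y) =
  a ^+ 2 * b x x + 2 * a * c * b x y + c ^+ 2 * b y y.
Proof.
move=> Wx Wy; have Wcy := subspaceZ c Wy; have Wax := subspaceZ a Wx.
have Ws := subspaceD Wax Wcy.
rewrite (linear_onD (form_linearl Ws))// !(linear_onD (form_linearr _))//.
rewrite !(linear_onZ _ (form_linearl _))// !(linear_onZ _ (form_linearr _))//.
by rewrite (formC Wy Wx); ring.
Qed.

Lemma form_sqrD x y : W x -> W y -> b (x + y) (x + y) = b x x + 2 * b x y + b y y.
Proof.
by move=> Wx Wy; have := form_sqr 1 1 Wx Wy; rewrite !scale1r => ->; ring.
Qed.

Lemma form_sqrB x y : W x -> W y -> b (x - y) (x - y) = b x x - 2 * b x y + b y y.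
Proof.
move=> Wx Wy; have := form_sqr 1 (-1) Wx Wy; rewrite scale1r scaleN1r => ->; ring.
Qed.

Lemma form_sqr_distC x y : W x -> W y -> b (x - y) (x - y) = b (y - x) (y - x).
Proof. by move=> Wx Wy; rewrite !form_sqrB// (formC Wy Wx); ring. Qed.

Lemma form_cauchy_schwarz x y : W x -> W y -> b x y ^+ 2 <= b x x * b y y.
Proof.
move=> Wx Wy; apply: discriminant_le; first exact: form_ge0.
move=> t; have := form_ge0 (sW.2 t x y Wx Wy).
by have := form_sqr t 1 Wx Wy; rewrite scale1r => ->; rewrite expr1n mul1r mulr1.
Qed.

Lemma form_sqrD_le x y : W x -> W y -> b (x + y) (x + y) <= 2 * b x x + 2 * b y y.
Proof.
move=> Wx Wy; have := form_ge0 (subspaceB Wx Wy).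
by rewrite form_sqrB// form_sqrD//; lra.
Qed.

Lemma form_sqr_le_dist x y z : W x -> W y -> W z ->
  b (x - z) (x - z) <= 2 * b (x - y) (x - y) + 2 * b (y - z) (y - z).
Proof.
move=> Wx Wy Wz; rewrite -[X in b X](subrKA y) addrA.
by rewrite -[X in b _ X](subrKA y) addrA -addrA; apply: form_sqrD_le; exact: subspaceB.
Qed.

(* Minimises the energy [b x x - 2 l x] over [W]; nearly minimal points form a
   Cauchy sequence by the parallelogram identity, and are nearly critical
   because the discriminant of the energy along any line is small. *)
Lemma riesz_on l (C : R) : form_complete W b -> linear_on W l ->
  (forall x, W x -> l x ^+ 2 <= C * b x x) ->
  exists2 p, W p & forall w, W w -> b p w = l w.
Proof.
move=> cW lW lC.
pose J x := b x x - 2 * l x.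
have C0 x : W x -> 0 <= C * b x x by move=> /lC; apply: le_trans; exact: sqr_ge0.
pose E := J @` W.
(* From t^2 <= c q and 4 c q <= (q + c)^2 one gets 2 t <= q + c, which bounds the energy from
   below. *)
have Jlb x : W x -> - `|C| <= J x.
  move=> Wx; have := lC x Wx; have := form_ge0 Wx; rewrite /J.
  have := ler_norm C; have := normr_ge0 C; move: `|C| (b x x) (l x) => c q t.
  move=> c0 Cc q0 tq; rewrite leNgt; apply/negP => qt.
  have Cq : C * q <= c * q by rewrite ler_wpM2r.
  have : 0 < (2 * t - (q + c)) * (2 * t + (q + c)) by apply: mulr_gt0; lra.
  have := sqr_ge0 (q - c); nra.
have Einf : has_inf E.
  split; first by exists (J 0); exists 0 => //; exact: sW.1.
  by exists (- `|C|) => _ [x Wx <-]; exact: Jlb.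
set m := inf E.
have Jm x : W x -> m <= J x by move=> Wx; apply: ge_inf; [exact: Einf.2|exists x].
have /choice[u uP] : forall n : nat, exists x, W x /\ J x < m + n.+1%:R^-1.
  move=> n; have [|_ [x Wx <-] Jx] := @inf_adherent _ E n.+1%:R^-1 _ Einf.
    by rewrite invr_gt0.
  by exists x.
have invlt (e : R) : 0 < e -> exists n0, forall n, (n0 <= n)%N -> n.+1%:R^-1 < e.
  move=> e0; have [n0 _ H] := near_infty_natSinv_lt (PosNum e0).
  by exists n0 => n nn; exact: H.
have Wu n : W (u n) by have [] := uP n.
have Jpar x y : W x -> W y ->
    b (x - y) (x - y) = 2 * J x + 2 * J y - 4 * J (2^-1 *: x + 2^-1 *: y).
  move=> Wx Wy; rewrite /J form_sqr// form_sqrB// lW//; last exact: subspaceZ.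
  by rewrite (linear_onZ _ lW)//; field.
have ucau : form_cauchy b u.
  move=> e e0; have [|n0 n0P] := invlt (e / 4); first by rewrite divr_gt0.
  exists n0 => i j /n0P i0 /n0P j0.
  rewrite Jpar//.
  have := Jm (2^-1 *: u i + 2^-1 *: u j).
  move=> /(_ (sW.2 _ _ _ (Wu i) (subspaceZ _ (Wu j)))).
  have [_] := uP i; have [_] := uP j; move: i0 j0.
  move: (J _) (J _) (J _) (i.+1%:R^-1) (j.+1%:R^-1) => ? ? ? ? ?; lra.
have [p Wp up] := cW u Wu ucau.
exists p => // w Ww.
have crit n : (b (u n) w - l w) ^+ 2 <= b w w * n.+1%:R^-1.
  apply: discriminant_le; first exact: form_ge0.
  move=> t; have := Jm (t *: w + u n) (sW.2 _ _ _ Ww (Wu n)).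
  have := form_sqr t 1 Ww (Wu n); rewrite scale1r => bE.
  rewrite /J bE lW// (formC Ww (Wu n)); have [_] := uP n; rewrite /J.
  by move: (b w w) (b _ _) (b _ _) (l _) (l _) (n.+1%:R^-1) => ? ? ? ? ? ?; lra.
have upw n : (b (u n) w - b p w) ^+ 2 <= b (u n - p) (u n - p) * b w w.
  have <- : b (u n - p) w = b (u n) w - b p w.
    exact: formBl.
  by apply: form_cauchy_schwarz => //; exact: subspaceB.
have w0 := form_ge0 Ww.
apply/eqP; rewrite -subr_eq0 -sqrf_eq0; apply/eqP/le_anti; rewrite sqr_ge0 andbT.
apply/ler_addgt0Pl => e e0; rewrite addr0.
(* The square of a sum of two errors costs a factor 2 on each, and each squared error is at most d
   times [b w w]. The [+ 1] covers [b w w = 0]. *)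
pose d := e / (4 * (b w w + 1)).
have d0 : 0 < d by rewrite divr_gt0// mulr_gt0//; lra.
have [n1 n1P] := invlt _ d0; have [n2 n2P] := up _ d0.
pose n := maxn n1 n2.
have := n1P n (leq_maxl _ _); have := n2P n (leq_maxr _ _).
have := crit n; have := upw n.
have de : 4 * d * (b w w + 1) = e by rewrite /d; field; apply/eqP; lra.
move: (b (u n) w) (b p w) (l w) (b (u n - p) (u n - p)) (n.+1%:R^-1) (b w w) w0 d0 de.
move=> x y z q r s s0 d0 de H1 H2 qd rd.
have : s * r <= s * d by rewrite ler_wpM2l// ltW.
have : q * s <= d * s by rewrite ler_wpM2r// ltW.
have := sqr_ge0 ((x - z) + (x - y)); rewrite sqrrD.
by nra.
Qed.

End form_theory.
End subspace_theory.

Lemma form_onS W W' b : W `<=` W' -> form_on W' b -> form_on W b.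
Proof.
move=> WW [bC bL b0]; split=> [x y /WW ? /WW ?|a x y z /WW ? /WW ? /WW ?|x /WW ?].
- exact: bC.
- exact: bL.
- exact: b0.
Qed.

Lemma subspaceT : subspace [set: V]. Proof. by []. Qed.

Section hilbert.
Variables (b : V -> V -> R) (fb : form_on setT b) (cb : form_complete setT b).
Let sT := subspaceT.

Lemma form_closure_subspace S : subspace S -> subspace (form_closure b S).
Proof.
move=> sS; split=> [e e0|a x y xS yS e e0].
  by exists 0; [exact: sS.1|rewrite subr0 (linear_on0 sT (form_linearl fb I))].
have ka : 0 < 2 * (2 * a ^+ 2 + 1) by have := sqr_ge0 a; lra.
have [s Ss sx] := xS (e / (2 * (2 * a ^+ 2 + 1))) ltac:(by rewrite divr_gt0).
have [t St ty] := yS (e / 4) ltac:(by rewrite divr_gt0).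
exists (a *: s + t); first exact: sS.2.
rewrite scale_addBl; apply: le_lt_trans (form_sqrD_le sT fb I I) _.
have := form_sqr sT fb a 0 (I : setT (x - s)) (I : setT (x - s)).
rewrite scale0r addr0 expr0n mulr0 !mul0r !addr0 => ->; rewrite mulrA.
by apply: linear_small ty => //; exact: (form_ge0 fb I).
Qed.

Lemma sub_form_closure S : S `<=` form_closure b S.
Proof.
by move=> x Sx e e0; exists x => //; rewrite subrr (linear_on0 sT (form_linearl fb I)).
Qed.

Lemma form_closure_complete S : form_complete (form_closure b S) b.
Proof.
move=> u Su ucau; have [x _ ux] := cb (fun=> I) ucau.
exists x => // e e0; have e4 : 0 < e / 4 by rewrite divr_gt0.
have [n0 n0P] := ux _ e4; have [s Ss us] := Su n0 _ e4.
exists s => //; have := n0P _ (leqnn _).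
rewrite (form_sqr_distC sT fb I I).
have := form_sqr_le_dist sT fb (I : setT x) (I : setT (u n0)) (I : setT s).
lra.
Qed.

(** The projection is the Riesz representative in [W] of the functional [b x], which Cauchy-Schwarz
    bounds with constant [b x x]. *)
Lemma form_projection W : subspace W -> form_complete W b ->
  forall x, exists2 p, W p & forall w, W w -> b (x - p) w = 0.
Proof.
move=> sW cW x.
have [] := @riesz_on W sW b (form_onS (fun _ _ => I) fb) (b x) (b x x) cW.
- by move=> a y z _ _; apply: (form_linearr sT fb).
- by move=> y _; apply: (form_cauchy_schwarz sT fb).
move=> p Wp pP; exists p => // w Ww.
by rewrite (formBl fb I I I) pP// subrr.
Qed.

(** This extends Green formulas from test functions to closures: an identity linear in [x] is
    rewritten as orthogonality to a fixed [y], and Cauchy-Schwarz makes [b x y] continuous in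
    [x]. *)
Lemma form_closure_orth S y : (forall s, S s -> b s y = 0) ->
  forall x, form_closure b S x -> b x y = 0.
Proof.
move=> yS x xS; apply/eqP; rewrite -sqrf_eq0; apply/eqP/le_anti.
rewrite sqr_ge0 andbT; apply/ler_addgt0Pl => e e0; rewrite addr0.
have y0 := form_ge0 fb (I : setT y).
have k0 : 0 < b y y + 1 by lra.
have [s Ss xs] := xS (e / (b y y + 1)) ltac:(by rewrite divr_gt0).
have -> : b x y = b (x - s) y.
  by rewrite (formBl fb I I I) (yS s Ss) subr0.
apply: le_trans (form_cauchy_schwarz sT fb I I) _.
have -> : e = e / (b y y + 1) * (b y y + 1) by field; apply/eqP; lra.
apply: ler_pM; [exact: form_ge0 fb _ I|exact: y0|exact: ltW|lra].
Qed.

(** Let p be the projection of [x] on the closure of [S]. Then x - p is orthogonal to [S], hence to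
    [x] by hypothesis and to p by continuity, so its square is 0. As the form may be degenerate,
    this does not yield x = p, but elements of [S] close to p are just as close to [x]. *)
Lemma form_bipolar S x : subspace S ->
  (forall y, (forall s, S s -> b s y = 0) -> b x y = 0) -> form_closure b S x.
Proof.
move=> sS xS.
have sC := form_closure_subspace sS.
have [p pS xp] := form_projection sC (@form_closure_complete S) x.
have yS s : S s -> b s (x - p) = 0.
  by move=> Ss; rewrite (formC fb)// xp//; exact: sub_form_closure.
have xp0 : b (x - p) (x - p) = 0.
  by rewrite (formBl fb I I I) xS// (form_closure_orth yS)// subrr.
move=> e e0; have [s Ss ps] := pS (e / 2) ltac:(by rewrite divr_gt0).
exists s => //; have := form_sqr_le_dist sT fb (I : setT x) (I : setT p) (I : setT s).
by rewrite xp0; lra.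
Qed.

End hilbert.
End forms.

(** * The Hilbert space L^2 *)

Section square_integrable.
Context d (T : measurableType d) (R : realType) (mu : {measure set T -> \bar R}).

Lemma Lfun2P (f : T -> R) : f \in Lfun mu 2%:E <->
  measurable_fun setT f /\ (\int[mu]_x ((f x) ^+ 2)%:E < +oo)%E.
Proof.
have sqE : (\int[mu]_x ((f x) ^+ 2)%:E = \int[mu]_x `|(f x)%:E| `^ 2)%E.
  by apply: eq_integral => x _ /=; rewrite powR_mulrn// real_normK// num_real.
split=> [|[mf fi]].
  rewrite inE => /andP[]; rewrite !inE/= => mf; rewrite /finite_norm unlock /= => H.
  split=> //; rewrite sqE; apply: lty_poweRy H; by rewrite invr_eq0.
rewrite inE; apply/andP; split; rewrite inE//=.
by rewrite /finite_norm unlock /= poweR_lty// -sqE.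
Qed.

Lemma limn_einf_le_near (u : (\bar R)^nat) (e : \bar R) j :
  (forall k, (j <= k)%N -> (u k <= e)%E) -> (limn_einf u <= e)%E.
Proof.
move=> ue; rewrite limn_einf_lim; apply: lime_le; first exact: is_cvg_einfs.
apply: nearW => n; apply: ereal_inf_le; exists (u (maxn n j)).
  by exists (maxn n j) => //=; exact: leq_maxl.
by apply: ue; exact: leq_maxr.
Qed.

(** A fast subsequence has a telescoping series that is dominated almost everywhere by a geometric
    one, which gives a pointwise limit. Fatou's lemma then turns the Cauchy bounds into bounds on
    the distance to that limit. *)
Lemma riesz_fischer (u : nat -> T -> R) : (forall n, measurable_fun setT (u n)) ->
  (forall e : R, 0 < e -> exists n0, forall m n, (n0 <= m)%N -> (n0 <= n)%N ->
     (\int[mu]_x ((u m x - u n x) ^+ 2)%:E < e%:E)%E) ->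
  exists2 f : T -> R, measurable_fun setT f & forall e : R, 0 < e ->
    exists n0, forall n, (n0 <= n)%N ->
      (\int[mu]_x ((u n x - f x) ^+ 2)%:E <= e%:E)%E.
Proof.
move=> mu_ ucau.
(* The factor 4^-k pays for the weight 4^k in [D]; the remaining 2^-(k+1) sum to 1. *)
pose eps k : R := (2 ^+ k.+1)^-1 / 4 ^+ k.
have eps0 k : 0 < eps k by rewrite divr_gt0 ?invr_gt0 ?exprn_gt0.
have /choice[s0 s0P] : forall k, exists n0, forall m n, (n0 <= m)%N -> (n0 <= n)%N ->
    (\int[mu]_x ((u m x - u n x) ^+ 2)%:E < (eps k)%:E)%E.
  by move=> k; exact: ucau.
(* The index [s k] lies beyond [s0 i] for every [i <= k]. This gives the distance of consecutive
   terms of [v], and later the distance of [u n] to all late [v k]. *)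
pose s k := (\sum_(i < k.+1) s0 i)%N.
have s0s i k : (i <= k)%N -> (s0 i <= s k)%N.
  by move=> ik; rewrite /s (bigD1 (Ordinal (ik : (i < k.+1)%N)))//= leq_addr.
pose v k := u (s k).
have mv k : measurable_fun setT (v k) by exact: mu_.
pose D k x : \bar R := (4 ^+ k * (v k.+1 x - v k x) ^+ 2)%:E.
have D0 k x : (0 <= D k x)%E by rewrite lee_fin mulr_ge0 ?sqr_ge0// exprn_ge0.
have msq (f g : T -> R) : measurable_fun setT f -> measurable_fun setT g ->
    measurable_fun setT (fun x => ((f x - g x) ^+ 2)%:E).
  move=> mf mg; apply/measurable_EFinP; apply: measurable_funX.
  exact: measurable_funB.
have mD k : measurable_fun setT (D k).
  rewrite (_ : D k = (fun x => (4 ^+ k)%:E * ((v k.+1 x - v k x) ^+ 2)%:E)%E).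
    by apply: measurable_funeM; exact: msq.
  by apply/funext => x; rewrite /D EFinM.
pose G x := (\sum_(k <oo) D k x)%E.
have mG : measurable_fun setT G by apply: ge0_emeasurable_sum.
have Gi : mu.-integrable setT G.
  apply/integrableP; split => //.
  under eq_integral do rewrite gee0_abs ?nneseries_ge0//.
  rewrite integral_nneseries//.
  apply: (@le_lt_trans _ _ 1%:E); last exact: ltry.
  apply: le_trans (epsilon_trick0 xpredT ler01).
  apply: lee_nneseries => [k _ _|k _]; first by apply: integral_ge0.
  rewrite /D; under eq_integral do rewrite EFinM.
  rewrite ge0_integralZl//; last 2 first.
  - exact: msq.
  - by move=> x _; rewrite lee_fin sqr_ge0.
  have := s0P k (s k.+1) (s k) (s0s _ _ (leqnSn k)) (s0s _ _ (leqnn k)).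
  move=> /ltW H; apply: (@le_trans _ _ ((4 ^+ k)%:E * (eps k)%:E)%E).
    by apply: lee_wpmul2l H; rewrite lee_fin exprn_ge0.
  by rewrite -EFinM lee_fin /eps mulrCA mulfV ?mulr1 ?div1r ?natrX// gt_eqF.
pose A := [set x | G x \is a fin_num].
have mA : measurable A.
  rewrite (_ : A = setT `&` G @^-1` [set x | x \is a fin_num]); last by rewrite setTI.
  exact: emeasurable_fin_num.
(* Killing the sequence outside [A] makes it converge everywhere, so that the limit is measurable;
   [A] has null complement because [G] is integrable. *)
pose w k x := \1_A x * v k x.
have mw k : measurable_fun setT (w k).
  by apply: measurable_funM => //; exact: measurable_indic.
have wcvg x : cvgn (w ^~ x).
  have [Ax|Ax] := pselect (A x); last first.
    rewrite (_ : w ^~ x = cst 0); first exact: is_cvg_cst.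
    by apply/funext => k; rewrite /w indicE memNset// mul0r.
  have -> : w ^~ x = v ^~ x.
    by apply/funext => k; rewrite /w indicE mem_set// mul1r.
  pose g := fine (G x).
  have Dg k : 4 ^+ k * (v k.+1 x - v k x) ^+ 2 <= g.
    rewrite -lee_fin fineK//.
    apply: le_trans (nneseries_lim_ge k.+1 _) => //.
    rewrite big_nat_recr//= leeDr// sume_ge0//.
  have g0 : 0 <= g by apply: le_trans (Dg 0%N); rewrite mul1r sqr_ge0.
  (* The bound by sqrt g times 2^-k is relaxed using g <= (g + 1)^2, which avoids the square
     root. *)
  have vd k : `|v k.+1 x - v k x| <= geometric (g + 1) 2^-1 k.
    rewrite /geometric /= -[leRHS]ger0_norm; last first.
      by rewrite mulr_ge0 ?exprn_ge0 ?invr_ge0//; lra.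
    rewrite -ler_sqr ?nnegrE// !real_normK ?num_real//.
    have k4 : (2^-1 : R) ^+ k ^+ 2 = (4 ^+ k)^-1.
      by rewrite exprAC exprVn -natrX exprVn.
    rewrite exprMn k4 ler_pdivlMr ?exprn_gt0// mulrC.
    apply: le_trans (Dg k) _; nra.
  have /cvg_ex[l sl] : cvgn (series (fun k => v k.+1 x - v k x)).
    apply: normed_cvg; apply: (series_le_cvg _ _ vd) => //.
    - by move=> k; apply: le_trans (vd k).
    - by apply: is_cvg_geometric_series; rewrite gtr0_norm ?invr_gt0// invf_lt1// ltr1n.
  apply/cvg_ex; exists (v 0%N x + l).
  rewrite (_ : v ^~ x = (fun n => v 0%N x + series (fun k => v k.+1 x - v k x) n)).
    by apply: cvgD => //; exact: cvg_cst.
  by apply/funext => n /=; rewrite /series/= telescope_sumr//; ring.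
pose f x := limn (w ^~ x).
exists f.
  by apply: (measurable_fun_cvg mw) => x _; exact: wcvg.
have aeA : {ae mu, forall x, A x}.
  by have := integrable_ae measurableT Gi; apply: filterS => x; exact.
move=> e e0.
have [n0 n0P] := ucau e e0.
have [j ej] : exists j, eps j <= e.
  have [k _ kP] := near_infty_natSinv_lt (PosNum e0).
  exists k; apply: le_trans (ltW (kP k (leqnn k))).
  rewrite /eps -invfM lef_pV2 ?posrE ?mulr_gt0 ?exprn_gt0//.
  rewrite -natrX -natrX -natrM ler_nat.
  apply: (@leq_trans (2 ^ k.+1)); last by rewrite leq_pmulr// expn_gt0.
  exact/ltnW/ltn_expl.
exists (s0 j) => n nj.
(* Here [n] is fixed and [k] tends to infinity, so that Fatou applies to the integrals of (u n - w
   k)^2. *)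
have -> : (\int[mu]_x ((u n x - f x) ^+ 2)%:E =
    \int[mu]_x limn_einf (fun k => ((u n x - w k x) ^+ 2)%:E))%E.
  apply: eq_integral => x _; apply/esym.
  have H : (fun k => ((u n x - w k x) ^+ 2)%:E) @ \oo --> ((u n x - f x) ^+ 2)%:E.
    apply: cvg_EFin; first exact: nearW.
    have H1 : (u n x - w k x) @[k --> \oo] --> u n x - f x.
      by apply: cvgB; [exact: cvg_cst|exact: wcvg].
    rewrite /comp /= expr2; under eq_fun do rewrite expr2.
    exact: cvgM.
  by have [->] := cvg_limn_einf_sup H.
apply: le_trans (fatou _ _ _ _) _ => //.
- by move=> k; exact: msq.
- by move=> k x _; rewrite lee_fin sqr_ge0.
apply: (@limn_einf_le_near _ _ j) => k jk.
rewrite (_ : (\int[mu]_x _ = \int[mu]_x ((u n x - v k x) ^+ 2)%:E)%E).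
  apply: le_trans (ltW (s0P j n (s k) nj (s0s _ _ jk))) _.
  by rewrite lee_fin.
apply: ge0_ae_eq_integral => //.
- exact: msq.
- exact: msq.
- by move=> x _; rewrite lee_fin sqr_ge0.
- by move=> x _; rewrite lee_fin sqr_ge0.
by apply: filterS aeA => x Ax _; rewrite /w indicE mem_set// mul1r.
Qed.

End square_integrable.

Section Lfun2_closure.
Context d (T : measurableType d) (R : realType) (mu : {measure set T -> \bar R}).
Local Notation L := (Lfun mu 2%:E).

Lemma Lfun2D (f g : T -> R) : f \in L -> g \in L -> (fun x => f x + g x) \in L.
Proof. move=> fL gL; exact: (Lfun_addr_closed mu (lee1n 2)).2. Qed.

Lemma Lfun2Z a (f : T -> R) : f \in L -> (fun x => a * f x) \in L.
Proof.
move=> fL; have := Lfun_scale a (_ : 1 <= 2) fL; rewrite ler1n => /(_ isT).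
by rewrite (_ : _ \o* _ = (fun x => a * f x))//; apply/funext => x /=; rewrite mulrC.
Qed.

Lemma Lfun2_integrableM (f g : T -> R) : f \in L -> g \in L ->
  mu.-integrable setT (EFin \o (fun x => f x * g x)).
Proof. by move=> fL gL; apply/Lfun1_integrable; exact: Lfun2_mul_Lfun1. Qed.

End Lfun2_closure.

Section L2_module.
Context {R : realType} {N : nat} (Omega : domain R N).
Local Notation mu := (lebesgue_on Omega).
Local Notation H := (L2 Omega).
Local Notation T := ('rV[R]_N).
Implicit Types u v w : H.

(** [cls f] is the class of [f], or [0] if [f] is not square integrable. *)
Definition cls (f : T -> R) : H :=
  xget (L2zero Omega) [set u : H | u = f %[ae mu]].

Lemma clsE (f : T -> R) : f \in Lfun mu 2%:E -> cls f = f %[ae mu].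
Proof.
move=> fL; have ex : exists u : H, u = f %[ae mu].
  exists (L2_class (Lfun_Sub (lee1n 2) fL)).
  exact: (L2_classK (Lfun_Sub (lee1n 2) fL)).
exact: (@xgetPex _ (L2zero Omega) [set u : H | u = f %[ae mu]] ex).
Qed.

Lemma L2_Lfun u : (u : T -> R) \in Lfun mu 2%:E.
Proof. exact: L2_fun_subproof. Qed.

Lemma L2zeroE : L2zero Omega = (fun=> 0) %[ae mu].
Proof. exact: L2_classK. Qed.

Lemma cls_ae u (f : T -> R) : u = f %[ae mu] -> cls f = u.
Proof.
move=> uf; apply/L2_eqP.
have : cls f = f %[ae mu].
  have ex : exists u : H, u = f %[ae mu] by exists u.
  exact: (@xgetPex _ (L2zero Omega) [set v : H | v = f %[ae mu]] ex).
by move: uf; apply: filterS2 => x /= + + _ => -> // ->.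
Qed.

Lemma clsK u : cls u = u.
Proof. by apply: cls_ae; exact: (ae_eq_refl mu setT). Qed.

Definition L2add u v : H := cls (fun x => u x + v x).
Definition L2scale a u : H := cls (fun x => a * u x).

Let addE u v : L2add u v = (fun x => u x + v x) %[ae mu].
Proof. by apply: clsE; apply: Lfun2D; exact: L2_Lfun. Qed.

Let scaleE a u : L2scale a u = (fun x => a * u x) %[ae mu].
Proof. by apply: clsE; apply: Lfun2Z; exact: L2_Lfun. Qed.

Let oppE u : L2opp u = (fun x => - u x) %[ae mu].
Proof. exact: L2_classK. Qed.

Let addA : associative L2add.
Proof.
move=> u v w; apply/L2_eqP.
near=> x => _; rewrite (near (addE u (L2add v w)) x)// (near (addE v w) x)//.
by rewrite (near (addE (L2add u v) w) x)// (near (addE u v) x)// addrA.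
Unshelve. all: by end_near. Qed.

Let addC : commutative L2add.
Proof.
move=> u v; apply/L2_eqP.
near=> x => _; rewrite (near (addE u v) x)// (near (addE v u) x)//.
by rewrite addrC.
Unshelve. all: by end_near. Qed.

Let add0 : left_id (L2zero Omega) L2add.
Proof.
move=> u; apply/L2_eqP.
near=> x => _; rewrite (near (addE (L2zero Omega) u) x)// (near L2zeroE x)//.
by rewrite add0r.
Unshelve. all: by end_near. Qed.

Let addN : left_inverse (L2zero Omega) (@L2opp R N Omega) L2add.
Proof.
move=> u; apply/L2_eqP.
near=> x => _; rewrite (near (addE (L2opp u) u) x)// (near L2zeroE x)//.
by rewrite (near (oppE u) x)// addNr.
Unshelve. all: by end_near. Qed.

HB.instance Definition _ := GRing.isZmodule.Build H addA addC add0 addN.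

Let scaleA a b u : L2scale a (L2scale b u) = L2scale (a * b) u.
Proof.
apply/L2_eqP.
near=> x => _; rewrite (near (scaleE a (L2scale b u)) x)// (near (scaleE b u) x)//.
by rewrite (near (scaleE (a * b) u) x)// mulrA.
Unshelve. all: by end_near. Qed.

Let scale1 : left_id 1 L2scale.
Proof.
move=> u; apply/L2_eqP.
by near=> x => _; rewrite (near (scaleE 1 u) x)// mul1r.
Unshelve. all: by end_near. Qed.

Let scaleDr : right_distributive L2scale +%R.
Proof.
move=> a u v; apply/L2_eqP.
near=> x => _; rewrite (near (scaleE a (u + v)) x)// (near (addE u v) x)//.
rewrite (near (addE (L2scale a u) (L2scale a v)) x)//.
by rewrite (near (scaleE a u) x)// (near (scaleE a v) x)// mulrDr.
Unshelve. all: by end_near. Qed.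

Let scaleDl u : {morph L2scale^~ u : a b / a + b}.
Proof.
move=> a b; apply/L2_eqP.
near=> x => _; rewrite (near (scaleE (a + b) u) x)//.
rewrite (near (addE (L2scale a u) (L2scale b u)) x)//.
by rewrite (near (scaleE a u) x)// (near (scaleE b u) x)// mulrDl.
Unshelve. all: by end_near. Qed.

HB.instance Definition _ :=
  GRing.Zmodule_isLmodule.Build R H scaleA scale1 scaleDr scaleDl.

Lemma L2addE u v : (u + v : H) = (fun x => u x + v x) %[ae mu]. Proof. exact: addE. Qed.
Lemma L2scaleE a u : (a *: u : H) = (fun x => a * u x) %[ae mu]. Proof. exact: scaleE. Qed.
Lemma L2oppE u : (- u : H) = (fun x => - u x) %[ae mu]. Proof. exact: oppE. Qed.
Lemma L2_0E : (0 : H) = (fun=> 0) %[ae mu]. Proof. exact: L2zeroE. Qed.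

Lemma L2subE u v : (u - v : H) = (fun x => u x - v x) %[ae mu].
Proof.
near=> x => _; rewrite (near (L2addE u (- v)) x)//.
by rewrite (near (L2oppE v) x).
Unshelve. all: by end_near. Qed.

Lemma cls_linear a (f g : T -> R) : f \in Lfun mu 2%:E -> g \in Lfun mu 2%:E ->
  cls (fun x => a * f x + g x) = a *: cls f + cls g.
Proof.
move=> fL gL; apply: cls_ae.
near=> x => _; rewrite (near (L2addE _ _) x)// (near (L2scaleE _ _) x)//.
by rewrite (near (clsE fL) x)// (near (clsE gL) x).
Unshelve. all: by end_near. Qed.

Lemma eq_integrand_Rintegral (f g : T -> R) :
  mu.-integrable setT (EFin \o f) -> measurable_fun setT g ->
  f = g %[ae mu] -> \int[mu]_x f x = \int[mu]_x g x.
Proof.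
move=> fi mg fg; congr fine; apply: ae_eq_integral => //.
- exact: measurable_int fi.
- exact/measurable_EFinP.
- by apply: filterS fg => x /= + _ => ->.
Qed.

Lemma ae_eq_pairing (f f' g g' : T -> R) :
  f \in Lfun mu 2%:E -> g \in Lfun mu 2%:E ->
  measurable_fun setT f' -> measurable_fun setT g' ->
  f = f' %[ae mu] -> g = g' %[ae mu] -> pairing Omega f g = pairing Omega f' g'.
Proof.
move=> fL gL mf mg ff gg; apply: eq_integrand_Rintegral.
- exact: Lfun2_integrableM.
- exact: measurable_funM.
- by apply: filterS2 ff gg => x /= + + _ => -> // ->.
Qed.

Definition dot u v : R := pairing Omega u v.

Lemma Lfun2_measurable (f : T -> R) : f \in Lfun mu 2%:E -> measurable_fun setT f.
Proof. by move=> /Lfun2P[]. Qed.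

Lemma dot_cls u (f : T -> R) : f \in Lfun mu 2%:E -> dot u (cls f) = pairing Omega u f.
Proof.
move=> fL; apply: ae_eq_pairing; [exact: L2_Lfun|exact: L2_Lfun|..] => //.
- exact: Lfun2_measurable (L2_Lfun u).
- exact: Lfun2_measurable.
- exact: (ae_eq_refl mu setT).
- exact: clsE.
Qed.

Lemma dot_cls2 (f g : T -> R) : f \in Lfun mu 2%:E -> g \in Lfun mu 2%:E ->
  dot (cls f) (cls g) = pairing Omega f g.
Proof.
move=> fL gL; apply: ae_eq_pairing; [exact: L2_Lfun|exact: L2_Lfun|..] => //.
- exact: Lfun2_measurable.
- exact: Lfun2_measurable.
- exact: clsE.
- exact: clsE.
Qed.

Lemma dot_form : form_on [set: H] dot.
Proof.
split=> [u v _ _|a u v w _ _ _|u _].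
- by rewrite /dot /pairing; under eq_Rintegral do rewrite mulrC.
- transitivity (pairing Omega (fun x => a * u x + v x) w).
    apply: ae_eq_pairing; [exact: L2_Lfun|exact: L2_Lfun| | | |
      exact: (ae_eq_refl mu setT)].
    + apply: (@Lfun2_measurable (fun x => a * u x + v x)).
      by apply: Lfun2D; [apply: Lfun2Z|]; exact: L2_Lfun.
    + exact: Lfun2_measurable (L2_Lfun w).
    near=> x => _; rewrite (near (L2addE (a *: u) v) x)//.
    by rewrite (near (L2scaleE a u) x).
  have uw := Lfun2_integrableM (L2_Lfun u) (L2_Lfun w).
  have vw := Lfun2_integrableM (L2_Lfun v) (L2_Lfun w).
  rewrite /dot /pairing -RintegralZl// -RintegralD//.
    by apply: eq_Rintegral => x _; rewrite mulrDl mulrA.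
  have := integrableZl measurableT a uw.
  by apply: eq_integrable => // x _ /=.
- by apply: Rintegral_ge0 => x _; rewrite -expr2 sqr_ge0.
Unshelve. all: by end_near. Qed.

Lemma dot_sqrE u : ((dot u u)%:E = \int[mu]_x ((u x) ^+ 2)%:E)%E.
Proof.
rewrite /dot /pairing fineK; last first.
  by apply: integrable_fin_num => //; exact: Lfun2_integrableM (L2_Lfun u) (L2_Lfun u).
by apply: eq_integral.
Qed.

Lemma dot_dist_cls u (f : T -> R) : f \in Lfun mu 2%:E ->
  ((dot (u - cls f) (u - cls f))%:E = \int[mu]_x ((u x - f x) ^+ 2)%:E)%E.
Proof.
move=> fL; have mu_ := Lfun2_measurable (L2_Lfun u).
rewrite dot_sqrE; apply: ge0_ae_eq_integral => //.
- apply/measurable_EFinP/measurable_funX.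
  exact: Lfun2_measurable (L2_Lfun _).
- apply/measurable_EFinP/measurable_funX/measurable_funB => //.
  exact: Lfun2_measurable.
- by move=> x _; rewrite lee_fin sqr_ge0.
- by move=> x _; rewrite lee_fin sqr_ge0.
near=> x => _; rewrite (near (L2subE u (cls f)) x)//.
by rewrite (near (clsE fL) x).
Unshelve. all: by end_near. Qed.

Lemma dot_complete : form_complete [set: H] dot.
Proof.
move=> u _ ucau.
have mu_ n := Lfun2_measurable (L2_Lfun (u n)).
have [||f mf fP] := @riesz_fischer _ _ _ mu (fun n => u n : T -> R).
- by [].
- move=> e /ucau[n0 n0P]; exists n0 => m n mn nn.
  have := dot_dist_cls (u m) (L2_Lfun (u n)); rewrite clsK => <-.
  by rewrite lte_fin; exact: n0P.
have fL : f \in Lfun mu 2%:E.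
  have [n0 /(_ _ (leqnn _)) n0P] := fP 1 ltr01.
  have uL : (fun x => u n0 x - f x) \in Lfun mu 2%:E.
    apply/Lfun2P; split; first exact: measurable_funB.
    by apply: le_lt_trans n0P _; exact: ltry.
  have := Lfun2D (L2_Lfun (u n0)) (Lfun2Z (-1) uL).
  by rewrite (_ : (fun x => _) = f)//; apply/funext => x; ring.
exists (cls f) => // e e0.
have [n0 n0P] := fP (e / 2) ltac:(by rewrite divr_gt0).
exists n0 => n /n0P; rewrite -dot_dist_cls// lee_fin => /le_lt_trans; apply; lra.
Qed.

Lemma L2normE u : L2norm Omega u = Num.sqrt (dot u u).
Proof.
rewrite /L2norm unlock /= -powR12_sqrt ?(form_ge0 dot_form)//.
have -> : (\int[mu]_x `|(u x)%:E| `^ 2 = (dot u u)%:E)%E.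
  rewrite dot_sqrE; apply: eq_integral => x _ /=.
  by rewrite powR_mulrn// real_normK// num_real.
by rewrite poweR_EFin.
Qed.

Lemma L2norm_dist_cls u (f : T -> R) : f \in Lfun mu 2%:E ->
  L2norm Omega (fun x => u x - f x) = Num.sqrt (dot (u - cls f) (u - cls f)).
Proof.
move=> fL; rewrite /L2norm unlock /= -powR12_sqrt ?(form_ge0 dot_form)//.
have -> : (\int[mu]_x `|(u x - f x)%:E| `^ 2 =
    (dot (u - cls f) (u - cls f))%:E)%E.
  rewrite dot_dist_cls//; apply: eq_integral => x _ /=.
  by rewrite powR_mulrn// real_normK// num_real.
by rewrite poweR_EFin.
Qed.

Lemma L2zero0 : L2zero Omega = 0. Proof. by []. Qed.
Lemma dotE u v : dot u v = pairing Omega u v. Proof. by []. Qed.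

Lemma dot_eq0 u : dot u u = 0 -> u = 0.
Proof.
move=> uu; apply/L2_eqP.
have mu2 : measurable_fun setT (fun x => ((u x) ^+ 2)%:E).
  by apply/measurable_EFinP/measurable_funX; exact: Lfun2_measurable (L2_Lfun u).
have u0 : (\int[mu]_x `|((u x) ^+ 2)%:E| = 0)%E.
  transitivity (dot u u)%:E; last by rewrite uu.
  rewrite dot_sqrE; apply: eq_integral => x _.
  by rewrite gee0_abs// lee_fin sqr_ge0.
have {u0} := (ae_eq_integral_abs mu measurableT mu2).1 u0.
move: L2_0E; apply: filterS2 => x /= /(_ I) -> /(_ I)[] /eqP.
by rewrite sqrf_eq0 => /eqP -> _.
Qed.

End L2_module.

(** * Calculus of test functions *)

Section continuous_arithmetic.
Context {R : realType} {X : topologicalType}.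
Implicit Types f g : X -> R.

Lemma continuous_addf f g : continuous f -> continuous g ->
  continuous (fun x => f x + g x).
Proof. by move=> cf cg x; exact: (continuousD (cf x) (cg x)). Qed.

Lemma continuous_mulf f g : continuous f -> continuous g ->
  continuous (fun x => f x * g x).
Proof. by move=> cf cg x; exact: (continuousM (cf x) (cg x)). Qed.

End continuous_arithmetic.

Section partials_theory.
Context {R : realType} {N : nat}.
Local Notation T := ('rV[R]_N).
Implicit Types (f g phi psi : T -> R) (i j : 'I_N) (v w x : T).

Lemma is_derive_line f v w (t : R) : derivable f (t *: v + w) v ->
  is_derive t 1 (fun s : R => f (s *: v + w)) ('D_v f (t *: v + w)).
Proof.
move=> df.
have E : (fun h : R => h^-1 *: (((fun s : R => f (s *: v + w)) \o shift t) (h *: 1)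
      - f (t *: v + w))) =
    (fun h : R => h^-1 *: ((f \o shift (t *: v + w)) (h *: v) - f (t *: v + w))).
  by apply/funext => h /=; rewrite [_%:A]mulr1 scalerDl addrA.
by split; [rewrite /derivable E|rewrite /derive E].
Qed.

Lemma is_derive1_continuous (g dg : R -> R) :
  (forall t : R, is_derive t 1 g (dg t)) -> continuous g.
Proof.
move=> gd t; apply/differentiable_continuous/derivable1_diffP.
by have [] := gd t.
Qed.

Lemma MVT_line (f : T -> R) v w (h : R) : 0 < h -> (forall x, derivable f x v) ->
  exists2 t : R, 0 < t < h & f (h *: v + w) - f w = h * 'D_v f (t *: v + w).
Proof.
move=> h0 df; pose g (s : R) := f (s *: v + w).
have gd (s : R) : is_derive s 1 g ('D_v f (s *: v + w)) by exact: is_derive_line.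
have [|t] := @MVT _ g (fun s => 'D_v f (s *: v + w)) 0 h h0 (fun s _ => gd s).
  by apply: continuous_subspaceT; exact: is_derive1_continuous gd.
rewrite in_itv/= /g scale0r add0r subr0 => t0h ->.
by exists t => //; rewrite mulrC.
Qed.

Lemma derivable_linear f g a x v : derivable f x v -> derivable g x v ->
  derivable (fun x => a * f x + g x) x v.
Proof. by move=> df dg; apply: derivableD => //; exact: derivableZ. Qed.

Lemma derive_linear f g a x v : derivable f x v -> derivable g x v ->
  'D_v (fun x => a * f x + g x) x = a * 'D_v f x + 'D_v g x.
Proof.
by move=> df dg; rewrite (deriveD (derivableZ (k := a) df) dg) deriveZ.
Qed.

Lemma derivable_translate f x v w : derivable f (x + w) v ->
  derivable (fun x => f (x + w)) x v.
Proof.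
rewrite /derivable; set F := (X in cvg (X @ _)) => cF.
rewrite [X in cvg (X @ _)](_ : _ = F)//.
by apply/funext => h /=; rewrite /F /= addrA.
Qed.

Lemma derive_translate f x v w :
  'D_v (fun x => f (x + w)) x = 'D_v f (x + w).
Proof.
rewrite /derive; set F := (X in _ = lim (X @ _)).
rewrite [X in lim (X @ _) = _](_ : _ = F)//.
by apply/funext => h /=; rewrite /F /= addrA.
Qed.

(** The mean value theorem is used twice: along [v] for the difference of [f] and its translate by
    [h *: w], then along [w] for the derivative of [f] in direction [v]. *)
Lemma second_difference f v w x (h : R) : 0 < h ->
  (forall x, derivable f x v) -> (forall x, derivable ('D_v f) x w) ->
  exists s t, [/\ 0 < s < h, 0 < t < h &
    f (h *: v + (h *: w + x)) - f (h *: v + x) - f (h *: w + x) + f x =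
    h ^+ 2 * 'D_w ('D_v f) (t *: w + (s *: v + x))].
Proof.
move=> h0 dv dw; pose g y := -1 * f y + f (y + h *: w).
have dg y : derivable g y v.
  by apply: derivable_linear => //; exact: derivable_translate.
have [s sh] := MVT_line x h0 dg.
rewrite {3}/g derive_linear//; last exact: derivable_translate.
rewrite derive_translate => gE.
have [t th tE] := MVT_line (s *: v + x) h0 dw.
exists s, t; split => //.
rewrite expr2 -mulrA -tE [h *: w + (s *: v + x)]addrC.
have -> : 'D_v f (s *: v + x + h *: w) - 'D_v f (s *: v + x) =
  - 1 * 'D_v f (s *: v + x) + 'D_v f (s *: v + x + h *: w) by ring.
rewrite -gE /g [h *: w + x]addrC [h *: v + (x + _)]addrA; ring.
Qed.

Lemma ball_combination x v w (d : R) : 0 < d -> exists2 h : R, 0 < h &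
  forall s t : R, 0 < s < h -> 0 < t < h -> ball x d (s *: v + (t *: w + x)).
Proof.
move=> d0; pose K := `|v| + `|w| + 1.
have K0 : 0 < K by rewrite ltr_wpDl// addr_ge0.
exists (d / K); first by rewrite divr_gt0.
move=> s t /andP[s0 sh] /andP[t0 th].
rewrite -ball_normE /= addrA opprD addrCA subrr addr0 normrN.
apply: le_lt_trans (ler_normD _ _) _; rewrite !normrZ !gtr0_norm//.
have : s * `|v| <= d / K * `|v| by rewrite ler_wpM2r// ltW.
have : t * `|w| <= d / K * `|w| by rewrite ler_wpM2r// ltW.
have : d / K * K = d by rewrite divfK// gt_eqF.
have : 0 < d / K by rewrite divr_gt0.
rewrite /K; move: (d / _) => e e0 eK.
by move: eK; rewrite !mulrDr mulr1; lra.
Qed.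

(** Schwarz's theorem. The second difference is symmetric in [v] and [w], so the two mixed
    derivatives take a common value at two points as close to [x] as desired, and continuity
    concludes. *)
Lemma derive_comm f v w : (forall x, derivable f x v) -> (forall x, derivable f x w) ->
  (forall x, derivable ('D_v f) x w) -> (forall x, derivable ('D_w f) x v) ->
  continuous ('D_w ('D_v f)) -> continuous ('D_v ('D_w f)) ->
  'D_w ('D_v f) = 'D_v ('D_w f).
Proof.
move=> dv dw dvw dwv cvw cwv; apply/funext => x.
apply/eqP; rewrite -subr_eq0 -normr_eq0; apply/eqP/le_anti.
rewrite normr_ge0 andbT; apply/ler_addgt0Pl => e e0; rewrite addr0.
have e20 : 0 < e / 2 by rewrite divr_gt0.
have /nbhs_ballP[d1 /= d10 B1] :
    \forall y \near x, `|'D_w ('D_v f) x - 'D_w ('D_v f) y| < e / 2.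
  by have /cvgrPdist_lt/(_ _ e20) := cvw x.
have /nbhs_ballP[d2 /= d20 B2] :
    \forall y \near x, `|'D_v ('D_w f) x - 'D_v ('D_w f) y| < e / 2.
  by have /cvgrPdist_lt/(_ _ e20) := cwv x.
have [h1 h10 H1] := ball_combination x w v d10.
have [h2 h20 H2] := ball_combination x v w d20.
pose h := Num.min h1 h2.
have h0 : 0 < h by rewrite lt_min h10.
have [s [t [sh th E1]]] := second_difference x h0 dv dvw.
have [s' [t' [sh' th' E2]]] := second_difference x h0 dw dwv.
have lt1 r : 0 < r < h -> 0 < r < h1.
  by rewrite /h lt_min => /andP[-> /andP[->]].
have lt2 r : 0 < r < h -> 0 < r < h2.
  by rewrite /h lt_min => /andP[-> /andP[]].
have := B1 _ (H1 t s (lt1 _ th) (lt1 _ sh)).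
have := B2 _ (H2 t' s' (lt2 _ th') (lt2 _ sh')).
have -> : 'D_v ('D_w f) (t' *: v + (s' *: w + x)) = 'D_w ('D_v f) (t *: w + (s *: v + x)).
  apply: (@mulfI _ (h ^+ 2)); first by rewrite expf_neq0// gt_eqF.
  apply: (etrans (esym E2)); apply: (etrans _ E1).
  have -> : h *: w + (h *: v + x) = h *: v + (h *: w + x) by rewrite addrCA.
  move: (f (h *: v + (h *: w + x))) (f (h *: w + x)) (f (h *: v + x)) (f x).
  by move=> a b c d'; ring.
move: ('D_w ('D_v f) (t *: w + (s *: v + x))) ('D_w ('D_v f) x) ('D_v ('D_w f) x).
move=> z p q H3 H4; have -> : p - q = (p - z) - (q - z) by ring.
by apply: le_trans (ler_normB _ _) _; rewrite (splitr e) lerD// ltW.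
Qed.

Lemma partials_cat s t f : partials (s ++ t) f = partials s (partials t f).
Proof. by rewrite /partials foldr_cat. Qed.

Lemma smooth_partials t f : smooth f -> smooth (partials t f).
Proof. by move=> sf s; rewrite -partials_cat; exact: sf. Qed.

Lemma smooth_continuous f : smooth f -> continuous f.
Proof. by move=> /(_ [::])[]. Qed.

Lemma smooth_derivable f i x : smooth f -> derivable f x (delta_mx 0 i).
Proof. by move=> /(_ [::])[_]; exact. Qed.

Lemma partialC f i j : smooth f -> partial i (partial j f) = partial j (partial i f).
Proof.
move=> sf; apply: derive_comm.
- by move=> x; exact: smooth_derivable.
- by move=> x; exact: smooth_derivable.
- by move=> x; have := (sf [:: j]).2; exact.
- by move=> x; have := (sf [:: i]).2; exact.
- exact: (sf [:: i; j]).1.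
- exact: (sf [:: j; i]).1.
Qed.

Lemma partials_partialC f s i : smooth f ->
  partials s (partial i f) = partial i (partials s f).
Proof.
move=> sf; elim: s => //= j s ->; rewrite partialC//.
exact: smooth_partials.
Qed.

Lemma partials_linear s f g a : smooth f -> smooth g ->
  partials s (fun x => a * f x + g x) =
  (fun x => a * partials s f x + partials s g x).
Proof.
move=> sf sg; elim: s => //= i s ->; apply/funext => x; rewrite /partial.
by rewrite derive_linear//; [have := (sf s).2|have := (sg s).2]; exact.
Qed.

Lemma smooth_linear f g a : smooth f -> smooth g -> smooth (fun x => a * f x + g x).
Proof.
move=> sf sg s; rewrite partials_linear//; split.
  have [cf _] := sf s; have [cg _] := sg s.
  by apply: continuous_addf => //; apply: continuous_mulf => //; exact: cst_continuous.
move=> i x; apply: derivable_linear; [have := (sf s).2|have := (sg s).2]; exact.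
Qed.

Lemma smooth_cst (c : R) : smooth (fun _ : T => c).
Proof.
have pc s : exists c', partials s (fun _ : T => c) = (fun=> c').
  elim: s => [|i s /= [c' ->]]; first by exists c.
  by exists 0; apply/funext => x; rewrite /partial derive_cst.
move=> s; have [c' ->] := pc s; split; first exact: cst_continuous.
by move=> i x; exact: derivable_cst.
Qed.

Lemma partial_eq0_near f i x : (\near x, f x = 0) -> partial i f x = 0.
Proof.
move=> fx; rewrite /partial -[RHS](derive_cst (0 : R) x (delta_mx 0 i)).
exact: near_eq_derive.
Qed.

Lemma notin_support f x : ~ closure [set x | f x != 0] x -> \near x, f x = 0.
Proof.
move=> /existsNP[B /not_implyP[Bx]] /set0P/negP; rewrite negbK => /eqP B0.
apply: filterS Bx => y By; apply/eqP/negPn/negP => fy.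
by have : set0 y by rewrite -B0; split.
Qed.

Lemma support_partial f i :
  [set x | partial i f x != 0] `<=` closure [set x | f x != 0].
Proof.
move=> x /= fx; apply: contrapT => /notin_support/(partial_eq0_near i) f0.
by move: fx; rewrite f0 eqxx.
Qed.

End partials_theory.

Section test_function_theory.
Context {R : realType} {N : nat} (Omega : domain R N).
Local Notation T := ('rV[R]_N).
Local Notation test := (test_function Omega).
Implicit Types (f g phi : T -> R) (i j : 'I_N).

Lemma test_function_sub phi psi : smooth psi -> test phi ->
  closure [set x | psi x != 0] `<=` closure [set x | phi x != 0] -> test psi.
Proof.
move=> spsi [sphi cphi phiO] sub; split => //; last exact: subset_trans phiO.
by apply: subclosed_compact cphi sub; exact: closed_closure.
Qed.

Lemma test_partial i phi : test phi -> test (partial i phi).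
Proof.
move=> tphi; have [sphi _ _] := tphi; apply: (test_function_sub _ tphi).
  exact: (smooth_partials [:: i]).
have /closure_subset := support_partial (f := phi) (i := i).
by have /closure_id <- := @closed_closure _ [set x | phi x != 0].
Qed.

Lemma test_linear a phi psi : test phi -> test psi -> test (fun x => a * phi x + psi x).
Proof.
move=> [sphi cphi phiO] [spsi cpsi psiO].
have sub : closure [set x | a * phi x + psi x != 0] `<=`
    closure [set x | phi x != 0] `|` closure [set x | psi x != 0].
  rewrite -closureU; apply: closure_subset => x /= H.
  have [p0|] := eqVneq (phi x) 0; last by left.
  by right; move: H; rewrite p0 mulr0 add0r.
split; first exact: smooth_linear.
- apply: subclosed_compact (compactU cphi cpsi) sub; exact: closed_closure.
- by move=> x /sub[/phiO|/psiO].
Qed.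

Lemma test0 : test (fun=> 0).
Proof.
have E : [set x : T | (0 : R) != 0] = set0 by apply/seteqP; split => x //=; rewrite eqxx.
split; first exact: smooth_cst.
- by rewrite E closure0; exact: compact0.
- by rewrite E closure0.
Qed.

Lemma test_sum (I : Type) (r : seq I) (F : I -> T -> R) :
  (forall k, test (F k)) -> test (fun x => \sum_(k <- r) F k x).
Proof.
move=> tF; elim: r => [|k r IH].
  by rewrite (_ : (fun x => _) = (fun=> 0)); [exact: test0|apply/funext => x; rewrite big_nil].
rewrite (_ : (fun x => _) = (fun x => 1 * F k x + \sum_(k <- r) F k x)).
  exact: test_linear.
by apply/funext => x; rewrite big_cons mul1r.
Qed.

Lemma test_laplacian phi : test phi -> test (laplacian phi).
Proof. by move=> tphi; apply: test_sum => i; do 2 apply: test_partial. Qed.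

Lemma test_partials s phi : test phi -> test (partials s phi).
Proof. by move=> tphi; elim: s => //= i s; exact: test_partial. Qed.

End test_function_theory.

(** * Continuous functions that vanish outside a cube *)

Section cube.
Context {R : realType}.

Definition cube n (M : R) : set 'rV[R]_n := [set v | forall i, `|v 0 i| <= M].
Arguments cube n M _ : clear implicits.

Lemma continuous_coord n (i : 'I_n) : continuous (fun v : 'rV[R]_n => v 0 i).
Proof. by move=> v; apply/differentiable_continuous/differentiable_coord. Qed.

Lemma continuous_measurable_rV n (f : 'rV[R]_n -> R) :
  continuous f -> measurable_fun setT f.
Proof.
move=> cf; apply: (measurability _ (RGenOpens.measurableE R)).
move=> _ [_ [a [b ->] <-]]; rewrite setTI; apply: open_measurable_rV.
by move/continuousP : cf; apply; exact: interval_open.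
Qed.

Lemma compact_cube n M : compact (cube n M).
Proof.
rewrite (_ : cube n M = [set v : 'rV[R]_n | forall i, `[- M, M]%classic (v ord0 i)]).
  apply: (@rV_compact _ n (fun=> `[- M, M]%classic)) => _.
  exact: segment_compact.
by apply/seteqP; split=> v /= H i; have := H i; rewrite in_itv/= ler_norml.
Qed.

Lemma measurable_cube n M : measurable (cube n M).
Proof.
rewrite (_ : cube n M = \bigcap_(i in [set: 'I_n])
    (fun v : 'rV[R]_n => v 0 i) @^-1` `[- M, M]%classic).
  apply: fin_bigcap_measurable => // i _.
  by rewrite -[X in measurable X]setTI; apply: measurable_coord => //.
by apply/seteqP; split=> v /= H i; have := H i; rewrite /= in_itv/= ler_norml// => /(_ I).
Qed.

Lemma lebesgue_cube n M : (lebesgue_rV n (cube n M) < +oo)%E.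
Proof.
elim: n => [|n IH]; first by rewrite /= diracE ltry.
rewrite /= /rV_cons_measure /pushforward.
rewrite (_ : @rV_cons R n @^-1` cube n.+1 M = `[- M, M]%classic `*` cube n M).
  rewrite product_measure1E//; last exact: measurable_cube.
  rewrite lte_mul_pinfty//.
  have : lebesgue_measure (`[- M, M]%classic : set R) \is a fin_num.
    by rewrite lebesgue_measure_itv/=; case: ifP.
  exact.
apply/seteqP; split=> [[x v] /= H|[x v] /= [xM vM] i].
  split; last by move=> i; have := H (rshift 1 i); rewrite /rV_cons (@row_mxEr _ 1 1 n).
  by have := H (@lshift 1 n 0); rewrite /rV_cons (@row_mxEl _ 1 1 n) mxE eqxx in_itv/= ler_norml.
have [j ->|j ->] := @split_ordP 1 n i; rewrite /rV_cons.
  by rewrite (@row_mxEl _ 1 1 n) ord1 mxE eqxx ler_norml; move: xM; rewrite in_itv.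
by rewrite (@row_mxEr _ 1 1 n).
Qed.

Lemma continuous_cube_bounded n (f : 'rV[R]_n -> R) M : continuous f ->
  (forall x, ~ cube n M x -> f x = 0) -> exists C, forall x, `|f x| <= C.
Proof.
move=> cf f0.
have [K [_ KP]] : bounded_set (f @` cube n M).
  apply/compact_bounded/continuous_compact; last exact: compact_cube.
  exact: continuous_subspaceT.
exists (`|K| + 1) => x; have [xM|xM] := pselect (cube n M x).
  by apply: KP; [rewrite (le_lt_trans (ler_norm _))// ltrDl|exists x].
by rewrite f0// normr0 addr_ge0.
Qed.

Section integrable.
Context n (m : {measure set 'rV[R]_n -> \bar R}) (f : 'rV[R]_n -> R) (M : R).
Hypotheses (cf : continuous f) (f0 : forall x, ~ cube n M x -> f x = 0).
Hypothesis mM : (m (cube n M) < +oo)%E.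

Lemma integrable_cube : m.-integrable setT (EFin \o f).
Proof.
have [C fC] := continuous_cube_bounded cf f0.
have ic : m.-integrable setT (fun x => (C * \1_(cube n M) x)%:E).
  rewrite (_ : (fun x => _) = (fun x => C%:E * (\1_(cube n M) x)%:E)%E)//.
  apply: integrableZl => //; apply/integrableP; split.
    by apply/measurable_EFinP/measurable_indic; exact: measurable_cube.
  rewrite (eq_integral (fun x => (\1_(cube n M) x)%:E)).
    by rewrite integral_indic ?setIT//; exact: measurable_cube.
  by move=> x _; rewrite gee0_abs// lee_fin.
apply: le_integrable ic => //.
  by apply/measurable_EFinP; exact: (continuous_measurable_rV cf).
move=> x _ /=; rewrite lee_fin indicE; case: (boolP (x \in _)) => xM.
  by rewrite mulr1 (le_trans (fC x))// ler_norm.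
by rewrite f0 ?normr0//; move: xM; rewrite notin_setE.
Qed.

End integrable.

Lemma Lfun2_cube n (m : {measure set 'rV[R]_n -> \bar R}) (f : 'rV[R]_n -> R) M :
  continuous f -> (forall x, ~ cube n M x -> f x = 0) ->
  (m (cube n M) < +oo)%E -> f \in Lfun m 2%:E.
Proof.
move=> cf f0 mM; apply/Lfun2P; split; first exact: continuous_measurable_rV.
have cf2 : continuous (fun x => f x ^+ 2).
  rewrite (_ : (fun x => _) = (fun x => f x * f x)); first exact: continuous_mulf.
  by apply/funext => x; rewrite expr2.
have /integrableP[_] : m.-integrable setT (EFin \o (fun x => f x ^+ 2)).
  by apply: integrable_cube mM => // x xM; rewrite f0// expr0n.
rewrite [X in (X < _)%E -> _](eq_integral (fun x => (f x ^+ 2)%:E)) => [//|x _].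
by rewrite gee0_abs// lee_fin sqr_ge0.
Qed.

End cube.
Arguments cube {R} n M _.

(** * The integral of a partial derivative vanishes *)

Section integral_partial.
Context {R : realType}.

Lemma rV_consL n (p : measurableTypeR R * 'rV[R]_n) (j : 'I_1) :
  rV_cons p 0 (@lshift 1 n j : 'I_n.+1) = p.1.
Proof. by rewrite /rV_cons (@row_mxEl _ 1 1 n) ord1 mxE eqxx. Qed.

Lemma rV_consR n (p : measurableTypeR R * 'rV[R]_n) (j : 'I_n) :
  rV_cons p 0 (@rshift 1 n j : 'I_n.+1) = p.2 0 j.
Proof. by rewrite /rV_cons (@row_mxEr _ 1 1 n). Qed.

Lemma rV_cons_lineV n (x h : R) (v : 'rV[R]_n) :
  rV_cons (x, v) + h *: delta_mx 0 (@lshift 1 n 0 : 'I_n.+1) = rV_cons (x + h, v).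
Proof.
apply/rowP => i; rewrite mxE [X in _ + X]mxE [X in _ + _ * X]mxE.
have [j ->|j ->] := @split_ordP 1 n i.
  by rewrite !rV_consL ord1 !eqxx mulr1.
by rewrite !rV_consR eqxx (@eq_rlshift 1 n) mulr0 addr0.
Qed.

Lemma rV_cons_lineH n (x h : R) (v : 'rV[R]_n) (j : 'I_n) :
  rV_cons (x, v) + h *: delta_mx 0 (@rshift 1 n j : 'I_n.+1) =
  rV_cons (x, v + h *: delta_mx 0 j).
Proof.
apply/rowP => i; rewrite mxE [X in _ + X]mxE [X in _ + _ * X]mxE.
have [k ->|k ->] := @split_ordP 1 n i.
  by rewrite !rV_consL eqxx (@eq_lrshift 1 n) mulr0 addr0.
by rewrite !rV_consR /= !mxE eqxx (inj_eq (@rshift_inj 1 n)).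
Qed.

Lemma continuous_rV_consl n (v : 'rV[R]_n) : continuous (fun x : R => rV_cons (x, v)).
Proof.
move=> x A /nbhs_ballP[e /= e0 eA]; apply/nbhs_ballP; exists e => //= y xy.
apply: eA; split => // i j; rewrite ord1.
have [k ->|k ->] := @split_ordP 1 n j; first by rewrite !rV_consL.
by rewrite !rV_consR; exact: ballxx.
Qed.

Lemma continuous_rV_consr n (x : R) : continuous (fun v : 'rV[R]_n => rV_cons (x, v)).
Proof.
move=> v A /nbhs_ballP[e /= e0 eA]; apply/nbhs_ballP; exists e => //= w [_ vw].
apply: eA; split => // i j; rewrite ord1.
have [k ->|k ->] := @split_ordP 1 n j; first by rewrite !rV_consL; exact: ballxx.
by rewrite !rV_consR; exact: vw.
Qed.

Lemma cube_consP n M (x : R) (v : 'rV[R]_n) :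
  cube n.+1 M (rV_cons (x, v)) <-> `|x| <= M /\ cube n M v.
Proof.
split=> [H|[xM vM] i].
  split; first by have := H (@lshift 1 n 0); rewrite rV_consL.
  by move=> i; have := H (@rshift 1 n i); rewrite rV_consR.
by have [j ->|j ->] := @split_ordP 1 n i; rewrite ?rV_consL ?rV_consR.
Qed.

Lemma integral_derive_eq0 (F f : R -> R) (M : R) : 0 < M -> continuous f ->
  (forall t : R, is_derive t 1 F (f t)) -> (forall t, M < `|t| -> F t = 0) ->
  (\int[lebesgue_measure]_x (f x)%:E = 0)%E.
Proof.
move=> M0 cf Ff F0.
have cF := is_derive1_continuous Ff.
have f0 t : M < `|t| -> f t = 0.
  move=> Mt; have [_ <-] := Ff t.
  rewrite -[RHS](derive_cst (0 : R) t (1 : R)); apply: near_eq_derive.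
  have /cvgrPdist_lt/(_ (`|t| - M)) := (@norm_continuous _ R t : _ --> _).
  rewrite subr_gt0 => /(_ Mt); apply: filterS => y /(le_lt_trans (ler_norm _)).
  by rewrite ltrD2l ltrNl opprK; exact: F0.
(* [F] is known to vanish only where |t| > M, so the endpoints are moved strictly beyond [M]. *)
pose M' := M + 1.
have MM : M < M' by rewrite ltrDl.
transitivity (\int[lebesgue_measure]_(x in `[(- M')%R, M']) (f x)%:E)%E; last first.
  rewrite (@continuous_FTC2 _ f F)//.
  - rewrite !F0 ?subee//; first by rewrite normrN gtr0_norm// (lt_trans M0).
    by rewrite gtr0_norm// (lt_trans M0).
  - by rewrite gtrN// (lt_trans M0).
  - exact: continuous_subspaceT.
  - split.
    + by move=> t _; have [] := Ff t.
    + by apply: cvg_at_right_filter; exact: cF.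
    + by apply: cvg_at_left_filter; exact: cF.
  - by move=> t _; rewrite derive1E; have [_ ->] := Ff t.
rewrite [RHS]integral_mkcond; apply: eq_integral => x _.
rewrite patchE; case: ifPn => //; rewrite notin_setE /= in_itv/= -ler_norml => /negP.
by rewrite -ltNge => Mx; rewrite f0// (lt_trans MM).
Qed.

(** Since [c] maps the line through [v] along [d] affinely to a line along [e], the two difference
    quotients are the same function. This is the chain rule that [smooth], phrased with partial
    derivatives only, allows for slices. *)
Lemma derivable_comp_line (V W : normedModType R) (F : W -> R) (c : V -> W)
    (v d : V) (e : W) :
  (forall h : R, c (h *: d + v) = h *: e + c v) ->
  derivable F (c v) e -> derivable (F \o c) v d /\ 'D_d (F \o c) v = 'D_e F (c v).
Proof.
move=> cd; rewrite /derivable /derive.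
set G := (X in cvg (X @ _) -> _); set H := (X in _ -> cvg (X @ _) /\ _).
have HG : H = G by apply/funext => h; rewrite /H /G /= cd.
move=> dF; split; first by rewrite HG.
by transitivity (lim (H x @[x --> 0^'])) => //; rewrite HG.
Qed.

(** Induction on the dimension by Fubini. If [i] is the first coordinate, the inner integral runs
    over it and vanishes by the fundamental theorem of calculus; otherwise the first coordinate is
    frozen and the induction hypothesis applies to the slice. *)
Lemma integral_partial_eq0 n (i : 'I_n) (F : 'rV[R]_n -> R) (M : R) : 0 < M ->
  (forall x, derivable F x (delta_mx 0 i)) -> continuous (partial i F) ->
  (forall x, ~ cube n M x -> F x = 0) ->
  (\int[lebesgue_rV n]_x (partial i F x)%:E = 0)%E.
Proof.
move=> M0; elim: n i F => [[]//|n IH] i F dF cF F0.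
have F0' x : ~ cube n.+1 M x -> partial i F x = 0.
  move=> xM; apply: partial_eq0_near.
  have : closed (cube n.+1 M) by apply: compact_closed => //; exact: compact_cube.
  by move=> /closed_openC oM; apply: filterS (open_nbhs_nbhs (conj oM xM)).
have mF : measurable_fun setT (EFin \o partial i F).
  by apply/measurable_EFinP; exact: continuous_measurable_rV.
pose m := lebesgue_rV (R := R) n.
have iF : (rV_cons_measure m).-integrable setT (EFin \o partial i F).
  by apply: integrable_cube cF F0' _; exact: (lebesgue_cube n.+1 M).
have iFc : (lebesgue_measure \x m)%E.-integrable setT
    ((EFin \o partial i F) \o @rV_cons R n).
  apply/integrableP; split; first exact: measurableT_comp.
  have /integrableP[_] := iF.
  by rewrite ge0_integral_pushforward//; exact: measurableT_comp.
rewrite /= [LHS]integral_pushforward//.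
have [j ij|j ij] := @split_ordP 1 n i.
  rewrite -integral21_prod_meas1//; apply: integral0_eq => v _ /=.
  rewrite /fubini_G /=.
  apply: (@integral_derive_eq0 (fun x => F (rV_cons (x, v))) _ M) => //.
  - by move=> x; apply: continuous_comp; [exact: continuous_rV_consl|exact: cF].
  - move=> t.
    have L (h : R) : h *: delta_mx 0 i + rV_cons (0, v) = rV_cons (h, v).
      by rewrite addrC ij ord1 rV_cons_lineV add0r.
    have := is_derive_line (w := rV_cons (0, v)) (t := t) (dF _).
    rewrite L; congr (is_derive _ _ _ _).
    by apply/funext => h; rewrite L.
  - move=> t Mt; apply: F0 => /cube_consP[]; by rewrite leNgt Mt.
rewrite -integral12_prod_meas1//; apply: integral0_eq => x _ /=.
rewrite /fubini_F /=.
have L (v : 'rV[R]_n) (h : R) :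
    rV_cons (x, h *: delta_mx 0 j + v) = h *: delta_mx 0 i + rV_cons (x, v).
  by rewrite [RHS]addrC ij rV_cons_lineH addrC.
have D v := derivable_comp_line (c := fun v => rV_cons (x, v)) (L v) (dF _).
rewrite (eq_integral (fun v => (partial j (F \o (fun v => rV_cons (x, v))) v)%:E)).
  apply: IH.
  - by move=> v; have [] := D v.
  - rewrite (_ : partial j _ = partial i F \o (fun v => rV_cons (x, v))).
      by move=> v; apply: continuous_comp; [exact: continuous_rV_consr|exact: cF].
    by apply/funext => v; have [] := D v.
  - by move=> v vM; apply: F0 => /cube_consP[].
by move=> v _ /=; congr EFin; rewrite [RHS](D v).2.
Qed.

End integral_partial.

(** * Density of test functions *)

Section flat_function.
Context {R : realType}.
Implicit Types (p : {poly R}) (x y : R).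

(** The functions [x |-> p (1 / x) exp (- 1 / x)] on [x > 0], extended by [0],
    are stable under differentiation. *)
Definition flat p x : R := if 0 < x then p.[x^-1] * expR (- x^-1) else 0.

(** In the variable y = 1 / x, whose derivative is - y^2, the product p(y) exp(- y) has derivative
    (p(y) - p'(y)) y^2 exp(- y). *)
Definition flat_deriv p : {poly R} := (p - p^`()) * 'X^2.

(** Each monomial satisfies y^i exp(- y) <= (i+2)! y^-2, because exp(y) >= y^(i+2) / (i+2)!. A
    quadratic bound at 0 is what makes the difference quotient at 0 tend to 0. *)
Lemma flat_bound p : exists2 C : R, 0 <= C & forall x, `|flat p x| <= C * x ^+ 2.
Proof.
exists (\sum_(i < size p) `|p`_i| * (i.+2)`!%:R).
  by apply: sumr_ge0 => i _; rewrite mulr_ge0.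
move=> x; rewrite /flat; case: ltP => [x0|_]; last first.
  rewrite normr0 mulr_ge0 ?sqr_ge0//.
  by apply: sumr_ge0 => i _; rewrite mulr_ge0.
have y0 : 0 < x^-1 by rewrite invr_gt0.
rewrite horner_coef normrM (ger0_norm (expR_ge0 _)) mulr_suml.
apply: le_trans (ler_wpM2r (expR_ge0 _) (ler_norm_sum _ _ _)) _.
rewrite mulr_suml; apply: ler_sum => i _.
rewrite normrM -!mulrA ler_wpM2l//.
rewrite ger0_norm ?exprn_ge0 ?(ltW y0)// expRN ler_pdivrMr ?expR_gt0//.
have := expR_ge1Dxn i.+1 (ltW y0).
move=> /(le_trans (_ : _ <= 1 + _)) => /(_ (x^-1 ^+ i.+2 / (i.+2)`!%:R)).
rewrite lerDr ler01 => /(_ isT).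
rewrite ler_pdivrMr ?ltr0n ?fact_gt0// => H.
rewrite mulrAC -ler_pdivrMr ?exprn_gt0//.
by rewrite -exprVn -exprD addn2 mulrC.
Qed.

Lemma is_derive_cvg (f : R -> R) x l :
  (h^-1 *: (f (h + x) - f x)) @[h --> (0:R)^'] --> l -> is_derive x 1 f l.
Proof.
move=> H; have E : (fun h : R => h^-1 *: ((f \o shift x) (h *: (1 : R)) - f x)) =
    (fun h : R => h^-1 *: (f (h + x) - f x)).
  by apply/funext => h /=; rewrite [_%:A]mulr1.
split; first by rewrite /derivable E; apply/cvg_ex; exists l.
by rewrite /derive E; exact: cvg_lim.
Qed.

Lemma near_eq_is_derive (f g : R -> R) x l :
  (\near x, f x = g x) -> is_derive x 1 f l -> is_derive x 1 g l.
Proof.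
move=> fg [df fl]; split; first exact: near_eq_derivable fg df.
by rewrite -(near_eq_derive (1 : R) fg).
Qed.

Lemma is_derive_flat p x : is_derive x 1 (flat p) (flat (flat_deriv p) x).
Proof.
have [x0|x0|->] := ltgtP x 0.
- rewrite {2}/flat ltNge (ltW x0) /=; apply: (@near_eq_is_derive (cst 0)).
    near=> y; rewrite /flat ltNge (_ : y <= 0)//.
  by near: y; apply: filterS (lt_nbhsl x0) => y /ltW.
- rewrite {2}/flat x0.
  apply: (@near_eq_is_derive (fun y => p.[y^-1] * expR (- y^-1))).
    near=> y; rewrite /flat (_ : 0 < y)//.
    by near: y; exact: lt_nbhsr.
  have dV : is_derive x 1 (fun y : R => y^-1) (- x ^- 2).
    apply: is_derive_eq; first by apply: is_deriveV; rewrite gt_eqF.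
    by rewrite [_%:A]mulr1.
  have dVN : is_derive x 1 (fun y : R => - y^-1) (x ^- 2).
    by apply: is_derive_eq; rewrite opprK.
  have dp : is_derive x^-1 1 (horner p) (p^`()).[x^-1].
    by split; [exact: derivable_horner|rewrite derivE derive1E].
  have d1 := @is_derive1_comp _ (horner p) (fun y : R => y^-1) x _ _ dp dV.
  have d2 := @is_derive1_comp _ (@expR R) (fun y : R => - y^-1) x _ _ (is_derive_expR _) dVN.
  refine (is_derive_eq (is_deriveM d1 d2) _).
  rewrite /= /flat_deriv hornerM hornerXn hornerD hornerN -exprVn /GRing.scale /=; ring.
rewrite {2}/flat ltxx; apply: is_derive_cvg.
have [C C0 fC] := flat_bound p.
have f0 : flat p 0 = 0 by rewrite /flat ltxx.
apply/cvgrPdist_lt => e e0; near=> h.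
rewrite addr0 f0 subr0 sub0r normrN normrZ.
have h0 : h != 0 by near: h; exact: nbhs_dnbhs_neq.
rewrite normfV mulrC ltr_pdivrMr ?normr_gt0//.
have hh : h ^+ 2 = `|h| * `|h| by rewrite -expr2 real_normK// num_real.
apply: le_lt_trans (fC h) _; rewrite hh mulrA.
rewrite ltr_pM2r ?normr_gt0//.
apply: (@le_lt_trans _ _ ((C + 1) * `|h|)); first by rewrite ler_wpM2r// lerDl.
rewrite mulrC -ltr_pdivlMr; last by rewrite ltr_wpDl.
near: h; apply: nbhs_dnbhs; apply/nbhs_ballP => /=.
exists (e / (C + 1)); first by rewrite /= divr_gt0// ltr_wpDl.
by move=> h /=; rewrite -ball_normE /= sub0r normrN.
Unshelve. all: by end_near. Qed.

Lemma continuous_flat p : continuous (flat p).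
Proof. exact: is_derive1_continuous (is_derive_flat p). Qed.

Lemma derivable_flat_dir p x (e : R) :
  derivable (flat p) x e /\ 'D_e (flat p) x = e * flat (flat_deriv p) x.
Proof.
have [d dE] := is_derive_flat p x.
have df : differentiable (flat p) x by apply/derivable1_diffP.
split; first exact: diff_derivable.
rewrite -dE !deriveE// -[X in 'd _ _ X = _](mulr1 e).
by rewrite -[e * 1]/(e *: (1 : R)) linearZ.
Qed.

Lemma flat1_ge0 x : 0 <= flat 1 x.
Proof. by rewrite /flat; case: ifP => // _; rewrite hornerC mul1r expR_ge0. Qed.

Lemma flat1_le1 x : flat 1 x <= 1.
Proof.
rewrite /flat; case: ifP => // x0; rewrite hornerC mul1r -expR0 ler_expR.
by rewrite oppr_le0 invr_ge0 ltW.
Qed.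

Lemma flat1_eq0 x : x <= 0 -> flat 1 x = 0.
Proof. by rewrite /flat ltNge => ->. Qed.

(** For [y > 0] the terms are exp(-1 / ((n+1) y)). Dilation thus turns [flat 1] into the indicator
    of the positive half-line. *)
Lemma flat1_cvg y : (flat 1 (n.+1%:R * y)) @[n --> \oo] --> ((0 < y)%R%:R : R).
Proof.
case: ltP => [y0|y0]; last first.
  apply: cvg_near_cst; apply: nearW => n.
  by rewrite flat1_eq0// mulr_ge0_le0.
rewrite (_ : (fun n => _) = (fun n : nat => expR (- (n.+1%:R^-1 * y^-1)))); last first.
  by apply/funext => n; rewrite /flat mulr_gt0// hornerC mul1r invfM.
rewrite -[X in _ --> X]expR0.
have : (- (n.+1%:R^-1 * y^-1)) @[n --> \oo] --> (0 : R).
  rewrite -oppr0; apply: cvgN; rewrite -(mul0r y^-1).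
  by apply: cvgMl; exact: cvg_harmonic.
by apply: continuous_cvg; exact: continuous_expR.
Qed.

End flat_function.

Section bump.
Context {R : realType} {N : nat}.
Local Notation T := ('rV[R]_N).

(* Closed under partial derivatives, hence made of smooth functions. *)
Inductive flat_expr : (T -> R) -> Prop :=
| flat_cst c : flat_expr (fun=> c)
| flat_coord p (i : 'I_N) a b : flat_expr (fun v => flat p (a * v 0 i + b))
| flat_add f g : flat_expr f -> flat_expr g -> flat_expr (fun v => f v + g v)
| flat_mul f g : flat_expr f -> flat_expr g -> flat_expr (fun v => f v * g v).

Lemma flat_expr_partial f i : flat_expr f ->
  [/\ continuous f, forall x, derivable f x (delta_mx 0 i) & flat_expr (partial i f)].
Proof.
elim=> {f} [c|p j a b|f g _ [cf df pf] _ [cg dg pg]|f g ef [cf df pf] eg [cg dg pg]].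
- split; [exact: cst_continuous|move=> x; exact: derivable_cst|].
  rewrite (_ : partial i _ = fun=> 0); first exact: flat_cst.
  by apply/funext => x; rewrite /partial derive_cst.
- have cc : continuous (fun v : T => a * v 0 j + b).
    apply: continuous_addf; last exact: cst_continuous.
    by apply: continuous_mulf; [exact: cst_continuous|exact: continuous_coord].
  have D (v : T) : derivable (fun v : T => flat p (a * v 0 j + b)) v (delta_mx 0 i) /\
      'D_(delta_mx 0 i) (fun v : T => flat p (a * v 0 j + b)) v =
      (a * (i == j)%:R) * flat (flat_deriv p) (a * v 0 j + b).
    have [d1 <-] := derivable_flat_dir p (a * v 0 j + b) (a * (i == j)%:R).
    apply: (@derivable_comp_line R _ _ (flat p) (fun v : T => a * v 0 j + b)) => //.
    move=> h; rewrite !mxE eqxx /= eq_sym /GRing.scale /=; ring.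
  split.
  + by move=> v; exact: (continuous_comp (cc v) (@continuous_flat _ p _)).
  + by move=> v; have [] := D v.
  + rewrite (_ : partial i _ = fun v =>
        (a * (i == j)%:R) * flat (flat_deriv p) (a * v 0 j + b)).
      by apply: flat_mul; [exact: flat_cst|exact: flat_coord].
    by apply/funext => v; have [_] := D v.
- split; first exact: continuous_addf.
    by move=> x; exact: derivableD.
  rewrite (_ : partial i _ = fun v => partial i f v + partial i g v).
    exact: flat_add.
  by apply/funext => v; exact: deriveD.
- split; first exact: continuous_mulf.
    by move=> x; exact: derivableM.
  rewrite (_ : partial i _ = fun v => f v * partial i g v + g v * partial i f v).
    by apply: flat_add; apply: flat_mul.
  by apply/funext => v; exact: deriveM.
Qed.

Lemma flat_expr_smooth f : (0 < N)%N -> flat_expr f -> smooth f.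
Proof.
move=> N0 ef s.
have es : flat_expr (partials s f).
  by elim: s => //= i s IH; have [] := flat_expr_partial i IH.
split; first by have [] := flat_expr_partial (Ordinal N0) es.
by move=> i; have [] := flat_expr_partial i es.
Qed.

Lemma flat_expr_prod (I : Type) (r : seq I) (F : I -> T -> R) :
  (forall i, flat_expr (F i)) -> flat_expr (fun v => \prod_(i <- r) F i v).
Proof.
move=> eF; elim: r => [|i r IH].
  rewrite (_ : (fun v => _) = (fun=> 1)); first exact: flat_cst.
  by apply/funext => v; rewrite big_nil.
rewrite (_ : (fun v => _) = (fun v => F i v * \prod_(i <- r) F i v)).
  exact: flat_mul.
by apply/funext => v; rewrite big_cons.
Qed.

Definition open_box (a b : T) : set T := [set v | forall i, a 0 i < v 0 i < b 0 i].
Definition closed_box (a b : T) : set T := [set v | forall i, a 0 i <= v 0 i <= b 0 i].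

(** A smooth approximation of the indicator of [open_box a b] from below: as [k] grows the values
    tend to 0 or 1, while the support stays in the fixed closed box, hence in any domain containing
    it. *)
Definition bump (k : R) (a b v : T) : R :=
  \prod_i (flat 1 (k * (v 0 i - a 0 i)) * flat 1 (k * (b 0 i - v 0 i))).

Lemma bump_expr k a b : flat_expr (bump k a b).
Proof.
apply: flat_expr_prod => i; apply: flat_mul.
  rewrite (_ : (fun v => _) = fun v : T => flat 1 (k * v 0 i + - k * a 0 i)).
    exact: flat_coord.
  by apply/funext => v; congr (flat _ _); ring.
rewrite (_ : (fun v => _) = fun v : T => flat 1 (- k * v 0 i + k * b 0 i)).
  exact: flat_coord.
by apply/funext => v; congr (flat _ _); ring.
Qed.

Lemma bump_ge0 k a b v : 0 <= bump k a b v.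
Proof. by apply: prodr_ge0 => i _; rewrite mulr_ge0 ?flat1_ge0. Qed.

Lemma bump_le1 k a b v : bump k a b v <= 1.
Proof.
apply: prodr_ile1 => i _; rewrite mulr_ge0 ?flat1_ge0//=.
by rewrite mulr_ile1 ?flat1_ge0 ?flat1_le1.
Qed.

Lemma bump_support k a b : 0 < k -> [set v | bump k a b v != 0] `<=` open_box a b.
Proof.
move=> k0 v /= bv i; apply/andP; split; rewrite ltNge; apply: contra_neqN bv => H.
  by rewrite /bump (bigD1 i)//= flat1_eq0 ?mul0r// mulr_ge0_le0 ?subr_le0// ltW.
by rewrite /bump (bigD1 i)//= [X in _ * X * _]flat1_eq0 ?mulr0 ?mul0r// mulr_ge0_le0 ?subr_le0// ltW.
Qed.

Lemma closed_boxE (a b : T) :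
  closed_box a b = [set v | forall i, `[a 0 i, b 0 i]%classic (v ord0 i)].
Proof. by apply/seteqP; split=> v /= H i; have := H i; rewrite in_itv. Qed.

Lemma compact_closed_box a b : compact (closed_box a b).
Proof.
rewrite closed_boxE; apply: (@rV_compact _ N (fun i => `[a 0 i, b 0 i]%classic)) => i.
exact: segment_compact.
Qed.

Lemma open_box_sub_closed a b : open_box a b `<=` closed_box a b.
Proof. by move=> v H i; have /andP[/ltW -> /ltW ->] := H i. Qed.

Lemma measurable_open_box a b : measurable (open_box a b).
Proof.
rewrite (_ : open_box a b = \bigcap_(i in [set: 'I_N])
    (fun v : T => v 0 i) @^-1` `]a 0 i, b 0 i[%classic).
  apply: fin_bigcap_measurable => // i _.
  by rewrite -[X in measurable X]setTI; apply: measurable_coord => //.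
by apply/seteqP; split=> v /= H i; have := H i; rewrite /= in_itv/= => // /(_ I).
Qed.

Lemma test_bump (Omega : domain R N) k a b : (0 < N)%N -> 0 < k ->
  closed_box a b `<=` Omega -> test_function Omega (bump k a b).
Proof.
move=> N0 k0 abO.
have sub : closure [set v | bump k a b v != 0] `<=` closed_box a b.
  have cb : closed (closed_box a b) by apply: compact_closed => //; exact: compact_closed_box.
  have /closure_id -> := cb; apply: closure_subset.
  by apply: subset_trans (bump_support k0) _; exact: open_box_sub_closed.
split.
- exact/flat_expr_smooth/bump_expr.
- apply: (@subclosed_compact _ _ (closed_box a b) _ _ sub); first exact: closed_closure.
  exact: compact_closed_box.
- exact: subset_trans sub abO.
Qed.

Lemma bump_cvg a b v : bump n.+1%:R a b v @[n --> \oo] --> (\1_(open_box a b) v : R).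
Proof.
have E : \1_(open_box a b) v =
    \prod_i ((0 < v 0 i - a 0 i)%R%:R * (0 < b 0 i - v 0 i)%R%:R) :> R.
  rewrite indicE; case: (boolP (v \in _)) => [/set_mem H|].
    rewrite big1// => i _; have /andP[h1 h2] := H i.
    by rewrite !subr_gt0 h1 h2 mulr1.
  rewrite notin_setE => /existsNP[i /negP]; rewrite negb_and => /orP H.
  rewrite (bigD1 i)//= !subr_gt0; case: H => /negbTE ->; by rewrite ?(mulr0, mul0r).
rewrite E /bump; elim: (index_enum _) => [|i r IH].
  by rewrite big_nil; under eq_fun do rewrite big_nil; exact: cvg_cst.
rewrite big_cons; under eq_fun do rewrite big_cons.
by apply: cvgM => //; apply: cvgM; exact: flat1_cvg.
Qed.

End bump.

Section open_boxes.
Context {R : realType} {N : nat}.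
Local Notation T := ('rV[R]_N).

Definition open_boxes : set (set T) := [set A | exists a b, A = open_box a b].

Lemma open_boxI (a b c d : T) :
  open_box a b `&` open_box c d =
  open_box (\row_i Num.max (a 0 i) (c 0 i)) (\row_i Num.min (b 0 i) (d 0 i)).
Proof.
apply/seteqP; split=> [v [H1 H2] i|v H].
  by rewrite !mxE gt_max lt_min; have /andP[-> ->] := H1 i; have /andP[-> ->] := H2 i.
by split=> i; have := H i; rewrite !mxE gt_max lt_min => /andP[/andP[? ?] /andP[? ?]]; apply/andP.
Qed.

Lemma setI_closed_open_boxes : setI_closed open_boxes.
Proof. by move=> _ _ [a [b ->]] [c [d ->]]; rewrite open_boxI; eexists; eexists. Qed.

(* [{v | c < v i}] is the union of the boxes with i-th side [(c, n)] and all
   other sides [(-n, n)]. *)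
Lemma open_boxes_generate (A : set T) : measurable A -> <<s open_boxes >> A.
Proof.
pose G := g_sigma_algebraType open_boxes.
have mid : @measurable_fun _ _ G T setT (fun v : T => v).
  apply/measurable_fun_rVP => i.
  apply: (measurability _ (RGenOInfty.measurableE R)).
  move=> _ [_ [c ->] <-]; rewrite setTI.
  rewrite (_ : _ @^-1` _ = \bigcup_n open_box
      (\row_j if j == i then c else - n%:R) (const_mx n%:R)).
    apply: bigcup_measurable => n _; apply: sub_sigma_algebra.
    by eexists; eexists.
  apply/seteqP; split=> [v /= |v [n _ /(_ i)]]; last first.
    by rewrite !mxE eqxx /= in_itv/= andbT => /andP[].
  rewrite in_itv/= andbT => cv.
  have [K KP] : exists K : nat, forall j, `|v 0 j| < K%:R.
    pose F (j : 'I_N) := (Num.truncn `|v 0 j|).+1.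
    exists (\max_j F j)%N => j.
    by apply: lt_le_trans (truncnS_gt _) _; rewrite ler_nat (leq_bigmax (F := F)).
  exists K => // j; rewrite !mxE; have := KP j; rewrite ltr_norml => /andP[h1 h2].
  by rewrite h2 andbT; case: eqP => [->|].
by move=> mA; have := mid measurableT A mA; rewrite setTI.
Qed.

End open_boxes.

(** * Integration by parts on a bounded domain *)

Section bounded_domain.
Context {R : realType} {N : nat} (Omega : domain R N).
Hypothesis bO : bounded_set (Omega : set 'rV[R]_N).
Local Notation T := ('rV[R]_N).
Local Notation mu := (lebesgue_on Omega).
Local Notation test := (test_function Omega).
Local Notation L := (Lfun mu 2%:E).
Implicit Types (f g phi psi : T -> R).

Lemma domain_cube : exists2 M : R, 0 < M & Omega `<=` cube N M.
Proof.
have [M [_ MO]] := bO; exists (`|M| + 1); first by rewrite ltr_wpDl.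
move=> x Ox i; apply: (@le_trans _ _ `|x|); last first.
  by apply: MO => //; rewrite (le_lt_trans (ler_norm _))// ltrDl.
rewrite [leRHS]/Num.norm /= mx_normrE.
by apply: le_trans (le_bigmax _ _ (0, i)).
Qed.

Lemma lebesgue_on_cube M : (mu (cube N M) < +oo)%E.
Proof.
apply: le_lt_trans (lebesgue_cube N M); rewrite /= /mrestr.
have mO := open_measurable_rV (domain_open Omega).
have mc := @measurable_cube R N M.
by apply: le_measure; rewrite ?inE//; exact: measurableI.
Qed.

Lemma lebesgue_on_finite : (mu setT < +oo)%E.
Proof.
have [M _ OM] := domain_cube; apply: le_lt_trans (lebesgue_cube N M).
rewrite /= /mrestr setTI.
apply: le_measure => //; rewrite inE; first exact: open_measurable_rV (domain_open Omega).
exact: measurable_cube.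
Qed.

Lemma integral_lebesgue_on f : (forall x, ~ domain_set Omega x -> f x = 0) ->
  (\int[mu]_x (f x)%:E = \int[lebesgue_rV N]_x (f x)%:E)%E.
Proof.
move=> f0.
have fE : (fun x => (f x)%:E) = ((fun x => (f x)%:E) \_ (Omega : set T)).
  apply/funext => x; rewrite patchE; case: ifPn => // /negP.
  by rewrite inE => /f0 ->.
rewrite fE -!integral_mkcond; apply: eq_measure_integral => A mA AO.
by rewrite /= /mrestr setIidl.
Qed.

Lemma test_eq0 phi x : test phi -> ~ domain_set Omega x -> phi x = 0.
Proof.
move=> [_ _ phiO] Ox; apply/eqP/negPn/negP => px.
by apply: Ox; apply: phiO; exact: subset_closure.
Qed.

Lemma test_continuous phi : test phi -> continuous phi.
Proof. by move=> [sp _ _]; exact: smooth_continuous. Qed.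

Lemma test_derivable i phi x : test phi -> derivable phi x (delta_mx 0 i).
Proof. by move=> [sp _ _]; exact: smooth_derivable. Qed.

Lemma test_Lfun phi : test phi -> phi \in L.
Proof.
move=> tp; have [M M0 OM] := domain_cube.
apply: (@Lfun2_cube _ _ _ _ M); first exact: test_continuous.
  by move=> x xM; apply: (test_eq0 tp) => /OM.
exact: lebesgue_on_cube.
Qed.

Lemma bounded_Lfun f C : measurable_fun setT f -> (forall x, `|f x| <= C) -> f \in L.
Proof.
move=> mf fC; apply/Lfun2P; split=> //.
have C0 : 0 <= C by apply: le_trans (fC 0).
apply: (@le_lt_trans _ _ (\int[mu]_x (C ^+ 2)%:E)%E).
  apply: ge0_le_integral => //.
  - by move=> x _; rewrite lee_fin sqr_ge0.
  - by apply/measurable_EFinP; exact: measurable_funX.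
  - move=> x _; rewrite lee_fin -[f x ^+ 2]ger0_norm ?sqr_ge0// normrX.
    by rewrite ler_sqr ?nnegrE.
by rewrite integral_cst// lte_mul_pinfty ?lee_fin ?sqr_ge0// lebesgue_on_finite.
Qed.

Lemma integral_on_partial_eq0 i f : (forall x, derivable f x (delta_mx 0 i)) ->
  continuous (partial i f) -> (forall x, ~ domain_set Omega x -> f x = 0) ->
  (forall x, ~ domain_set Omega x -> partial i f x = 0) ->
  \int[mu]_x partial i f x = 0.
Proof.
move=> df cf f0 pf0; have [M M0 OM] := domain_cube.
rewrite /Rintegral integral_lebesgue_on// (@integral_partial_eq0 _ _ _ _ M)//.
by move=> x xM; apply: f0 => /OM.
Qed.

Lemma integration_by_parts i phi psi : test phi -> test psi ->
  pairing Omega (partial i phi) psi = - pairing Omega phi (partial i psi).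
Proof.
move=> tp tq; apply/eqP; rewrite -addr_eq0.
have tpi := test_partial i tp; have tqi := test_partial i tq.
rewrite /pairing -RintegralD//; last 2 first.
  by apply: Lfun2_integrableM; exact: test_Lfun.
  by apply: Lfun2_integrableM; exact: test_Lfun.
have dpq x : partial i (fun x => phi x * psi x) x =
    partial i phi x * psi x + phi x * partial i psi x.
  have d1 : derivable phi x (delta_mx 0 i) by exact: test_derivable.
  have d2 : derivable psi x (delta_mx 0 i) by exact: test_derivable.
  rewrite /partial (deriveM d1 d2).
  by rewrite addrC /GRing.scale /= [X in X + _]mulrC.
rewrite -[X in X == _](_ : \int[mu]_x partial i (fun x => phi x * psi x) x = _); last first.
  by apply: eq_Rintegral => x _.
rewrite integral_on_partial_eq0//.
- by move=> x; apply: derivableM; exact: test_derivable.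
- rewrite (_ : partial i _ = fun x => partial i phi x * psi x + phi x * partial i psi x).
    by apply: continuous_addf; apply: continuous_mulf; exact: test_continuous.
  by apply/funext.
- by move=> x Ox; rewrite (test_eq0 tp Ox) mul0r.
- by move=> x Ox; rewrite dpq (test_eq0 tp Ox) (test_eq0 tq Ox) mulr0 mul0r addr0.
Qed.

Lemma integral_test_partial i phi : test phi -> \int[mu]_x partial i phi x = 0.
Proof.
move=> tp; have tpi := test_partial i tp; apply: integral_on_partial_eq0.
- by move=> x; exact: test_derivable.
- exact: test_continuous.
- by move=> x; exact: test_eq0.
- by move=> x; exact: test_eq0.
Qed.

(* Integrates [x_i * phi ^ 2] by parts. *)
Lemma friedrichs_identity i phi : test phi ->
  pairing Omega phi phi = - (2 * pairing Omega (fun x : T => x 0 i * phi x) (partial i phi)).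
Proof.
move=> tp; have tpi := test_partial i tp.
have ct := test_continuous tp; have cti := test_continuous tpi.
have cc := @continuous_coord R N i.
have [M M0 OM] := domain_cube.
have xL : (fun x : T => x 0 i * phi x) \in L.
  apply: (@Lfun2_cube _ _ _ _ M); last exact: lebesgue_on_cube.
    exact: continuous_mulf.
  by move=> x xM; rewrite (test_eq0 tp) ?mulr0// => /OM.
have dc (x : T) : derivable (fun x : T => x 0 i) x (delta_mx 0 i) /\
    'D_(delta_mx 0 i) (fun x : T => x 0 i) x = 1.
  have dl : differentiable (fun x : T => x 0 i) x by exact: differentiable_coord.
  split; first exact: diff_derivable.
  have := @derivable_comp_line R _ _ (id : R -> R) (fun x : T => x 0 i) x (delta_mx 0 i) 1.
  case.
  - by move=> h; rewrite !mxE !eqxx.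
  - exact: derivable_id.
  - by move=> _ ->; rewrite derive_id.
have df x : partial i (fun x : T => x 0 i * (phi x * phi x)) x =
    phi x * phi x + 2 * (x 0 i * phi x * partial i phi x).
  have [d1 d1E] := dc x; have d2 : derivable phi x (delta_mx 0 i) by exact: test_derivable.
  rewrite /partial (deriveM d1 (derivableM d2 d2)) d1E (deriveM d2 d2) /GRing.scale /=.
  by rewrite -[(phi * phi) x]/(phi x * phi x); ring.
apply/eqP; rewrite -addr_eq0.
rewrite /pairing -RintegralZl//; last by apply: Lfun2_integrableM => //; exact: test_Lfun.
rewrite -RintegralD//; last 2 first.
- by apply: Lfun2_integrableM => //; exact: test_Lfun.
- rewrite (_ : _ \o _ = fun x : T => (2%:E * (x 0 i * phi x * partial i phi x)%:E)%E)//.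
  by apply: integrableZl => //; apply: Lfun2_integrableM => //; exact: test_Lfun.
rewrite -[X in X == _](_ : \int[mu]_x partial i (fun x : T => x 0 i * (phi x * phi x)) x = _); last first.
  by apply: eq_Rintegral => x _; rewrite df.
rewrite integral_on_partial_eq0//.
- move=> x; have [d1 _] := dc x; have d2 : derivable phi x (delta_mx 0 i) by exact: test_derivable.
  exact: (derivableM d1 (derivableM d2 d2)).
- rewrite (_ : partial i _ = fun x : T => phi x * phi x + 2 * (x 0 i * phi x * partial i phi x)).
    apply: continuous_addf; first exact: continuous_mulf.
    apply: continuous_mulf; first exact: cst_continuous.
    by apply: continuous_mulf => //; exact: continuous_mulf.
  by apply/funext.
- by move=> x Ox; rewrite (test_eq0 tp Ox) !mulr0.
- by move=> x Ox; rewrite df (test_eq0 tp Ox) !(mulr0, mul0r) addr0.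
Qed.

End bounded_domain.

Section density.
Context {R : realType} {N : nat} (Omega : domain R N).
Hypotheses (N_gt0 : (0 < N)%N) (bO : bounded_set (Omega : set 'rV[R]_N)).
Local Notation T := ('rV[R]_N).
Local Notation mu := (lebesgue_on Omega).
Local Notation test := (test_function Omega).
Local Notation L := (Lfun mu 2%:E).

Lemma L2_integrable (u : L2 Omega) : mu.-integrable setT (EFin \o (u : T -> R)).
Proof.
apply/Lfun1_integrable; have : (u : T -> R) \in L by exact: L2_Lfun.
apply: (Lfun_subset12 (mu := mu)); rewrite ge0_fin_numE//; exact: lebesgue_on_finite.
Qed.

Section orthogonal_to_tests.
Variables (u : L2 Omega).
Hypothesis u0 : forall phi, test phi -> pairing Omega u phi = 0.

(** Dominated convergence along the bumps, whose pairings with [u] vanish. The dominating function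
    |u| is integrable because a bounded domain has finite measure. *)
Lemma integral_open_box_eq0 a b : closed_box a b `<=` Omega ->
  (\int[mu]_(x in open_box a b) (u x)%:E = 0)%E.
Proof.
move=> abO; have iu := L2_integrable u; have mub := @measurable_open_box R N a b.
have mu_ : measurable_fun setT (u : T -> R) by apply: Lfun2_measurable; exact: L2_Lfun.
have tb n : test (bump n.+1%:R a b) by exact: test_bump.
have mb n : measurable_fun setT (bump n.+1%:R a b).
  exact: (continuous_measurable_rV (test_continuous (tb n))).
pose f_ n x := (u x * bump n.+1%:R a b x)%:E.
pose f x := (u x * \1_(open_box a b) x)%:E.
have := @dominated_convergence _ _ _ mu setT measurableT f_ f (abse \o (EFin \o (u : T -> R))).
case.
- by move=> n; apply/measurable_EFinP; exact: measurable_funM.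
- by apply/measurable_EFinP; apply: measurable_funM => //; exact: measurable_indic.
- apply: aeW => x _; apply: cvg_EFin; first exact: nearW.
  by apply: cvgM; [exact: cvg_cst|exact: bump_cvg].
- exact: integrable_abse.
- apply: aeW => x n _ /=; rewrite lee_fin normrM ler_piMr//.
  by rewrite ger0_norm ?bump_ge0 ?bump_le1.
move=> _ _ H.
have E n : (\int[mu]_x f_ n x = 0)%E.
  have iub := Lfun2_integrableM (L2_Lfun u) (test_Lfun bO (tb n)).
  have fn : (\int[mu]_x f_ n x)%E \is a fin_num by exact: integrable_fin_num.
  by rewrite -(fineK fn); congr EFin; exact: (u0 (tb n)).
have {H} : (fun n => \int[mu]_x f_ n x)%E @ \oo --> (\int[mu]_x f x)%E by [].
rewrite (_ : (fun n => _) = cst 0%E); last by apply/funext => n; exact: E.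
move=> H; transitivity (\int[mu]_x f x)%E.
  rewrite integral_mkcond; apply: eq_integral => x _.
  by rewrite patchE /f indicE; case: ifP => _; rewrite ?mulr1 ?mulr0.
by rewrite -(cvg_lim _ H)// lim_cst.
Qed.

(** The sets [A] with this property form a Dynkin system; complements are covered because the
    integral over the whole box vanishes. It contains the open boxes, which are stable under
    intersection and generate the Borel sets. *)
Lemma integral_box_eq0 a b A : closed_box a b `<=` Omega -> measurable A ->
  (\int[mu]_(x in A `&` open_box a b) (u x)%:E = 0)%E.
Proof.
move=> abO mA; have iu := L2_integrable u; have mQ := @measurable_open_box R N a b.
have muB B : measurable B -> measurable_fun B (fun x => (u x)%:E).
  by move=> mB; apply: measurable_funS (measurable_int _ iu).
pose P := [set B | measurable B /\ (\int[mu]_(x in B `&` open_box a b) (u x)%:E = 0)%E].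
suff : P A by case.
have : <<d open_boxes >> A.
  rewrite setI_closed_g_dynkin_g_sigma_algebra; last exact: setI_closed_open_boxes.
  exact: open_boxes_generate.
apply: smallest_sub.
  split.
  - by split=> //; rewrite setTI; exact: integral_open_box_eq0.
  - move=> B [mB B0]; split; first exact: measurableC.
    have := integral_open_box_eq0 abO.
    rewrite -{1}(setIidr (@subsetT _ (open_box a b))) -(setUv B) setIUl.
    rewrite integral_setU ?B0 ?add0e//.
    + exact: measurableI.
    + by apply: measurableI => //; exact: measurableC.
    + by apply: muB; apply: measurableU; apply: measurableI => //; exact: measurableC.
    + by apply/disj_setPS => x [[Bx _] []].
  - move=> F tF PF; have mF k : measurable (F k) by case: (PF k).
    split; first exact: bigcupT_measurable.
    rewrite setI_bigcupl integral_bigcup.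
    + by rewrite eseries0// => k _ _; case: (PF k).
    + by apply: trivIset_setIr.
    + by move=> k; exact: measurableI.
    + apply: integrableS iu => //.
      by apply: bigcupT_measurable => k; exact: measurableI.
move=> _ [c [d ->]]; split; first exact: measurable_open_box.
rewrite open_boxI; apply: integral_open_box_eq0.
apply: subset_trans abO => v H i; have := H i; rewrite !mxE ge_max le_min.
by move=> /andP[/andP[_ ->] /andP[_ ->]].
Qed.

Lemma open_box_ae_eq0 a b : closed_box a b `<=` Omega ->
  ae_eq mu (open_box a b) (EFin \o (u : T -> R)) (cst 0%E).
Proof.
move=> abO; apply: integral_ae_eq => //.
- exact: measurable_open_box.
- by apply: integrableS (L2_integrable u) => //; exact: measurable_open_box.
- move=> A Aab mA; rewrite -{1}(setIidl Aab) integral_box_eq0//.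
  by rewrite integral_cst// mul0e.
Qed.

(** Countability of the index type is the point: centres are rational and half-sides are 1 / (k+1).
    A centre within 1 / (k+1) of [x] gives a box inside the ball of radius e as soon as 1 / (k+1) <
    e / 2. The enumeration also lists boxes that leave the domain, so the inclusion is attached to
    the index. *)
Lemma domain_box_cover : exists F : ('rV[rat]_N * nat) -> T * T,
  forall x, domain_set Omega x -> exists2 q, closed_box (F q).1 (F q).2 `<=` Omega &
    open_box (F q).1 (F q).2 x.
Proof.
pose F (q : 'rV[rat]_N * nat) : T * T :=
  (\row_i (ratr (q.1 0 i) - q.2.+1%:R^-1), \row_i (ratr (q.1 0 i) + q.2.+1%:R^-1)).
exists F => x Ox.
have /nbhs_ballP[e /= e0 xeO] : nbhs x (domain_set Omega).
  exact: open_nbhs_nbhs (conj (domain_open Omega) Ox).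
have e20 : 0 < e / 2 by rewrite divr_gt0.
have [k _ /(_ k (leqnn k)) /= ke] := near_infty_natSinv_lt (PosNum e20).
have k0 : 0 < k.+1%:R^-1 :> R by rewrite invr_gt0.
have /choice[q qP] : forall i : 'I_N, exists q : rat, `|ratr q - x 0 i| < k.+1%:R^-1.
  move=> i; have [q] := @rat_in_itvoo R (x 0 i - k.+1%:R^-1) (x 0 i + k.+1%:R^-1)
    ltac:(by rewrite ltrBlDr -addrA ltrDl addr_gt0).
  by rewrite in_itv/= => /andP[q1 q2]; exists q; rewrite ltr_distl q1.
exists (\row_i q i, k) => [v vF|i]; last first.
  have := qP i; rewrite !mxE ltr_distl => /andP[h1 h2].
  by rewrite ltrBlDr h2 /= -ltrBlDr h1.
apply: xeO; split => // i j; rewrite !ord1 /ball/=.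
have := vF j; rewrite !mxE => /andP[h1 h2]; have := qP j.
rewrite ltr_distl => /andP[h3 h4]; rewrite ltr_distl.
move: (ratr (q j)) (v 0 j) (x 0 j) k.+1%:R^-1 ke k0 h1 h2 h3 h4 => p y z d.
by move=> de d0 h1 h2 h3 h4; apply/andP; split; lra.
Qed.

Lemma orthogonal_test_eq0 : u = 0.
Proof.
have [F FP] := domain_box_cover; apply/L2_eqP.
pose Z q : set T := if pselect (closed_box (F q).1 (F q).2 `<=` Omega) then
   [set x | open_box (F q).1 (F q).2 x /\ u x <> 0] else set0.
have Zneg q : mu.-negligible (Z q).
  rewrite /Z; case: pselect => qO; last exact: negligible_set0.
  have := open_box_ae_eq0 qO; apply: negligibleS => x /= [xq ux] H.
  by apply: ux; have [] := H xq.
(* [unpickle] turns the countable family of boxes into a sequence, with the empty set for codes of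
   no box. *)
have Uneg : mu.-negligible (\bigcup_n (oapp Z set0 (unpickle n))).
  by apply: negligible_bigcup => n; case: unpickle => //=; exact: negligible_set0.
have Oneg : mu.-negligible (~` (domain_set Omega)).
  exists (~` domain_set Omega); split => //.
    by apply: measurableC; exact: open_measurable_rV (domain_open Omega).
  by rewrite /= /mrestr setICl measure0.
have : mu.-negligible ((\bigcup_n (oapp Z set0 (unpickle n))) `|` ~` domain_set Omega).
  exact: negligibleU.
have z0 := L2_0E Omega; move: z0 => /[swap] Hneg.
have ae0 : {ae mu, forall x, u x = 0}.
  apply: negligibleS Hneg => x /= ux; have [Ox|] := pselect (domain_set Omega x); last by right.
  left; have [q qO xq] := FP x Ox; exists (pickle q) => //.
  by rewrite pickleK /= /Z; case: pselect.
by move: ae0; apply: filterS2 => x /= -> /(_ I) ->.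
Qed.

End orthogonal_to_tests.
End density.

(** * Weak derivatives *)

Opaque dot.

Section dot_theory.
Context {R : realType} {N : nat} (Omega : domain R N).
Local Notation H := (L2 Omega).
Local Notation fd := (dot_form Omega).
Let sT := @subspaceT R H.
Implicit Types u v w : H.

Lemma dotC u v : dot u v = dot v u. Proof. exact: (formC fd). Qed.
Lemma dot_ge0 u : 0 <= dot u u. Proof. exact: (form_ge0 fd). Qed.
Lemma dotPl a u v w : dot (a *: u + v) w = a * dot u w + dot v w.
Proof. exact: (form_linearl fd). Qed.
Lemma dotPr a u v w : dot w (a *: u + v) = a * dot w u + dot w v.
Proof. exact: (form_linearr sT fd). Qed.
Lemma dotBl u v w : dot (u - v) w = dot u w - dot v w.
Proof. exact: (formBl fd). Qed.
Lemma dotBr u v w : dot w (u - v) = dot w u - dot w v.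
Proof. by rewrite dotC dotBl !(dotC w). Qed.
Lemma dotDl u v w : dot (u + v) w = dot u w + dot v w.
Proof. exact: (linear_onD (form_linearl fd I)). Qed.
Lemma dotDr u v w : dot w (u + v) = dot w u + dot w v.
Proof. by rewrite dotC dotDl !(dotC w). Qed.
Lemma dot0l u : @dot R N Omega 0 u = 0.
Proof. by rewrite -(subrr u) dotBl subrr. Qed.
Lemma dot0r u : @dot R N Omega u 0 = 0. Proof. by rewrite dotC dot0l. Qed.
Lemma dotNl u v : dot (- u) v = - dot u v.
Proof. by rewrite -[- u]add0r dotBl dot0l add0r. Qed.
Lemma dotNr u v : dot u (- v) = - dot u v.
Proof. by rewrite dotC dotNl dotC. Qed.
Lemma dot_sqrN u : dot (- u) (- u) = dot u u.
Proof. by rewrite dotNl dotNr opprK. Qed.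
Lemma dot_sumr (I : Type) (r : seq I) (F : I -> H) u :
  dot u (\sum_(k <- r) F k) = \sum_(k <- r) dot u (F k).
Proof. exact: (big_morph (dot u) (fun v w => dotDr v w u) (dot0r u)). Qed.
Lemma dot_suml (I : Type) (r : seq I) (F : I -> H) u :
  dot (\sum_(k <- r) F k) u = \sum_(k <- r) dot (F k) u.
Proof. exact: (big_morph (fun v => dot v u) (fun v w => dotDl v w u) (dot0l u)). Qed.
Lemma dot_cauchy_schwarz u v : dot u v ^+ 2 <= dot u u * dot v v.
Proof. exact: (form_cauchy_schwarz sT fd). Qed.
Lemma dot_distC u v : dot (u - v) (u - v) = dot (v - u) (v - u).
Proof. exact: (form_sqr_distC sT fd). Qed.
Lemma dot_sqrD_le u v : dot (u + v) (u + v) <= 2 * dot u u + 2 * dot v v.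
Proof. exact: (form_sqrD_le sT fd). Qed.

Lemma dot_sqrZ a u : dot (a *: u) (a *: u) = a ^+ 2 * dot u u.
Proof. by have := form_sqr sT fd a 0 (I : setT u) (I : setT u); rewrite scale0r addr0 => ->; ring. Qed.

Lemma dot_sqr_linear_le a u v :
  dot (a *: u + v) (a *: u + v) <= 2 * a ^+ 2 * dot u u + 2 * dot v v.
Proof. by apply: le_trans (dot_sqrD_le _ _) _; rewrite dot_sqrZ mulrA. Qed.

Lemma dot_sqr_le_dist u v : dot u u <= 2 * dot (u - v) (u - v) + 2 * dot v v.
Proof. by have := dot_sqrD_le (u - v) v; rewrite subrK. Qed.

Lemma sqr_le_mul (x y : R) : 0 <= x -> 0 <= y -> x ^+ 2 <= y * x -> x <= y.
Proof.
rewrite le_eqVlt => /predU1P[<- //|x0] y0.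
by rewrite expr2 ler_pM2r.
Qed.

Lemma le_of_small (x y K : R) : 0 <= K ->
  (forall e, 0 < e -> x <= y + K * e) -> x <= y.
Proof.
move=> K0 xy; apply/ler_addgt0Pr => e e0.
have K1 : 0 < K + 1 by lra.
have := xy (e / (K + 1)) ltac:(by rewrite divr_gt0).
have : K * (e / (K + 1)) <= e.
  by rewrite mulrCA ger_pMr// ler_pdivrMr//; lra.
lra.
Qed.

(** The defect of the relation is linear in the errors u - u' and g - g', and Cauchy-Schwarz bounds
    its square. The coefficient [c] makes one lemma serve weak derivatives (a sign), the weak
    Laplacian (1) and orthogonality relations (0). *)
Lemma dot_relation_closed u (g a b : H) (c : R) :
  (forall e : R, 0 < e -> exists u' g' : H, [/\ dot u' a = c * dot g' b,
     dot (u - u') (u - u') < e & dot (g - g') (g - g') < e]) ->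
  dot u a = c * dot g b.
Proof.
move=> H0; apply/eqP; rewrite -subr_eq0 -sqrf_eq0; apply/eqP/le_anti.
rewrite sqr_ge0 andbT.
apply: (@le_of_small _ _ (2 * dot a a + 2 * c ^+ 2 * dot b b)).
  have := dot_ge0 a; have := mulr_ge0 (sqr_ge0 c) (dot_ge0 b).
  clear; move: (dot a a) (dot b b) => p q; lra.
move=> e e0; have [u' [g' [E ue ge]]] := H0 e e0; rewrite add0r.
have -> : dot u a - c * dot g b = dot (u - u') a - c * dot (g - g') b.
  by rewrite !dotBl E; ring.
have h1 := dot_cauchy_schwarz (u - u') a.
have h2 := dot_cauchy_schwarz (g - g') b.
have h3 : dot (u - u') (u - u') * dot a a <= e * dot a a.
  exact: ler_wpM2r (dot_ge0 a) _ _ (ltW ue).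
have h4 : dot (g - g') (g - g') * dot b b <= e * dot b b.
  exact: ler_wpM2r (dot_ge0 b) _ _ (ltW ge).
have h5 : c ^+ 2 * dot (g - g') b ^+ 2 <= c ^+ 2 * (e * dot b b).
  by rewrite ler_wpM2l ?sqr_ge0//; exact: le_trans h4.
move: h1 h3 h5; move: (dot (u - u') a) (dot (g - g') b) (dot a a) (dot b b).
move: (dot (u - u') (u - u')) => p q r s t h1 h3 h5.
have := sqr_ge0 (q + c * r); rewrite sqrrD sqrrB exprMn => h6.
have -> : (2 * s + 2 * c ^+ 2 * t) * e = 2 * (e * s) + 2 * (c ^+ 2 * (e * t)) by ring.
clear -h1 h3 h5 h6; move: h6; rewrite !mulr2n; lra.
Qed.

Lemma L2norm_sqr u : L2norm Omega u ^+ 2 = dot u u.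
Proof. by rewrite L2normE sqr_sqrtr ?dot_ge0. Qed.

End dot_theory.

Section weak_derivatives.
Context {R : realType} {N : nat} (Omega : domain R N).
Hypotheses (N_gt0 : (0 < N)%N) (bO : bounded_set (Omega : set 'rV[R]_N)).
Local Notation T := ('rV[R]_N).
Local Notation mu := (lebesgue_on Omega).
Local Notation test := (test_function Omega).
Local Notation H := (L2 Omega).
Local Notation e_ := (@cls R N Omega).
Implicit Types (u v w g h f : H) (phi psi : T -> R) (i j : 'I_N) (s : seq 'I_N).

Lemma pairing_dot u phi : test phi -> pairing Omega u phi = dot u (e_ phi).
Proof. by move=> tp; rewrite dot_cls//; exact: test_Lfun. Qed.

Lemma test_dense u : (forall phi, test phi -> dot u (e_ phi) = 0) -> u = 0.
Proof.
by move=> u0; apply: orthogonal_test_eq0 => // phi tp; rewrite pairing_dot// u0.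
Qed.

(** This gives the uniqueness of all weak derivatives, hence the specification of [wpartials],
    [wlaplacian] and [wdiv], which are defined by choice. *)
Lemma test_separates u v : (forall phi, test phi -> dot u (e_ phi) = dot v (e_ phi)) -> u = v.
Proof.
move=> uv; apply/eqP; rewrite -subr_eq0; apply/eqP/test_dense => phi tp.
by rewrite dotBl uv// subrr.
Qed.

Lemma cls_test_linear a phi psi : test phi -> test psi ->
  e_ (fun x => a * phi x + psi x) = a *: e_ phi + e_ psi.
Proof. by move=> tp tq; apply: cls_linear; exact: test_Lfun. Qed.

Lemma cls0 : e_ (fun=> 0) = 0.
Proof.
have := cls_test_linear (-1) (test0 Omega) (test0 Omega).
rewrite scaleN1r addNr => <-; congr (e_ _).
by apply/funext => x; rewrite mulr0 addr0.
Qed.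

Lemma cls_test_sum (I : Type) (r : seq I) (F : I -> T -> R) :
  (forall k, test (F k)) -> e_ (fun x => \sum_(k <- r) F k x) = \sum_(k <- r) e_ (F k).
Proof.
move=> tF; elim: r => [|k r IH].
  by rewrite big_nil -cls0; congr (e_ _); apply/funext => x; rewrite big_nil.
rewrite big_cons -IH -[in RHS](scale1r (e_ (F k))) -cls_test_linear//; last exact: test_sum.
by congr (e_ _); apply/funext => x; rewrite big_cons mul1r.
Qed.

Lemma dot_cls_laplacian u phi : test phi ->
  dot u (e_ (laplacian phi)) = \sum_i dot u (e_ (partial i (partial i phi))).
Proof.
move=> tp; rewrite /laplacian cls_test_sum ?dot_sumr// => k.
by do 2 apply: test_partial.
Qed.

Lemma dot_test_partial i phi psi : test phi -> test psi ->
  dot (e_ (partial i phi)) (e_ psi) = - dot (e_ phi) (e_ (partial i psi)).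
Proof.
move=> tp tq; have tpi := test_partial i tp; have tqi := test_partial i tq.
by rewrite !dot_cls2 ?integration_by_parts//; exact: test_Lfun.
Qed.

Lemma is_wpartialsP s u g : is_wpartials s u g <->
  forall phi, test phi -> dot u (e_ (partials s phi)) = (-1) ^+ size s * dot g (e_ phi).
Proof.
by split=> ug phi tp; have tps := test_partials s tp; have := ug phi tp;
  rewrite !pairing_dot.
Qed.

Lemma is_wlaplacianP u f : is_wlaplacian 1 u f <->
  forall phi, test phi -> dot u (e_ (laplacian phi)) = dot f (e_ phi).
Proof.
by split=> ug phi tp; have tps := test_laplacian tp; have := ug phi tp; rewrite /= !pairing_dot.
Qed.

Lemma is_wpartials_uniq s u g h : is_wpartials s u g -> is_wpartials s u h -> g = h.
Proof.
move=> /is_wpartialsP ug /is_wpartialsP uh; apply: test_separates => phi tp.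
have s0 : (-1) ^+ size s != 0 :> R by rewrite signr_eq0.
by apply: (mulfI s0); rewrite -ug// -uh.
Qed.

Lemma wpartialsE s u g : is_wpartials s u g -> wpartials s u = g.
Proof.
move=> ug; have ex : exists g, is_wpartials s u g by exists g.
apply: (is_wpartials_uniq _ ug).
exact: (@xgetPex _ (L2zero Omega) [set g | is_wpartials s u g] ex).
Qed.

Lemma wpartialsP s u : (exists g, is_wpartials s u g) -> is_wpartials s u (wpartials s u).
Proof. by move=> [g ug]; rewrite (wpartialsE ug). Qed.

Lemma is_wlaplacian_uniq u g h : is_wlaplacian 1 u g -> is_wlaplacian 1 u h -> g = h.
Proof.
move=> /is_wlaplacianP ug /is_wlaplacianP uh; apply: test_separates => phi tp.
by rewrite -ug// -uh.
Qed.

Lemma wlaplacianE u f : is_wlaplacian 1 u f -> wlaplacian u = f.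
Proof.
move=> uf; have ex : exists f, is_wlaplacian 1 u f by exists f.
apply: (is_wlaplacian_uniq _ uf).
exact: (@xgetPex _ (L2zero Omega) [set f | is_wlaplacian 1 u f] ex).
Qed.

Lemma wlaplacianP u : HLap u -> is_wlaplacian 1 u (wlaplacian u).
Proof. by move=> [f uf]; rewrite (wlaplacianE uf). Qed.

Lemma is_wpartials_linear s a u v g h : is_wpartials s u g -> is_wpartials s v h ->
  is_wpartials s (a *: u + v) (a *: g + h).
Proof.
move=> /is_wpartialsP ug /is_wpartialsP vh; apply/is_wpartialsP => phi tp.
by rewrite !dotPl ug// vh//; ring.
Qed.

Lemma is_wlaplacian_linear a u v g h : is_wlaplacian 1 u g -> is_wlaplacian 1 v h ->
  is_wlaplacian 1 (a *: u + v) (a *: g + h).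
Proof.
move=> /is_wlaplacianP ug /is_wlaplacianP vh; apply/is_wlaplacianP => phi tp.
by rewrite !dotPl ug// vh.
Qed.

Lemma is_wpartials0 s : is_wpartials s (0 : H) 0.
Proof. by apply/is_wpartialsP => phi tp; rewrite !dot0l mulr0. Qed.

Lemma is_wlaplacian0 : is_wlaplacian 1 (0 : H) 0.
Proof. by apply/is_wlaplacianP => phi tp; rewrite !dot0l. Qed.

Lemma is_wpartials_closed s u g :
  (forall e : R, 0 < e -> exists u' g', [/\ is_wpartials s u' g',
     dot (u - u') (u - u') < e & dot (g - g') (g - g') < e]) ->
  is_wpartials s u g.
Proof.
move=> ug; apply/is_wpartialsP => phi tp; apply: dot_relation_closed => e e0.
have [u' [g' [/is_wpartialsP u'g' ue ge]]] := ug e e0.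
by exists u', g'; split => //; exact: u'g'.
Qed.

Lemma is_wlaplacian_closed u g :
  (forall e : R, 0 < e -> exists u' g', [/\ is_wlaplacian 1 u' g',
     dot (u - u') (u - u') < e & dot (g - g') (g - g') < e]) ->
  is_wlaplacian 1 u g.
Proof.
move=> ug; apply/is_wlaplacianP => phi tp.
rewrite -[RHS]mul1r; apply: dot_relation_closed => e e0.
have [u' [g' [/is_wlaplacianP u'g' ue ge]]] := ug e e0.
by exists u', g'; split => //; rewrite mul1r u'g'.
Qed.

(** The outer derivative is moved onto [phi] by parts, and the induction hypothesis is used for
    [partial i phi]. The derivatives then come in the wrong order, which Schwarz's theorem
    repairs. *)
Lemma is_wpartials_test s phi : test phi -> is_wpartials s (e_ phi) (e_ (partials s phi)).
Proof.
move=> tp; apply/is_wpartialsP; elim: s phi tp => [|i s IH] phi tp psi tq.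
  by rewrite /= mul1r.
have tpi := test_partial i tp; have tsq := test_partials s tq.
rewrite -[partials (i :: s) psi]/(partial i (partials s psi)).
have -> : dot (e_ phi) (e_ (partial i (partials s psi))) =
    - dot (e_ (partial i phi)) (e_ (partials s psi)) by rewrite dot_test_partial// opprK.
have sp : smooth phi by case: tp.
rewrite (IH _ tpi _ tq) (partials_partialC s i sp).
by rewrite /= exprS mulN1r mulNr.
Qed.

(** One integration by parts on each side leads, for every [i], to the same symmetric product of
    [partial i phi] and [partial i psi]. *)
Lemma is_wlaplacian_test phi : test phi -> is_wlaplacian 1 (e_ phi) (e_ (laplacian phi)).
Proof.
move=> tp; apply/is_wlaplacianP => psi tq.
rewrite (dot_cls_laplacian _ tq) [RHS]dotC (dot_cls_laplacian _ tp).
apply: eq_bigr => i _.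
have E1 := dot_test_partial i tp (test_partial i tq).
have E2 := dot_test_partial i tq (test_partial i tp).
apply: oppr_inj; apply: (etrans (esym E1)); apply: (etrans _ E2); exact: dotC.
Qed.

Lemma is_wlaplacian_partials u (g : 'I_N -> H) : (forall i, is_wpartials [:: i; i] u (g i)) ->
  is_wlaplacian 1 u (\sum_i g i).
Proof.
move=> ug; apply/is_wlaplacianP => phi tp; rewrite dot_cls_laplacian//.
rewrite dot_suml; apply: eq_bigr => i _; have /is_wpartialsP/(_ phi tp) := ug i.
by rewrite /= => ->; rewrite expr2 mulN1r opprK mul1r.
Qed.

End weak_derivatives.

Lemma sum_lt_card (R : realFieldType) n (x : 'I_n -> R) (e : R) : 0 < e ->
  (forall i, x i < e / n.+1%:R) -> \sum_i x i < e.
Proof.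
move=> e0 xe; apply: (@le_lt_trans _ _ (\sum_(i < n) e / n.+1%:R)).
  by apply: ler_sum => i _; exact: ltW.
rewrite sumr_const card_ord -[_ *+ n]mulr_natr mulrAC ltr_pdivrMr ?ltr0n//.
by rewrite ltr_pM2l// ltr_nat.
Qed.

(** * Sobolev spaces, the Dirichlet form, and pairs of a field and a function *)

Section sobolev_spaces.
Context {R : realType} {N : nat} (Omega : domain R N).
Hypotheses (N_gt0 : (0 < N)%N) (bO : bounded_set (Omega : set 'rV[R]_N)).
Local Notation T := ('rV[R]_N).
Local Notation test := (test_function Omega).
Local Notation H := (L2 Omega).
Local Notation e_ := (@cls R N Omega).
Implicit Types (u v w f g h : H) (phi psi : T -> R) (i j : 'I_N) (s : seq 'I_N).

Lemma Hk_wpartials k u s : Hk k u -> (size s <= k)%N -> is_wpartials s u (wpartials s u).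
Proof. by move=> uk sk; apply: wpartialsP => //; exact: uk. Qed.

Lemma is_wpartials_nil u : is_wpartials [::] u u.
Proof. by apply/is_wpartialsP => // phi tp; rewrite mul1r. Qed.

Lemma wpartials_nil u : wpartials [::] u = u.
Proof. by apply: wpartialsE => //; exact: is_wpartials_nil. Qed.

Lemma Hk_subspace k : subspace (Hk k : set H).
Proof.
split=> [s _|a u v uk vk s sk]; first by exists 0; exact: is_wpartials0.
exists (a *: wpartials s u + wpartials s v).
by apply: is_wpartials_linear => //; exact: Hk_wpartials sk.
Qed.

Lemma wpartials_linear k s a u v : Hk k u -> Hk k v -> (size s <= k)%N ->
  wpartials s (a *: u + v) = a *: wpartials s u + wpartials s v.
Proof.
move=> uk vk sk; apply: wpartialsE => //.
by apply: is_wpartials_linear => //; exact: Hk_wpartials sk.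
Qed.

Lemma Hk_test k phi : test phi -> Hk k (e_ phi).
Proof. by move=> tp s _; exists (e_ (partials s phi)); exact: is_wpartials_test. Qed.

Lemma wpartials_test s phi : test phi -> wpartials s (e_ phi) = e_ (partials s phi).
Proof. by move=> tp; apply: wpartialsE => //; exact: is_wpartials_test. Qed.

(** The approximation clause of [Hk0] with one squared tolerance per derivative instead of the
    square root of a sum; [Hk0P] passes between the two. *)
Definition test_approx k u := forall e : R, 0 < e -> exists2 phi, test phi &
  forall s, (size s <= k)%N ->
    dot (wpartials s u - e_ (partials s phi)) (wpartials s u - e_ (partials s phi)) < e.

Lemma HdistE k u phi : test phi -> Hdist k u phi =
  Num.sqrt (\sum_(m < k.+1) \sum_(s : m.-tuple 'I_N)
    dot (wpartials s u - e_ (partials s phi)) (wpartials s u - e_ (partials s phi))).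
Proof.
move=> tp; congr Num.sqrt; apply: eq_bigr => m _; apply: eq_bigr => s _.
rewrite L2norm_dist_cls ?sqr_sqrtr ?dot_ge0//.
by apply: test_Lfun => //; exact: test_partials.
Qed.

Lemma Hk0P k u : Hk0 Omega k u <-> Hk k u /\ test_approx k u.
Proof.
split=> -[uk ua]; split=> // e e0.
  have [|phi tp] := ua (Num.sqrt e); first by rewrite sqrtr_gt0.
  rewrite HdistE// => lte; exists phi => // s sk.
  have {lte} : \sum_(m < k.+1) \sum_(s : m.-tuple 'I_N)
    dot (wpartials s u - e_ (partials s phi)) (wpartials s u - e_ (partials s phi)) < e.
    by rewrite -ltr_sqrt.
  apply: le_lt_trans; rewrite (bigD1 (Ordinal (sk : (size s < k.+1)%N)))//=.
  rewrite (bigD1 (in_tuple s))//= -addrA lerDl addr_ge0//.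
    by apply: sumr_ge0 => *; exact: dot_ge0.
  by apply: sumr_ge0 => *; apply: sumr_ge0 => *; exact: dot_ge0.
(* [K] counts the terms of the sum defining [Hdist], so that the tolerance can be shared equally. *)
pose K : R := \sum_(m < k.+1) \sum_(s : m.-tuple 'I_N) 1.
have K0 : 0 <= K by apply: sumr_ge0 => *; apply: sumr_ge0.
have K1 : 0 < K + 1 by rewrite ltr_wpDl.
have [|phi tp phiP] := ua (e ^+ 2 / (K + 1)); first by rewrite divr_gt0 ?exprn_gt0.
exists phi => //; rewrite HdistE// -[ltRHS]gtr0_norm// -sqrtr_sqr ltr_sqrt ?exprn_gt0//.
apply: (@le_lt_trans _ _ (e ^+ 2 / (K + 1) * K)).
  rewrite /K mulr_sumr; apply: ler_sum => m _; rewrite mulr_sumr; apply: ler_sum => s _.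
  by rewrite mulr1; apply/ltW/phiP; rewrite size_tuple -ltnS.
by rewrite mulrAC ltr_pdivrMr// ltr_pM2l ?exprn_gt0// ltrDl.
Qed.

Lemma Hk0_subspace k : subspace (Hk0 Omega k).
Proof.
split.
  apply/Hk0P; split; first exact: (Hk_subspace k).1.
  move=> e e0; exists (fun=> 0) => [|s _]; first exact: test0.
  have -> : e_ (partials s (fun=> 0)) = wpartials s (0 : H).
    by rewrite -wpartials_test ?cls0//; exact: test0.
  by rewrite subrr dot0l.
move=> a u v /Hk0P[uk ua] /Hk0P[vk va]; apply/Hk0P; split; first exact: (Hk_subspace k).2.
move=> e e0; have ka : 0 < 2 * a ^+ 2 + 1 by rewrite ltr_wpDl// mulr_ge0 ?sqr_ge0.
have [|phi tp phiP] := ua (e / (2 * (2 * a ^+ 2 + 1))).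
  by rewrite divr_gt0// mulr_gt0.
have [|psi tq psiP] := va (e / 4); first by rewrite divr_gt0.
exists (fun x => a * phi x + psi x); first exact: test_linear.
move=> s sk; rewrite (wpartials_linear _ uk vk sk) -wpartials_test; last exact: test_linear.
rewrite cls_test_linear// (wpartials_linear (k := k))//; [|exact: Hk_test|exact: Hk_test].
rewrite !wpartials_test//.
rewrite scale_addBl; apply: le_lt_trans (dot_sqr_linear_le _ _ _) _.
exact: linear_small (dot_ge0 _) (phiP s sk) (psiP s sk).
Qed.

Definition grad_form u v : R := \sum_i dot (wgrad u i) (wgrad v i).

Lemma grad_form_on : form_on (Hk 1) grad_form.
Proof.
split=> [u v _ _|a u v w u1 v1 w1|u _].
- by apply: eq_bigr => i _; exact: dotC.
- rewrite /grad_form mulr_sumr -big_split; apply: eq_bigr => i _ /=.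
  by rewrite /wgrad (wpartials_linear _ u1 v1)// dotPl.
- by apply: sumr_ge0 => i _; exact: dot_ge0.
Qed.

Lemma wgradB u v i : Hk 1 u -> Hk 1 v -> wgrad (u - v) i = wgrad u i - wgrad v i.
Proof.
move=> u1 v1; rewrite -scaleN1r addrC /wgrad (wpartials_linear _ v1 u1)//.
by rewrite scaleN1r addrC.
Qed.

Lemma dot_wgrad_le u i : dot (wgrad u i) (wgrad u i) <= grad_form u u.
Proof.
by rewrite /grad_form (bigD1 i)//= lerDl; apply: sumr_ge0 => *; exact: dot_ge0.
Qed.

(** Closedness relative to [Hk 1] for the H^1 norm, which is the convergence obtained once a
    Poincare inequality adds L^2 control to energy control. *)
Definition grad_closed (W : set H) := forall u, Hk 1 u ->
  (forall e : R, 0 < e -> exists w, [/\ W w, dot (u - w) (u - w) < e &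
     forall i, dot (wgrad u i - wgrad w i) (wgrad u i - wgrad w i) < e]) -> W u.

(** By the Poincare inequality, a sequence that is Cauchy in energy is Cauchy in L^2, and so are its
    gradients. Weak derivatives have a closed graph, hence the limit of the gradients is the
    gradient of the limit. *)
Lemma grad_complete (W : set H) (C : R) : subspace W -> W `<=` Hk 1 -> 0 <= C ->
  (forall u, W u -> dot u u <= C * grad_form u u) -> grad_closed W ->
  form_complete W grad_form.
Proof.
move=> sW W1 C0 WC cW u Wu ucau.
have WB m n : W (u m - u n) by exact: subspaceB.
have cau0 : form_cauchy (@dot R N Omega) u.
  move=> e e0; have C1 : 0 < C + 1 by rewrite ltr_wpDl.
  have [n0 n0P] := ucau (e / (C + 1)) ltac:(by rewrite divr_gt0).
  exists n0 => m n mn nn; have := n0P m n mn nn; rewrite ltr_pdivlMr//.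
  have := WC _ (WB m n); have := form_ge0 grad_form_on (W1 _ (WB m n)).
  by move: (grad_form _ _) (dot _ _) => p q; clear; nra.
have caui i : form_cauchy (@dot R N Omega) (fun n => wgrad (u n) i).
  move=> e /ucau[n0 n0P]; exists n0 => m n mn nn.
  rewrite -(wgradB i (W1 _ (Wu m)) (W1 _ (Wu n))).
  exact: le_lt_trans (dot_wgrad_le _ _) (n0P m n mn nn).
have [p _ up] := dot_complete (fun=> I) cau0.
have /choice[g gP] : forall i, exists gi, form_cvg (@dot R N Omega) (fun n => wgrad (u n) i) gi.
  by move=> i; have [gi _ ?] := dot_complete (fun=> I) (caui i); exists gi.
have uni e : 0 < e -> exists n0, forall n, (n0 <= n)%N -> dot (p - u n) (p - u n) < e /\
    forall i, dot (g i - wgrad (u n) i) (g i - wgrad (u n) i) < e.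
  move=> e0; have [n0 n0P] := up e e0.
  have /choice[m mP] : forall i, exists m, forall n, (m <= n)%N ->
      dot (wgrad (u n) i - g i) (wgrad (u n) i - g i) < e by move=> i; exact: gP.
  exists (maxn n0 (\max_i m i)) => n; rewrite geq_max => /andP[n0n mn]; split.
    by rewrite dot_distC; exact: n0P.
  by move=> i; rewrite dot_distC; apply: mP; apply: leq_trans mn; exact: leq_bigmax.
have pg i : is_wpartials [:: i] p (g i).
  apply: is_wpartials_closed => // e /uni[n0 /(_ _ (leqnn _))[h1 h2]].
  exists (u n0), (wgrad (u n0) i); split; [|exact: h1|exact: h2].
  exact: (@Hk_wpartials 1 (u n0) [:: i] (W1 _ (Wu n0)) isT).
have p1 : Hk 1 p.
  by move=> [|i []]//= _; [exists p; exact: is_wpartials_nil|exists (g i)].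
have gE i : wgrad p i = g i by exact: wpartialsE.
exists p.
  apply: (cW _ p1) => e /uni[n0 /(_ _ (leqnn _))[h1 h2]]; exists (u n0).
  split; [exact: Wu|exact: h1|move=> i; rewrite gE; exact: h2].
move=> e e0; have [n0 n0P] := uni (e / N.+1%:R) ltac:(by rewrite divr_gt0).
exists n0 => n /n0P[_ h]; apply: sum_lt_card => // i.
by rewrite (wgradB i (W1 _ (Wu n)) p1) gE dot_distC; exact: h.
Qed.

(** The variational existence theorem shared by the Dirichlet and Neumann problems; Cauchy-Schwarz
    and the Poincare inequality bound the functional [dot f] in the energy. *)
Lemma grad_riesz (W : set H) (C : R) : subspace W -> W `<=` Hk 1 -> 0 <= C ->
  (forall u, W u -> dot u u <= C * grad_form u u) -> grad_closed W ->
  forall f, exists2 p, W p & forall w, W w -> grad_form p w = dot f w.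
Proof.
move=> sW W1 C0 WC cW f.
apply: (riesz_on sW (form_onS W1 grad_form_on) (C := dot f f * C)).
- exact: grad_complete WC cW.
- by move=> a x y _ _; exact: dotPr.
- move=> x Wx; apply: le_trans (dot_cauchy_schwarz _ _) _.
  by rewrite -mulrA; apply: ler_wpM2l (WC x Wx); exact: dot_ge0.
Qed.

(* Pairs [(v, u)] of a vector field and a function, stored as [option 'I_N -> L2]. *)
Definition pair_form (X Y : option 'I_N -> H) : R :=
  dot (X None) (Y None) + \sum_i dot (X (Some i)) (Y (Some i)).

Lemma pair_form_on : form_on setT pair_form.
Proof.
split=> [X Y _ _|a X Y Z _ _ _|X _].
- by rewrite /pair_form dotC; congr (_ + _); apply: eq_bigr => i _; exact: dotC.
- rewrite /pair_form -[(a *: X + Y) None]/(a *: X None + Y None) dotPl.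
  rewrite (eq_bigr (fun i => a * dot (X (Some i)) (Z (Some i)) + dot (Y (Some i)) (Z (Some i)))).
    by rewrite big_split /= -mulr_sumr; ring.
  by move=> i _; exact: dotPl.
- by rewrite /pair_form addr_ge0 ?dot_ge0// sumr_ge0// => i _; exact: dot_ge0.
Qed.

Lemma dot_pair_form_le X o : dot (X o) (X o) <= pair_form X X.
Proof.
rewrite /pair_form; case: o => [i|].
  rewrite (bigD1 i)//= addrCA lerDl addr_ge0 ?dot_ge0// sumr_ge0// => *.
  exact: dot_ge0.
by rewrite lerDl sumr_ge0// => *; exact: dot_ge0.
Qed.

Lemma pair_form_complete : form_complete setT pair_form.
Proof.
move=> X _ Xcau.
have cau o : form_cauchy (@dot R N Omega) (fun n => X n o).
  move=> e /Xcau[n0 n0P]; exists n0 => m n mn nn.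
  exact: le_lt_trans (dot_pair_form_le (X m - X n) o) (n0P m n mn nn).
have /choice[Y YP] : forall o, exists Yo, form_cvg (@dot R N Omega) (fun n => X n o) Yo.
  by move=> o; have [Yo _ ?] := dot_complete (fun=> I) (cau o); exists Yo.
exists Y => // e e0; have e20 : 0 < e / 2 by rewrite divr_gt0.
have [n0 n0P] := YP None (e / 2) e20.
have /choice[m mP] : forall i, exists m, forall n, (m <= n)%N ->
    dot (X n (Some i) - Y (Some i)) (X n (Some i) - Y (Some i)) < e / 2 / N.+1%:R.
  by move=> i; apply: YP; rewrite divr_gt0.
exists (maxn n0 (\max_i m i)) => n; rewrite geq_max => /andP[n0n mn].
rewrite /pair_form (splitr e); apply: ltrD; first exact: n0P.
apply: sum_lt_card => // i; apply: mP; apply: leq_trans mn; exact: leq_bigmax.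
Qed.

End sobolev_spaces.

(** * The reduced Laplacians *)

Opaque dot cls partial laplacian.

Lemma ge0_le_sum (R : realFieldType) n (F : 'I_n -> R) i :
  (forall k, 0 <= F k) -> F i <= \sum_k F k.
Proof. by move=> F0; rewrite (bigD1 i)//= lerDl; apply: sumr_ge0. Qed.

Section reduced_laplacians.
Context {R : realType} {N : nat} (Omega : domain R N).
Hypotheses (N_gt0 : (0 < N)%N) (bO : bounded_set (Omega : set 'rV[R]_N)).
Local Notation T := ('rV[R]_N).
Local Notation test := (test_function Omega).
Local Notation H := (L2 Omega).
Local Notation e_ := (@cls R N Omega).
Implicit Types (u v w f g h : H) (phi psi : T -> R) (i j : 'I_N) (s : seq 'I_N).

(** The common interface of the four operators. It speaks of [wlaplacian]; since domains are
    subspaces, [iso_bij] restores the sign of [neg_laplacian]. Injectivity is contained in the last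
    clause, applied to differences. *)
Definition laplacian_iso (X : operator Omega) :=
  [/\ op_act X = @neg_laplacian R N Omega, subspace (op_dom X) /\ op_dom X `<=` @HLap R N Omega,
      forall u, op_dom X u -> op_cod X (wlaplacian u),
      forall f, op_cod X f -> exists2 u, op_dom X u & wlaplacian u = f &
      exists2 C : R, 0 <= C & forall u, op_dom X u ->
        dot u u <= C * dot (wlaplacian u) (wlaplacian u)].

Lemma HLap_subspace : subspace (@HLap R N Omega).
Proof.
split=> [|a u v uL vL]; first by exists 0; exact: is_wlaplacian0.
exists (a *: wlaplacian u + wlaplacian v).
by apply: is_wlaplacian_linear => //; exact: wlaplacianP.
Qed.

Lemma wlaplacian_linear a u v : HLap u -> HLap v ->
  wlaplacian (a *: u + v) = a *: wlaplacian u + wlaplacian v.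
Proof.
move=> uL vL; apply: wlaplacianE => //.
by apply: is_wlaplacian_linear => //; exact: wlaplacianP.
Qed.

Lemma wlaplacianB u v : HLap u -> HLap v ->
  wlaplacian (u - v) = wlaplacian u - wlaplacian v.
Proof.
move=> uL vL; rewrite -scaleN1r addrC (wlaplacian_linear _ vL uL).
by rewrite scaleN1r addrC.
Qed.

(** Cauchy-Schwarz gives |u|^2 <= C |w| |u|, and one factor |u| cancels. This converts coercivity
    tested with the solution itself into a bound on the inverse. *)
Lemma dot_bound (C : R) u w : 0 <= C -> dot u u <= C * dot w u ->
  dot u u <= C ^+ 2 * dot w w.
Proof.
move=> C0 uw; apply: sqr_le_mul; first exact: dot_ge0.
  by rewrite mulr_ge0 ?sqr_ge0 ?dot_ge0.
have := dot_cauchy_schwarz w u; move: uw (dot_ge0 u) (dot_ge0 w).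
move: (dot u u) (dot w u) (dot w w) => p q r; clear -C0 => pq p0 r0 qq.
have Cq : 0 <= C * q by lra.
apply: (@le_trans _ _ ((C * q) ^+ 2)).
  by rewrite ler_sqr ?nnegrE.
by rewrite exprMn -mulrA ler_wpM2l ?sqr_ge0.
Qed.

(** With |x_i| <= M on the domain, [friedrichs_identity] gives |phi|^2 <= 2 M |phi| |d_i phi|,
    whence the constant 4 M^2, valid for every single direction. *)
Lemma friedrichs : exists2 C : R, 0 <= C & forall i phi, test phi ->
  dot (e_ phi) (e_ phi) <= C * dot (e_ (partial i phi)) (e_ (partial i phi)).
Proof.
have [M M0 OM] := domain_cube bO.
exists (4 * M ^+ 2) => [|i phi tp]; first by rewrite mulr_ge0 ?sqr_ge0.
have pL := test_Lfun bO tp; have tpi := test_partial i tp.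
have xL : (fun x : T => x 0 i * phi x) \in Lfun (lebesgue_on Omega) 2%:E.
  apply: (@Lfun2_cube _ _ _ _ M); last exact: lebesgue_on_cube.
    by apply: continuous_mulf; [exact: continuous_coord|exact: test_continuous tp].
  by move=> x xM; rewrite (test_eq0 tp) ?mulr0// => /OM.
have xM : dot (e_ (fun x : T => x 0 i * phi x)) (e_ (fun x : T => x 0 i * phi x)) <=
    M ^+ 2 * dot (e_ phi) (e_ phi).
  rewrite !dot_cls2// /pairing -RintegralZl//; last exact: Lfun2_integrableM.
  apply: le_Rintegral => //.
  - exact: Lfun2_integrableM.
  - rewrite (_ : _ \o _ = fun x => ((M ^+ 2)%:E * (phi x * phi x)%:E)%E)//.
    by apply: integrableZl => //; exact: Lfun2_integrableM.
  - move=> x _; rewrite mulrACA -!expr2.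
    have [px0|px0] := eqVneq (phi x) 0; first by rewrite px0 expr0n !mulr0.
    rewrite ler_wpM2r ?sqr_ge0//.
    have xO : cube N M x.
      by apply: OM; apply: contrapT => /(test_eq0 tp) /eqP; rewrite (negbTE px0).
    rewrite -[x 0 i ^+ 2]ger0_norm ?sqr_ge0// normrX ler_sqr ?nnegrE ?(ltW M0)//.
have E : dot (e_ phi) (e_ phi) =
    - (2 * dot (e_ (fun x : T => x 0 i * phi x)) (e_ (partial i phi))).
  by rewrite !dot_cls2//; [exact: friedrichs_identity|exact: test_Lfun].
apply: sqr_le_mul; first exact: dot_ge0.
  by rewrite mulr_ge0 ?dot_ge0// mulr_ge0 ?sqr_ge0.
have key (p x q s m : R) : 0 <= q -> p = - (2 * x) -> s <= m ^+ 2 * p ->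
    x ^+ 2 <= s * q -> p ^+ 2 <= 4 * m ^+ 2 * q * p.
  move=> q0 E' sp xs; have : s * q <= m ^+ 2 * p * q by rewrite ler_wpM2r.
  have -> : p ^+ 2 = 4 * x ^+ 2 by rewrite E'; ring.
  by clear -xs; lra.
exact: key (dot_ge0 _) E xM (dot_cauchy_schwarz _ _).
Qed.

Lemma dot_cls_laplacian_grad u phi : Hk 1 u -> test phi ->
  dot u (e_ (laplacian phi)) = - \sum_i dot (wgrad u i) (e_ (partial i phi)).
Proof.
move=> u1 tp; rewrite (dot_cls_laplacian bO _ tp) -sumrN; apply: eq_bigr => i _.
have tpi := test_partial i tp.
have /(is_wpartialsP bO)/(_ _ tpi) := @Hk_wpartials R N Omega N_gt0 bO 1 u [:: i] u1 isT.
by rewrite /= expr1 mulN1r.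
Qed.

(** Derivatives of order 0, 1 and 2 are bounded with constants C^2, C and 1, whose sum is the
    constant used. The squared gradient norm g equals - <phi, Delta phi>, so that g^2 <= C g |Delta
    phi|^2 by Friedrichs. *)
Lemma laplacian_estimate : exists2 K : R, 0 <= K & forall phi s, test phi ->
  (size s <= 2)%N -> dot (e_ (partials s phi)) (e_ (partials s phi)) <=
    K * dot (e_ (laplacian phi)) (e_ (laplacian phi)).
Proof.
have [C C0 FC] := friedrichs.
exists (C ^+ 2 + C + 1); first by have := sqr_ge0 C; lra.
move=> phi s tp; have [sp _ _] := tp.
have L0 := dot_ge0 (e_ (laplacian phi)).
pose g := \sum_i dot (e_ (partial i phi)) (e_ (partial i phi)).
have gE : g = - dot (e_ phi) (e_ (laplacian phi)).
  rewrite (dot_cls_laplacian bO _ tp) -sumrN; apply: eq_bigr => i _.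
  exact: (dot_test_partial bO i tp (test_partial i tp)).
have gi i : dot (e_ (partial i phi)) (e_ (partial i phi)) <= g.
  by apply: (ge0_le_sum i) => k; exact: dot_ge0.
have g0 : 0 <= g by apply: sumr_ge0 => *; exact: dot_ge0.
have pg : dot (e_ phi) (e_ phi) <= C * g.
  exact: le_trans (FC (Ordinal N_gt0) _ tp) (ler_wpM2l C0 (gi _)).
have gL : g <= C * dot (e_ (laplacian phi)) (e_ (laplacian phi)).
  apply: sqr_le_mul => //; first exact: mulr_ge0.
  rewrite [in leLHS]gE sqrrN; apply: le_trans (dot_cauchy_schwarz _ _) _.
  by rewrite mulrAC; apply: ler_wpM2r.
(* Both derivatives change sides by two integrations by parts, with Schwarz's theorem in between to
   bring d_j to the front. *)
have hess i j : dot (e_ (partial i (partial j phi))) (e_ (partial i (partial j phi))) =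
    dot (e_ (partial j (partial j phi))) (e_ (partial i (partial i phi))).
  have tj := test_partial j tp; have tii := test_partial i (test_partial i tp).
  have E1 := dot_test_partial bO i tj (test_partial i tj).
  have E2 := dot_test_partial bO j tj tii.
  have E3 : partial i (partial i (partial j phi)) = partial j (partial i (partial i phi)).
    by rewrite (partialC i j sp) (partialC i j (smooth_partials [:: i] sp)).
  by apply: (etrans E1); rewrite E3; exact: (esym E2).
have hL i j : dot (e_ (partial i (partial j phi))) (e_ (partial i (partial j phi))) <=
    dot (e_ (laplacian phi)) (e_ (laplacian phi)).
  (* By [hess], the sum of all these squares is |Delta phi|^2, so each of them is at most that. *)
  pose F k l := dot (e_ (partial k (partial l phi))) (e_ (partial k (partial l phi))).
  have F0 k l : 0 <= F k l by exact: dot_ge0.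
  apply: (@le_trans _ _ (\sum_k F k j)); first exact: (ge0_le_sum i (fun k => F0 k j)).
  rewrite (dot_cls_laplacian bO _ tp); apply: ler_sum => k _.
  rewrite dotC (dot_cls_laplacian bO _ tp) (eq_bigr (F k)).
    exact: (ge0_le_sum j (F0 k)).
  by move=> l _; exact: (etrans (dotC _ _) (esym (hess k l))).
have fin (x : R) : x <= C * g \/ x <= g \/
    x <= dot (e_ (laplacian phi)) (e_ (laplacian phi)) ->
    x <= (C ^+ 2 + C + 1) * dot (e_ (laplacian phi)) (e_ (laplacian phi)).
  move: gL g0 L0; clear -C0; move: (dot _ _) => L gL g0 L0.
  have CgL : C * g <= C * (C * L) by rewrite ler_wpM2l.
  have CL : 0 <= C * L by rewrite mulr_ge0.
  have CCL : 0 <= C * (C * L) by rewrite mulr_ge0.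
  have -> : (C ^+ 2 + C + 1) * L = C * (C * L) + C * L + L by ring.
  by move=> [|[]] ?; lra.
case: s => [|i [|j [|]]]//= _; apply: fin.
- by left.
- by right; left.
- by right; right.
Qed.

(** The factor comes from repeating |x + y|^2 <= 2 |x|^2 + 2 |y|^2; it only serves to choose
    tolerances. *)
Lemma dot_sqr_sum_le (I : Type) (r : seq I) (F : I -> H) :
  dot (\sum_(k <- r) F k) (\sum_(k <- r) F k) <=
  2 ^+ size r * \sum_(k <- r) dot (F k) (F k).
Proof.
elim: r => [|k r IH]; first by rewrite !big_nil dot0l mulr0.
rewrite !big_cons; apply: le_trans (dot_sqrD_le _ _) _.
have key (p q t z : R) : q <= z * t -> 0 <= p -> 1 <= z -> 2 * p + 2 * q <= 2 * z * (p + t).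
  move=> qt p0 z1; have : 1 * p <= z * p by rewrite ler_wpM2r.
  by clear -qt; lra.
by rewrite /= exprS; apply: key IH (dot_ge0 _) _; rewrite exprn_ege1// ler1n.
Qed.

End reduced_laplacians.

(** * The Laplacian with both boundary conditions *)

Section minimal_laplacian.
Context {R : realType} {N : nat} (Omega : domain R N).
Hypotheses (N_gt0 : (0 < N)%N) (bO : bounded_set (Omega : set 'rV[R]_N)).
Local Notation T := ('rV[R]_N).
Local Notation test := (test_function Omega).
Local Notation H := (L2 Omega).
Local Notation e_ := (@cls R N Omega).
Implicit Types (u v w f g h : H) (phi psi : T -> R) (i j : 'I_N) (s : seq 'I_N).

Lemma Hk0_laplacian u : Hk0 Omega 2 u ->
  HLap u /\ forall e : R, 0 < e -> exists phi, [/\ test phi,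
    dot (u - e_ phi) (u - e_ phi) < e &
    dot (wlaplacian u - e_ (laplacian phi)) (wlaplacian u - e_ (laplacian phi)) < e].
Proof.
move=> /(Hk0P bO)[u2 ua].
have uL : is_wlaplacian 1 u (\sum_i wpartials [:: i; i] u).
  apply: (is_wlaplacian_partials bO) => i.
  exact: (@Hk_wpartials R N Omega N_gt0 bO 2 u [:: i; i] u2 isT).
split; first by exists (\sum_i wpartials [:: i; i] u).
move=> e e0; rewrite (wlaplacianE N_gt0 bO uL).
pose K : R := 2 ^+ size (index_enum 'I_N).
have K0 : 0 < K by rewrite exprn_gt0.
have [|phi tp pP] := ua (Num.min e (e / K / N.+1%:R)).
  by rewrite lt_min e0 divr_gt0 ?divr_gt0.
have [p1 p2] : (forall s, (size s <= 2)%N ->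
    dot (wpartials s u - e_ (partials s phi)) (wpartials s u - e_ (partials s phi)) < e) /\
    (forall s, (size s <= 2)%N ->
    dot (wpartials s u - e_ (partials s phi)) (wpartials s u - e_ (partials s phi))
      < e / K / N.+1%:R).
  by split=> s /pP; rewrite lt_min => /andP[].
exists phi; split => //.
  by have := p1 [::] isT; rewrite (wpartials_nil N_gt0 bO).
rewrite cls_test_sum//; last by move=> k; do 2 apply: test_partial.
rewrite -sumrB; apply: le_lt_trans (dot_sqr_sum_le _ _) _.
rewrite -/K mulrC -ltr_pdivlMr//; apply: sum_lt_card; first by rewrite divr_gt0.
by move=> i; exact: (p2 [:: i; i] isT).
Qed.

Lemma harmonicP h : Defs.harmonic h <-> forall phi, test phi -> dot h (e_ (laplacian phi)) = 0.
Proof.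
split=> [/(is_wlaplacianP bO) h0 phi tp|h0]; first by rewrite h0// L2zero0 dot0l.
by apply/(is_wlaplacianP bO) => phi tp; rewrite h0// L2zero0 dot0l.
Qed.

Lemma Lap0_iso : laplacian_iso (Lap0 Omega).
Proof.
have [K K0 KP] := laplacian_estimate N_gt0 bO.
split; first by [].
- split; first exact: Hk0_subspace.
  by move=> u /Hk0_laplacian[].
(* For a test function, orthogonality of its Laplacian to [h] is the definition of harmonicity. The
   closure lemma with coefficient 0 passes to [u]; the second function is then a mere
   placeholder. *)
- move=> u /= /Hk0_laplacian[_ ua] h hh; rewrite -dotE.
  rewrite -(mul0r (dot (0 : H) h)); apply: dot_relation_closed => e /ua[phi [tp _ lp]].
  exists (e_ (laplacian phi)), 0; split; [|exact: lp|].
    by rewrite mul0r dotC; exact: (harmonicP h).1.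
  by rewrite subrr dot0l; exact: le_lt_trans (dot_ge0 _) lp.
- move=> f /= fh.
  pose S := [set x | exists2 phi, test phi & x = e_ (laplacian phi)].
  have lapL a phi psi : test phi -> test psi ->
      e_ (laplacian (fun x => a * phi x + psi x)) =
      a *: e_ (laplacian phi) + e_ (laplacian psi).
    move=> tp tq; have tL := test_linear a tp tq.
    apply: (test_separates N_gt0 bO) => chi tc.
    have [/(is_wlaplacianP bO) E1 /(is_wlaplacianP bO) E2] :=
      (is_wlaplacian_test bO tp, is_wlaplacian_test bO tq).
    have /(is_wlaplacianP bO) E3 := is_wlaplacian_test bO tL.
    by rewrite -E3// cls_test_linear// !dotPl E1// E2.
  have sS : subspace S.
    split.
      exists (fun=> 0); first exact: test0.
      have := lapL (-1) _ _ (test0 Omega) (test0 Omega).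
      rewrite scaleN1r addNr => <-; congr (e_ (laplacian _)).
      by apply/funext => x; rewrite mulr0 addr0.
    move=> a _ _ [phi tp ->] [psi tq ->].
    by exists (fun x => a * phi x + psi x); [exact: test_linear|exact: (esym (lapL a phi psi tp tq))].
  (* The functions orthogonal to all Laplacians of test functions are exactly the harmonic ones, so
     the bipolar theorem applies to [f]. *)
  have fS : form_closure (@dot R N Omega) S f.
    apply: (form_bipolar (dot_form Omega) (@dot_complete R N Omega) sS) => y yS.
    rewrite dotE; apply: fh; apply/harmonicP => phi tp.
    by rewrite dotC; apply: yS; exists phi.
  have /choice[p pP] : forall n : nat, exists phi, test phi /\
      dot (f - e_ (laplacian phi)) (f - e_ (laplacian phi)) < n.+1%:R^-1.
    move=> n; have [|_ [phi tp ->] lp] := fS n.+1%:R^-1; first by rewrite invr_gt0.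
    by exists phi.
  have tp n : test (p n) by case: (pP n).
  have small (c : R) : 0 < c -> exists n0, forall n, (n0 <= n)%N -> n.+1%:R^-1 < c.
    by move=> c0; have [n0 _ H] := near_infty_natSinv_lt (PosNum c0); exists n0 => n /H.
  have dist s m n : (size s <= 2)%N ->
      dot (e_ (partials s (p m)) - e_ (partials s (p n)))
          (e_ (partials s (p m)) - e_ (partials s (p n))) <=
      K * (2 * m.+1%:R^-1 + 2 * n.+1%:R^-1).
    move=> s2.
    have tmn : test (fun x => -1 * p n x + p m x) by exact: test_linear.
    have [smp _ _] := tp m; have [snp _ _] := tp n.
    have -> : e_ (partials s (p m)) - e_ (partials s (p n)) =
        e_ (partials s (fun x => -1 * p n x + p m x)).
      rewrite (partials_linear s (-1) snp smp).
      rewrite (cls_test_linear bO (-1) (test_partials s (tp n)) (test_partials s (tp m))).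
      by rewrite scaleN1r addrC.
    apply: le_trans (KP _ _ tmn s2) _; apply: ler_wpM2l => //.
    rewrite lapL// scaleN1r addrC -(subrKA f).
    rewrite -[e_ (laplacian (p m)) - f]opprB.
    apply: le_trans (dot_sqrD_le _ _) _; rewrite dot_sqrN.
    by apply: lerD; apply: ler_wpM2l => //; apply: ltW; case: (pP m); case: (pP n).
  have Kpos : 0 < K + 1 by rewrite ltr_wpDl.
  have distS (c : R) : 0 < c -> exists n0, forall m n, (n0 <= m)%N -> (n0 <= n)%N ->
      K * (2 * m.+1%:R^-1 + 2 * n.+1%:R^-1) < c.
    move=> c0; have [|n0 n0P] := small (c / (K + 1) / 4); first by rewrite !divr_gt0.
    have key (x y d : R) : 0 < d -> x < d -> y < d -> K * (2 * x + 2 * y) < 4 * d * (K + 1).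
      move=> d0 xd yd; apply: (@le_lt_trans _ _ (K * (4 * d))).
        by apply: ler_wpM2l => //; clear -xd yd; lra.
      by clear -d0; lra.
    have -> : c = 4 * (c / (K + 1) / 4) * (K + 1).
      by field; rewrite gt_eqF.
    exists n0 => m n /n0P mm /n0P nn; apply: key mm nn.
    by rewrite !divr_gt0.
  have cau s : (size s <= 2)%N -> form_cauchy (@dot R N Omega) (fun n => e_ (partials s (p n))).
    move=> s2 e /distS[n0 n0P]; exists n0 => m n mn nn.
    exact: le_lt_trans (dist s m n s2) (n0P m n mn nn).
  have /choice[g gP] : forall s, exists gs, (size s <= 2)%N ->
      form_cvg (@dot R N Omega) (fun n => e_ (partials s (p n))) gs.
    move=> s; have [s2|s2] := leqP (size s) 2; last by exists 0.
    by have [gs _ ?] := dot_complete (fun=> I) (cau s s2); exists gs.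
  (* Passing to the limit in the Cauchy estimate, whose right-hand side does not involve the
     derivative, gives one index that is valid for all [s] at once. *)
  have unif (e : R) : 0 < e -> exists n0, forall n, (n0 <= n)%N -> forall s, (size s <= 2)%N ->
      dot (g s - e_ (partials s (p n))) (g s - e_ (partials s (p n))) < e.
    move=> e0; have [|n0 n0P] := distS (e / 4); first by rewrite divr_gt0.
    exists n0 => n nn s s2.
    have [|m mP] := gP s s2 (e / 4); first by rewrite divr_gt0.
    have h1 := mP (maxn m n0) (leq_maxl _ _).
    have h2 := le_lt_trans (dist s (maxn m n0) n s2) (n0P _ n (leq_maxr _ _) nn).
    rewrite dot_distC in h1.
    rewrite -(subrKA (e_ (partials s (p (maxn m n0))))).
    apply: le_lt_trans (dot_sqrD_le _ _) _.
    by move: h1 h2; move: (dot _ _) (dot _ _) => x y; clear; lra.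
  exists (g [::]).
    apply/(Hk0P bO).
    have gs s : (size s <= 2)%N -> is_wpartials s (g [::]) (g s).
      move=> s2; apply: (is_wpartials_closed bO) => e /unif[n0 /(_ _ (leqnn _)) H].
      exists (e_ (p n0)), (e_ (partials s (p n0))); split; [|exact: (H [::])|exact: H].
      exact: is_wpartials_test.
    split; first by move=> s s2; exists (g s); exact: gs.
    move=> e /unif[n0 /(_ _ (leqnn _)) H]; exists (p n0); first exact: tp.
    by move=> s s2; rewrite (wpartialsE N_gt0 bO (gs s s2)); exact: H.
  apply: (wlaplacianE N_gt0 bO); apply: (is_wlaplacian_closed bO) => e e0.
  have [n0 n0P] := unif e e0; have [n1 n1P] := small e e0.
  pose n := maxn n0 n1.
  exists (e_ (p n)), (e_ (laplacian (p n))); split.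
  + exact: is_wlaplacian_test.
  + exact: (n0P n (leq_maxl _ _) [::]).
  + by apply: lt_trans (n1P n (leq_maxr _ _)); case: (pP n).
(* One factor 2 comes from replacing [u] by a test function, the other from replacing the Laplacian
   of that test function by that of [u]. *)
exists (4 * K) => [|u /Hk0_laplacian[_ ua]]; first by rewrite mulr_ge0.
apply: (@le_of_small _ _ _ (2 + 4 * K)); first by rewrite addr_ge0// mulr_ge0.
move=> e /ua[phi [tp up lp]].
have h1 := dot_sqr_le_dist u (e_ phi); have h2 := KP phi [::] tp isT.
have h3 := dot_sqr_le_dist (e_ (laplacian phi)) (wlaplacian u).
rewrite dot_distC in h3.
have key (p q r t x y : R) : p <= 2 * q + 2 * r -> r <= K * t -> t <= 2 * x + 2 * y ->
    q < e -> x < e -> p <= 4 * K * y + (2 + 4 * K) * e.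
  move=> pq rt tx qe xe.
  have : K * t <= K * (2 * e + 2 * y) by apply: ler_wpM2l => //; clear -tx xe; lra.
  by clear -pq rt qe; lra.
exact: key h1 h2 h3 up lp.
Qed.

End minimal_laplacian.

(** * The Dirichlet Laplacian, and the Laplacian orthogonal to harmonic functions *)

Section dirichlet_laplacian.
Context {R : realType} {N : nat} (Omega : domain R N).
Hypotheses (N_gt0 : (0 < N)%N) (bO : bounded_set (Omega : set 'rV[R]_N)).
Local Notation T := ('rV[R]_N).
Local Notation test := (test_function Omega).
Local Notation H := (L2 Omega).
Local Notation e_ := (@cls R N Omega).
Implicit Types (u v w f g h : H) (phi psi : T -> R) (i j : 'I_N) (s : seq 'I_N).

Lemma Hk0_test k phi : test phi -> Hk0 Omega k (e_ phi).
Proof.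
move=> tp; apply/(Hk0P bO); split; first exact: Hk_test.
move=> e e0; exists phi; first exact: tp.
by move=> s _; rewrite (wpartials_test N_gt0 bO s tp) subrr dot0l.
Qed.

Lemma Hk0_sub_Hk k : Hk0 Omega k `<=` Hk k.
Proof. by move=> u []. Qed.

(** Friedrichs in a single direction, carried to the closure. Approximating both the function and
    its derivative costs a factor 2 each, hence 4 C. *)
Lemma Hk0_poincare : exists2 C : R, 0 <= C & forall u, Hk0 Omega 1 u ->
  dot u u <= C * grad_form u u.
Proof.
have [C C0 FC] := friedrichs bO.
exists (4 * C) => [|u]; first by rewrite mulr_ge0.
move=> /(Hk0P bO)[u1 ua]; pose i := Ordinal N_gt0.
apply: (@le_of_small _ _ _ (2 + 4 * C)); first by rewrite addr_ge0// mulr_ge0.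
move=> e /ua[phi tp pP].
have h1 := dot_sqr_le_dist u (e_ phi); have h2 := FC i _ tp.
have h3 := dot_sqr_le_dist (e_ (partial i phi)) (wgrad u i).
rewrite dot_distC in h3; have h4 := dot_wgrad_le u i.
have h5 := pP [::] isT; rewrite (wpartials_nil N_gt0 bO) in h5.
have h6 := pP [:: i] isT.
have key (p q r t x y z : R) : p <= 2 * q + 2 * r -> r <= C * t -> t <= 2 * x + 2 * y ->
    y <= z -> q < e -> x < e -> p <= 4 * C * z + (2 + 4 * C) * e.
  move=> pq rt tx yz qe xe.
  have : C * t <= C * (2 * e + 2 * z) by apply: ler_wpM2l => //; clear -tx xe yz; lra.
  by clear -pq rt qe; lra.
exact: key h1 h2 h3 h4 h5 h6.
Qed.

Lemma Hk0_grad_closed : grad_closed (Hk0 Omega 1).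
Proof.
move=> u u1 uW; apply/(Hk0P bO); split; first exact: u1.
move=> e e0; have e40 : 0 < e / 4 by rewrite divr_gt0.
have [w [w0 uw gw]] := uW _ e40.
have /(Hk0P bO)[w1 wa] := w0; have [phi tp pP] := wa _ e40.
exists phi; first exact: tp.
have key (A B C : H) : dot (A - B) (A - B) < e / 4 -> dot (B - C) (B - C) < e / 4 ->
    dot (A - C) (A - C) < e.
  move=> h1 h2; rewrite -(subrKA B); apply: le_lt_trans (dot_sqrD_le _ _) _.
  by move: h1 h2; move: (dot _ _) (dot _ _) => x y; clear; lra.
case=> [_|i [|//] _].
  apply: key (pP [::] isT); rewrite !(wpartials_nil N_gt0 bO); exact: uw.
apply: key (pP [:: i] isT); exact: gw.
Qed.

(* The pairs [(grad phi, phi)] are dense in the pairs [(grad w, w)], [w : H^1_0]. *)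
Lemma Hk0_weak_laplacian u f w : Hk 1 u -> is_wlaplacian 1 u f -> Hk0 Omega 1 w ->
  grad_form u w = - dot f w.
Proof.
move=> u1 /(is_wlaplacianP bO) uf /(Hk0P bO)[w1 wa].
pose S : set (option 'I_N -> H) := [set X | exists2 phi, test phi &
  X = fun o => if o is Some i then e_ (partial i phi) else e_ phi].
pose X o := if o is Some i then wgrad w i else w.
pose Y o := if o is Some i then wgrad u i else f.
have XS : form_closure (@pair_form R N Omega) S X.
  move=> e e0; have [|phi tp pP] := wa (e / 2 / N.+1%:R); first by rewrite !divr_gt0.
  exists (fun o => if o is Some i then e_ (partial i phi) else e_ phi); first by exists phi.
  rewrite /pair_form (splitr e); apply: ltrD.
    have := pP [::] isT; rewrite (wpartials_nil N_gt0 bO) => /lt_le_trans; apply.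
    by rewrite ler_pdivrMr// ler_peMr ?ler1n// ltW// divr_gt0.
  by apply: sum_lt_card; [rewrite divr_gt0|move=> i; exact: (pP [:: i] isT)].
have YS (Z : option 'I_N -> H) : S Z -> pair_form Z Y = 0.
  move=> [phi tp ->]; rewrite /pair_form /Y.
  have := dot_cls_laplacian_grad N_gt0 bO u1 tp; rewrite uf// => E.
  rewrite (dotC (e_ phi) f) E [X in _ + X](eq_bigr (fun i => dot (wgrad u i) (e_ (partial i phi)))).
    by rewrite addNr.
  by move=> i _; exact: dotC.
have := form_closure_orth (pair_form_on Omega) YS XS.
rewrite /pair_form /X /Y => /eqP; rewrite addr_eq0 => /eqP E.
rewrite (dotC f w) E opprK; apply: eq_bigr => i _; exact: dotC.
Qed.

Lemma LapD_iso : laplacian_iso (LapD Omega).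
Proof.
have [C C0 HC] := Hk0_poincare.
have sW := Hk0_subspace N_gt0 bO 1; have W1 := @Hk0_sub_Hk 1.
have sL := HLap_subspace N_gt0 bO.
split; first by [].
- split; last by move=> u [].
  split; first by split; [exact: sW.1|exact: sL.1].
  by move=> a u v [u0 uL] [v0 vL]; split; [exact: sW.2|exact: sL.2].
- by [].
- move=> f _.
  (* The sign is that of Green's formula: the energy of [p] against [w] must be - <f, w>. *)
  have [p p0 pP] := grad_riesz N_gt0 bO sW W1 C0 HC Hk0_grad_closed (- f).
  have pf : is_wlaplacian 1 p f.
    apply/(is_wlaplacianP bO) => phi tp.
    rewrite (dot_cls_laplacian_grad N_gt0 bO (W1 _ p0) tp).
    have := pP _ (Hk0_test 1 tp); rewrite dotNl => /(congr1 -%R); rewrite opprK => <-.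
    congr (- _); apply: eq_bigr => i _; congr dot.
    by rewrite /wgrad (wpartials_test N_gt0 bO [:: i] tp).
  by exists p; [split; [exact: p0|exists f]|exact: (wlaplacianE N_gt0 bO)].
exists (C ^+ 2) => [|u [u0 uL]]; first exact: sqr_ge0.
rewrite -(dot_sqrN (wlaplacian u)); apply: (dot_bound C0).
rewrite dotNl -(Hk0_weak_laplacian (W1 _ u0) (wlaplacianP N_gt0 bO uL) u0).
exact: HC.
Qed.

Lemma harmonic_subspace : subspace (@Defs.harmonic R N Omega).
Proof.
split; first exact: is_wlaplacian0.
move=> a u v /(harmonicP bO) hu /(harmonicP bO) hv; apply/(harmonicP bO) => phi tp.
by rewrite dotPl hu// hv// mulr0 addr0.
Qed.

Lemma harmonic_complete : form_complete (@Defs.harmonic R N Omega) (@dot R N Omega).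
Proof.
move=> u uh ucau; have [p _ up] := dot_complete (fun=> I) ucau; exists p; last exact: up.
apply: (is_wlaplacian_closed bO) => e e0; have [n nP] := up e e0.
exists (u n), 0; split; first exact: uh.
  by rewrite dot_distC; exact: nP.
by rewrite L2zero0 subrr dot0l.
Qed.

Lemma harmonic_HLap h : Defs.harmonic h -> HLap h.
Proof. by move=> hh; exists (L2zero Omega). Qed.

Lemma wlaplacian_harmonic h : Defs.harmonic h -> wlaplacian h = 0.
Proof. by move=> hh; apply: (wlaplacianE N_gt0 bO). Qed.

Lemma orthP (A : set H) u : orth A u <-> forall v, A v -> dot u v = 0.
Proof. by split=> uA v Av; have := uA v Av; rewrite dotE. Qed.

Lemma orth_subspace (A : set H) : subspace (orth A).
Proof.
split; first by apply/orthP => v _; rewrite dot0l.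
by move=> a u v /orthP uA /orthP vA; apply/orthP => w Aw; rewrite dotPl uA// vA// mulr0 addr0.
Qed.

Lemma Lap_iso : laplacian_iso (Lap Omega).
Proof.
have sL := HLap_subspace N_gt0 bO; have sO := @orth_subspace (@Defs.harmonic R N Omega).
have [_ _ _ Dsurj [C C0 CP]] := LapD_iso.
split; first by [].
- split; last by move=> u [].
  split; first by split; [exact: sL.1|exact: sO.1].
  by move=> a u v [uL uO] [vL vO]; split; [exact: sL.2|exact: sO.2].
- by [].
- move=> f _; have [u [_ uL] uf] := Dsurj f I.
  have [p ph pP] := form_projection (dot_form Omega) harmonic_subspace harmonic_complete u.
  have pL := harmonic_HLap ph.
  exists (u - p); first by split; [exact: subspaceB|apply/orthP].
  by rewrite (wlaplacianB N_gt0 bO uL pL) uf wlaplacian_harmonic// subr0.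
exists C => [//|v [vL /orthP vO]].
have [u uD uf] := Dsurj (wlaplacian v) I; have [_ uL] := uD.
(* The Dirichlet solution [u] with the same Laplacian differs from [v] by a harmonic function. As
   [v] is orthogonal to those, <v, u> = |v|^2, hence |v| <= |u| and the Dirichlet bound carries
   over. *)
have h0 : Defs.harmonic (u - v).
  have := wlaplacianP N_gt0 bO (subspaceB sL uL vL).
  by rewrite (wlaplacianB N_gt0 bO uL vL) uf subrr.
have uv : dot v u = dot v v.
  by apply/eqP; rewrite -subr_eq0 -dotBr vO.
rewrite -uf; apply: le_trans (CP u uD).
apply: sqr_le_mul; [exact: dot_ge0|exact: dot_ge0|].
by rewrite -{1}uv mulrC; exact: dot_cauchy_schwarz.
Qed.

End dirichlet_laplacian.

(** * The Neumann Laplacian *)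

Section neumann_laplacian.
Context {R : realType} {N : nat} (Omega : domain R N).
Hypotheses (N_gt0 : (0 < N)%N) (bO : bounded_set (Omega : set 'rV[R]_N)).
Local Notation T := ('rV[R]_N).
Local Notation test := (test_function Omega).
Local Notation H := (L2 Omega).
Local Notation mu := (lebesgue_on Omega).
Local Notation e_ := (@cls R N Omega).
Local Notation pf := (@pair_form R N Omega).
Implicit Types (u w f g h : H) (v : 'I_N -> H) (phi psi : T -> R) (i j : 'I_N).
Implicit Types (Phi Psi : 'I_N -> T -> R).

Lemma is_wdivP v f : is_wdiv v f <->
  forall phi, test phi -> \sum_i dot (v i) (e_ (partial i phi)) = - dot f (e_ phi).
Proof.
have E phi : test phi -> \sum_i pairing Omega (v i) (partial i phi) =
    \sum_i dot (v i) (e_ (partial i phi)).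
  move=> tp; apply: eq_bigr => i _; apply: (pairing_dot bO); exact: test_partial.
split=> vf phi tp; have := vf phi tp; rewrite (pairing_dot bO _ tp).
  by rewrite E.
by rewrite (E _ tp).
Qed.

Lemma wdivE v f : is_wdiv v f -> wdiv v = f.
Proof.
move=> vf; have ex : exists f, is_wdiv v f by exists f.
have /is_wdivP h := @xgetPex _ (L2zero Omega) [set f | is_wdiv v f] ex.
have /is_wdivP h' := vf.
apply: (test_separates N_gt0 bO) => phi tp; apply: oppr_inj.
by rewrite -(h' phi tp); exact: esym (h phi tp).
Qed.

Definition div_pair v : option 'I_N -> H := fun o => if o is Some i then v i else wdiv v.

Definition test_div_pair Phi : option 'I_N -> H := fun o =>
  if o is Some i then e_ (Phi i) else e_ (fun x => \sum_i partial i (Phi i) x).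

(** The graph of the divergence over test fields; by [Hdiv0P], membership in [Hdiv0] means lying in
    its closure for [pair_form]. *)
Definition test_div_pairs : set (option 'I_N -> H) :=
  [set X | exists2 Phi, (forall i, test (Phi i)) & X = test_div_pair Phi].

Lemma cls_div Phi : (forall i, test (Phi i)) ->
  e_ (fun x => \sum_i partial i (Phi i) x) = \sum_i e_ (partial i (Phi i)).
Proof. by move=> tP; apply: (cls_test_sum bO) => i; exact: test_partial. Qed.

Lemma cls_partial_linear a i phi psi : test phi -> test psi ->
  e_ (partial i (fun x => a * phi x + psi x)) =
  a *: e_ (partial i phi) + e_ (partial i psi).
Proof.
move=> tp tq; have [sp _ _] := tp; have [sq _ _] := tq.
have := partials_linear [:: i] a sp sq; rewrite /partials /= => ->.
by apply: (cls_test_linear bO); exact: test_partial.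
Qed.

Lemma cls_partial0 i : e_ (partial i (fun=> 0)) = 0.
Proof.
have := cls_partial_linear (-1) i (test0 Omega) (test0 Omega).
rewrite scaleN1r addNr => <-; congr (e_ (partial i _)).
by apply/funext => x; rewrite mulr0 addr0.
Qed.

Lemma test_div_pairs_subspace : subspace test_div_pairs.
Proof.
split.
  exists (fun _ _ => 0); first by move=> i; exact: test0.
  apply/funext => -[i|]; first exact: (esym (cls0 bO)).
  rewrite /test_div_pair cls_div; last by move=> i; exact: test0.
  by rewrite big1// => i _; exact: cls_partial0.
move=> a _ _ [Phi tP ->] [Psi tQ ->].
have tL i : test (fun x => a * Phi i x + Psi i x) by exact: test_linear.
exists (fun i x => a * Phi i x + Psi i x); first exact: tL.
apply/funext => -[i|].
  exact: (esym (cls_test_linear bO a (tP i) (tQ i))).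
apply: (etrans (y := a *: test_div_pair Phi None + test_div_pair Psi None)) => //.
rewrite /test_div_pair (cls_div tP) (cls_div tQ) (cls_div tL) scaler_sumr -big_split.
by apply: eq_bigr => i _; exact: (esym (cls_partial_linear a i (tP i) (tQ i))).
Qed.

Lemma Hdiv_distE v Phi : (forall i, test (Phi i)) -> Hdiv_dist v Phi =
  Num.sqrt (pf (div_pair v - test_div_pair Phi) (div_pair v - test_div_pair Phi)).
Proof.
move=> tP; congr Num.sqrt; rewrite addrC; congr (_ + _).
  rewrite L2norm_dist_cls ?sqr_sqrtr ?dot_ge0//.
  by apply: (test_Lfun bO); apply: test_sum => i; exact: test_partial.
apply: eq_bigr => i _; rewrite L2norm_dist_cls ?sqr_sqrtr ?dot_ge0//.
exact: (test_Lfun bO).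
Qed.

Lemma Hdiv0P v : Hdiv0 v <-> Hdiv v /\ form_closure pf test_div_pairs (div_pair v).
Proof.
split=> -[vd va]; split=> // e e0.
  have [|Phi tP] := va (Num.sqrt e); first by rewrite sqrtr_gt0.
  rewrite Hdiv_distE// ltr_sqrt// => lte; exists (test_div_pair Phi); last exact: lte.
  by exists Phi.
have [|_ [Phi tP ->] lte] := va (e ^+ 2); first by rewrite exprn_gt0.
exists Phi; first exact: tP.
by rewrite (Hdiv_distE _ tP) -[ltRHS]gtr0_norm// -sqrtr_sqr ltr_sqrt ?exprn_gt0.
Qed.

(** The pair formed by [wgrad w] and [w] is orthogonal to every test field paired with its
    divergence, by definition of weak derivatives; orthogonality extends to the closure. *)
Lemma Hdiv0_green v w : Hdiv0 v -> Hk 1 w ->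
  \sum_i dot (v i) (wgrad w i) = - dot (wdiv v) w.
Proof.
move=> /Hdiv0P[_ vS] w1.
pose Y o := if o is Some i then wgrad w i else w.
have YS (Z : option 'I_N -> H) : test_div_pairs Z -> pf Z Y = 0.
  move=> [Phi tP ->]; rewrite /pair_form /Y /test_div_pair (cls_div tP) dot_suml -big_split.
  rewrite big1// => i _.
  have /(is_wpartialsP bO)/(_ _ (tP i)) := @Hk_wpartials R N Omega N_gt0 bO 1 w [:: i] w1 isT.
  rewrite /= expr1 mulN1r dotC => ->.
  by rewrite (dotC (e_ (Phi i))); exact: addNr.
have := form_closure_orth (pair_form_on Omega) YS vS.
by rewrite /pair_form /div_pair /Y addrC => /eqP; rewrite addr_eq0 => /eqP.
Qed.

(* If [Y] is orthogonal to all pairs [(Phi, div Phi)], its field part is the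
   gradient of its scalar part. *)
Lemma green_Hdiv0 v f : (forall w, Hk 1 w -> \sum_i dot (v i) (wgrad w i) = - dot f w) ->
  Hdiv0 v /\ wdiv v = f.
Proof.
move=> vf; have vd : is_wdiv v f.
  apply/is_wdivP => phi tp; rewrite -(vf _ (Hk_test bO (k := 1) tp)).
  by apply: eq_bigr => i _; rewrite /wgrad (wpartials_test N_gt0 bO [:: i] tp).
split; last exact: wdivE.
apply/Hdiv0P; split; first by exists f.
apply: (form_bipolar (pair_form_on Omega) (@pair_form_complete R N Omega)
  test_div_pairs_subspace) => Y YS.
have Yw i : is_wpartials [:: i] (Y None) (Y (Some i)).
  apply/(is_wpartialsP bO) => phi tp.
  (* A field with a single nonzero component isolates the i-th weak derivative of [Y None]. *)
  pose Phi j : T -> R := if j == i then phi else fun=> 0.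
  have tP j : test (Phi j) by rewrite /Phi; case: eqP => _; [exact: tp|exact: test0].
  have := YS _ (ex_intro2 _ _ Phi tP erefl).
  rewrite /pair_form /test_div_pair (cls_div tP) dot_suml -big_split (bigD1 i)//=.
  rewrite big1 => [|j ji]; last first.
    by rewrite /Phi (negbTE ji) cls_partial0 (cls0 bO) !dot0l addr0.
  rewrite /Phi eqxx addr0 => /eqP; rewrite addr_eq0 => /eqP E.
  by rewrite expr1 mulN1r dotC E; congr (- _); exact: dotC.
have Y1 : Hk 1 (Y None).
  by move=> [|i []]//= _; [exists (Y None); exact: is_wpartials_nil|exists (Y (Some i))].
rewrite /pair_form /div_pair (wdivE vd) addrC; apply/eqP; rewrite addr_eq0; apply/eqP.
rewrite -(vf _ Y1); apply: eq_bigr => i _; congr dot.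
exact: esym (wpartialsE N_gt0 bO (Yw i)).
Qed.

Local Notation one := (e_ (fun=> 1)).

Lemma one_Lfun : (fun=> 1) \in Lfun mu 2%:E.
Proof. by apply: (bounded_Lfun bO (C := 1)) => [|x]; [exact: measurable_cst|rewrite normr1]. Qed.

Lemma constantsP u : constants u <-> exists c, u = c *: one.
Proof.
have cE c : (c *: one : H) = cst c %[ae mu].
  have := L2scaleE c one; have := clsE one_Lfun.
  by apply: filterS2 => x h1 h2 _; rewrite (h2 I) (h1 I) mulr1.
split=> -[c uc]; exists c; last by rewrite uc.
by apply/L2_eqP; move: uc (cE c); apply: filterS2 => x h1 h2 _; rewrite (h1 I) (h2 I).
Qed.

Lemma orth_constantsP u : orth (@constants R N Omega) u <-> dot u one = 0.
Proof.
split=> [/orthP uc|u1].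
  by apply: uc; apply/constantsP; exists 1; rewrite scale1r.
apply/orthP => _ /constantsP[c ->].
by have := dotPr c one 0 u; rewrite addr0 dot0r u1 mulr0 addr0.
Qed.

Lemma is_wpartials_one i : is_wpartials [:: i] one 0.
Proof.
apply/(is_wpartialsP bO) => phi tp; have tpi := test_partial i tp.
rewrite dot0l mulr0 /= (dot_cls2 one_Lfun (test_Lfun bO tpi)) /pairing.
rewrite -[RHS](integral_test_partial bO i tp); apply: eq_Rintegral => x _.
exact: mul1r.
Qed.

Lemma Hk1_one : Hk 1 one.
Proof.
by move=> [|i []]//= _; [exists one; exact: is_wpartials_nil|exists 0; exact: is_wpartials_one].
Qed.

Lemma wgrad_one i : wgrad one i = 0.
Proof. exact: (wpartialsE N_gt0 bO (is_wpartials_one i)). Qed.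

Lemma grad_form_oner u : grad_form u one = 0.
Proof. by apply: big1 => i _; rewrite wgrad_one dot0r. Qed.

Lemma harmonic_one : Defs.harmonic one.
Proof.
apply/(harmonicP bO) => phi tp; rewrite (dot_cls_laplacian_grad N_gt0 bO Hk1_one tp).
by rewrite big1 ?oppr0// => i _; rewrite wgrad_one dot0l.
Qed.

Lemma HLaptilde_sub_L2hat : HLaptilde Omega `<=` L2hat Omega.
Proof. by move=> u [_ /orthP uh]; apply/orth_constantsP; apply: uh; exact: harmonic_one. Qed.

Lemma H1hat_subspace : subspace (@H1hat R N Omega).
Proof.
have sH := Hk_subspace N_gt0 bO 1; have sO := @orth_subspace R N Omega (@constants R N Omega).
split; first by split; [exact: sH.1|exact: sO.1].
by move=> a u w [u1 uc] [w1 wc]; split; [exact: sH.2|exact: sO.2].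
Qed.

Lemma H1hat_grad_closed : grad_closed (@H1hat R N Omega).
Proof.
move=> u u1 ua; split; first exact: u1.
apply/orth_constantsP.
apply: (form_closure_orth (dot_form Omega) (S := [set w | dot w one = 0])) => [w //|e e0].
have [w [[_ /orth_constantsP w1] uw _]] := ua e e0.
by exists w; [exact: w1|exact: uw].
Qed.

(** The weak Neumann problem, tested with all of H^1 rather than with mean-free functions only: the
    choice [w] = 1 encodes the compatibility condition that [f] is orthogonal to constants. *)
Definition neumann u f := forall w, Hk 1 w -> grad_form u w = - dot f w.

Lemma neumann_wlaplacian u f : Hk 1 u -> neumann u f -> is_wlaplacian 1 u f.
Proof.
move=> u1 uf; apply/(is_wlaplacianP bO) => phi tp.
rewrite (dot_cls_laplacian_grad N_gt0 bO u1 tp).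
have /(congr1 -%R) := uf _ (Hk_test bO (k := 1) tp); rewrite opprK => <-.
congr (- _); apply: eq_bigr => i _; congr dot.
by rewrite /wgrad (wpartials_test N_gt0 bO [:: i] tp).
Qed.

(** This trades the closure in the definition of [Hdiv0] for a variational condition, which is
    plainly linear in [u]. The two directions are [Hdiv0_green] and [green_Hdiv0]. *)
Lemma LapN_domP u : op_dom (LapN Omega) u <-> H1hat u /\ exists f, neumann u f.
Proof.
split=> [[u1 uN]|[u1 [f uf]]].
  by split; [exact: u1|exists (wdiv (wgrad u)) => w w1; exact: Hdiv0_green].
by split; [exact: u1|exact: (green_Hdiv0 uf).1].
Qed.

Lemma LapN_neumann u : op_dom (LapN Omega) u -> neumann u (wlaplacian u).
Proof.
move=> /LapN_domP[[u1 _] [f uf]].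
by rewrite (wlaplacianE N_gt0 bO (neumann_wlaplacian u1 uf)).
Qed.

Lemma LapN_iso (C : R) : 0 <= C -> (forall u, H1hat u -> dot u u <= C * grad_form u u) ->
  laplacian_iso (LapN Omega).
Proof.
move=> C0 HC; have fg := grad_form_on N_gt0 bO; have sW := H1hat_subspace.
have W1 : @H1hat R N Omega `<=` Hk 1 by move=> u [].
split; first by [].
- split; last first.
    move=> u /LapN_domP[u1 [f uf]]; exists f; exact: neumann_wlaplacian (W1 _ u1) uf.
  split.
    apply/LapN_domP; split; first exact: sW.1.
    exists 0 => w w1; rewrite dot0l oppr0.
    by rewrite (linear_on0 (Hk_subspace N_gt0 bO 1) (form_linearl fg w1)).
  move=> a u v /LapN_domP[u1 [f uf]] /LapN_domP[v1 [g vg]].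
  apply/LapN_domP; split; first exact: sW.2.
  exists (a *: f + g) => w w1.
  rewrite (form_linearl fg w1 _ (W1 _ u1) (W1 _ v1)) (uf w w1) (vg w w1) dotPl.
  by rewrite mulrN -opprD.
- move=> u /LapN_neumann uN; apply/orth_constantsP.
  by have := uN _ Hk1_one; rewrite grad_form_oner => /esym/eqP; rewrite oppr_eq0 => /eqP.
- move=> f /orth_constantsP f1.
  have [p ph pP] := grad_riesz N_gt0 bO sW W1 C0 HC H1hat_grad_closed (- f).
  (* Riesz gives the equation for mean-free [w] only. Subtracting from [w] a multiple of the
     constant 1 extends it to H^1, since both sides vanish on constants: the left because their
     gradient is 0, the right because [f] is orthogonal to them. *)
  have pN : neumann p f.
    move=> w w1.
    have [c wc] : exists c, dot (w - c *: one) one = 0.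
      (* If the square of [one] were 0, then [one] would be 0 and any [c] would do; this avoids
         showing that the domain has positive measure. *)
      have [oo|oo] := eqVneq (dot one one) 0.
        by exists 0; rewrite (dot_eq0 oo) dot0r.
      exists (dot w one / dot one one).
      have := dotPl (dot w one / dot one one) one 0 one.
      by rewrite addr0 dot0l addr0 dotBl => ->; rewrite divfK// subrr.
    have c1 : Hk 1 (c *: one) by apply: (subspaceZ (Hk_subspace N_gt0 bO 1)); exact: Hk1_one.
    have wh : H1hat (w - c *: one).
      split; last exact/orth_constantsP.
      exact: (subspaceB (Hk_subspace N_gt0 bO 1)).
    have sH := Hk_subspace N_gt0 bO 1.
    have p1 := W1 _ ph.
    have Eg : grad_form p (c *: one) = 0.
      by rewrite (linear_onZ sH c (form_linearr sH fg p1) Hk1_one) grad_form_oner mulr0.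
    have Ef : dot f (c *: one) = 0.
      by have := dotPr c one 0 f; rewrite addr0 dot0r f1 mulr0 addr0.
    rewrite -[w in LHS](subrK (c *: one)) -[w in RHS](subrK (c *: one)).
    rewrite (linear_onD (form_linearr sH fg p1) (W1 _ wh) c1) Eg addr0 (pP _ wh).
    by rewrite dotNl (dotDr _ (c *: one)) Ef addr0.
  exists p; first by apply/LapN_domP; split; [exact: ph|exists f].
  exact: (wlaplacianE N_gt0 bO (neumann_wlaplacian (W1 _ ph) pN)).
exists (C ^+ 2) => [|u uD]; first exact: sqr_ge0.
have [u1 _] := (LapN_domP u).1 uD.
rewrite -(dot_sqrN (wlaplacian u)); apply: (dot_bound C0).
rewrite dotNl -(LapN_neumann uD (W1 _ u1)).
exact: HC.
Qed.

End neumann_laplacian.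

(** * Composition of the reduced Laplacians *)

Lemma pinv_image T U (d : U -> T) (A : set T) (f : T -> U) x :
  set_inj A f -> A x -> 'pinv_d A f (f x) = x.
Proof. by move=> iA Ax; apply: (pinvKV d iA); rewrite inE. Qed.

Section operator_composition.
Context {R : realType} {N : nat} (Omega : domain R N).
Local Notation H := (L2 Omega).
Variables (X Y : operator Omega).
Hypotheses (bX : set_bij (op_dom X) (op_cod X) X) (bY : set_bij (op_dom Y) (op_cod Y) Y).
Hypothesis XY : op_dom X `<=` op_cod Y.

Lemma op_comp_bij : set_bij (op_dom (op_comp X Y)) (op_cod X) (op_comp X Y).
Proof.
have [[fX iX sX] [_ iY sY]] := (bX, bY).
split=> [u [_ uX]|u v|f fF]; first exact: fX.
  rewrite !inE => -[uY uX] [vY vX] uv; apply: iY; rewrite ?inE//.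
  by apply: iX; rewrite ?inE.
have [g gX gf] := sX f fF; have [u uY ug] := sY g (XY gX).
by exists u; [split; rewrite ?ug|rewrite /= ug].
Qed.

Lemma op_inv_comp : op_eq (op_inv (op_comp X Y)) (op_comp (op_inv Y) (op_inv X)).
Proof.
have [[_ iX _] [_ iY _] [_ iXY _]] := And3 bX bY op_comp_bij.
split.
  apply/seteqP; split=> [_ [u [uY uX] <-]|f [[g gX <-]]].
    by split; [exists (Y u)|exists u => //=; rewrite pinv_image].
  by rewrite /= pinv_image// => -[u uY ug]; exists u; [split; rewrite ?ug|rewrite /= ug].
move=> f; rewrite inE => -[u uD <-]; have [uY uX] := uD.
by rewrite [LHS](pinv_image _ iXY uD) /= (pinv_image _ iX uX) (pinv_image _ iY uY).
Qed.

End operator_composition.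

Section bilaplacian.
Context {R : realType} {N : nat} (Omega : domain R N).
Hypotheses (N_gt0 : (0 < N)%N) (bO : bounded_set (Omega : set 'rV[R]_N)).
Local Notation T := ('rV[R]_N).
Local Notation test := (test_function Omega).
Local Notation H := (L2 Omega).
Local Notation e_ := (@cls R N Omega).
Implicit Types (u v w f g h : H) (phi psi : T -> R).

(** The Laplacian of a test function is again a test function, so the inner equation may be tested
    with it. *)
Lemma is_wlaplacian_comp u f g :
  is_wlaplacian 1 u g -> is_wlaplacian 1 g f -> is_wlaplacian 2 u f.
Proof.
move=> ug gf phi tp; apply: etrans (gf phi tp).
exact: ug (test_laplacian tp).
Qed.

Lemma is_wlaplacian2_uniq u f g : is_wlaplacian 2 u f -> is_wlaplacian 2 u g -> f = g.
Proof.
move=> uf ug; apply: (test_separates N_gt0 bO) => phi tp.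
by rewrite -!(pairing_dot bO _ tp) -uf// -ug.
Qed.

Section iso_theory.
Variables (X : operator Omega) (iX : laplacian_iso X).

Lemma iso_subspace : subspace (op_dom X). Proof. by case: iX => _ []. Qed.

Lemma iso_HLap : op_dom X `<=` @HLap R N Omega. Proof. by case: iX => _ []. Qed.

Lemma iso_actE u : X u = - wlaplacian u. Proof. by case: iX => -> *. Qed.

Lemma wlaplacianN u : HLap u -> wlaplacian (- u) = - wlaplacian u.
Proof.
move=> uL; have := wlaplacianB N_gt0 bO (HLap_subspace N_gt0 bO).1 uL.
rewrite (wlaplacianE N_gt0 bO (is_wlaplacian0 bO)) !add0r; exact.
Qed.

Lemma iso_bound : exists2 C : R, 0 <= C &
  forall u, op_dom X u -> dot u u <= C * dot (X u) (X u).
Proof.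
by have [_ _ _ _ [C C0 CP]] := iX; exists C => [//|u uX]; rewrite iso_actE dot_sqrN; exact: CP.
Qed.

Lemma iso_bij : set_bij (op_dom X) (op_cod X) X.
Proof.
have [_ _ rX sX [C C0 CP]] := iX; have sD := iso_subspace; have XL := iso_HLap.
split=> [u uX|u v|f fF].
- rewrite iso_actE -(wlaplacianN (XL _ uX)); apply: rX; exact: (subspaceN sD).
- rewrite !inE !iso_actE => uX vX /oppr_inj uv; apply/eqP; rewrite -subr_eq0; apply/eqP.
  apply: dot_eq0; apply: le_anti; rewrite dot_ge0 andbT.
  have := CP _ (subspaceB sD uX vX).
  by rewrite (wlaplacianB N_gt0 bO (XL _ uX) (XL _ vX)) uv subrr dot0l mulr0.
- have [u uX uf] := sX f fF; exists (- u); first exact: (subspaceN sD).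
  by rewrite iso_actE (wlaplacianN (XL _ uX)) opprK.
Qed.

End iso_theory.

Lemma bilaplacian_iso_comp (X Y : operator Omega) : laplacian_iso X -> laplacian_iso Y ->
  op_dom X `<=` op_cod Y ->
  bilaplacian_iso X Y [set u | op_dom Y u /\ op_dom X (wlaplacian u)] (op_cod X).
Proof.
move=> iX iY XY; have [bX bY] := (iso_bij iX, iso_bij iY).
have [C C0 CP] := iso_bound iX; have [D D0 DP] := iso_bound iY.
have sX := iso_subspace iX.
have DE : op_dom (op_comp X Y) = [set u | op_dom Y u /\ op_dom X (wlaplacian u)].
  apply/seteqP; split=> u [uY]; rewrite /= (iso_actE iY) => uX; split; try exact: uY.
    by rewrite -[wlaplacian u]opprK; exact: (subspaceN sX).
  exact: (subspaceN sX).
have bXY := op_comp_bij bX bY XY; have iXY := op_inv_comp bX bY XY.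
have lap2 u : op_dom (op_comp X Y) u -> is_wlaplacian 2 u (op_comp X Y u).
  move=> [uY uX]; have uL := iso_HLap iY uY; have YL := iso_HLap iX uX.
  have sL := HLap_subspace N_gt0 bO.
  rewrite /= (iso_actE iX) (iso_actE iY) in YL *.
  have wL : HLap (wlaplacian u) by rewrite -[wlaplacian u]opprK; exact: (subspaceN sL).
  rewrite (wlaplacianN wL) opprK.
  apply: is_wlaplacian_comp; exact: wlaplacianP.
rewrite -DE; split => //.
  exists (Num.sqrt (D * C)) => f fF.
  have [_ inj sur] := bXY; have [u uD uf] := sur f fF.
  have -> : op_inv (op_comp X Y) f = u.
    by rewrite -uf; exact: pinv_image.
  (* The bounds of the two factors are for squared norms: D for [Y] and C for [X] multiply under the
     root. *)
  rewrite !L2normE -sqrtrM ?mulr_ge0// ler_wsqrtr//.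
  apply: le_trans (DP u uD.1) _; rewrite -mulrA; apply: ler_wpM2l => //.
  by rewrite -uf; exact: CP uD.2.
have [[_ injX _] [_ injY _]] := (bX, bY); split => //.
move=> f fF; have [_ inj sur] := bXY; have [u uD uf] := sur f fF.
exists u; split; first by split; [exact: uD|rewrite -uf; exact: lap2].
(* The distributional bilaplacian of [v] is unique, so the composition also sends [v] to [f] and
   injectivity applies. *)
move=> v [vD vf]; apply: inj; rewrite ?inE// uf.
exact: is_wlaplacian2_uniq vf (lap2 v vD).
Qed.

End bilaplacian.

Theorem mainTheorem3 (R : realType) (N : nat) (N_gt0 : (0 < N)%N)
    (Omega : domain R N) (Omega_adm : Poincare_admissible Omega) :
  (* (i) *)
  bilaplacian_iso (Lap Omega) (Lap0 Omega)
    [set u | Hk0 Omega 2 u /\ HLaptilde Omega (wlaplacian u)] setT /\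
  (* (ii) *)
  bilaplacian_iso (Lap0 Omega) (Lap Omega)
    [set u | HLaptilde Omega u /\ Hk0 Omega 2 (wlaplacian u)]
    (L2tilde Omega) /\
  (* (iii) *)
  bilaplacian_iso (Lap Omega) (Lap Omega)
    [set u | HLaptilde Omega u /\ HLaptilde Omega (wlaplacian u)] setT /\
  (* (iv) *)
  bilaplacian_iso (LapD Omega) (Lap Omega)
    [set u | HLaptilde Omega u /\ op_dom (LapD Omega) (wlaplacian u)] setT /\
  (* (v) *)
  bilaplacian_iso (LapN Omega) (Lap Omega)
    [set u | HLaptilde Omega u /\ op_dom (LapN Omega) (wlaplacian u)]
    (L2hat Omega) /\
  (* (vi) *)
  bilaplacian_iso (Lap Omega) (LapN Omega)
    [set u | op_dom (LapN Omega) u /\ HLaptilde Omega (wlaplacian u)] setT /\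
  (* (vii) *)
  bilaplacian_iso (LapN Omega) (LapN Omega)
    [set u | op_dom (LapN Omega) u /\ op_dom (LapN Omega) (wlaplacian u)]
    (L2hat Omega) /\
  (* (viii) *)
  bilaplacian_iso (Lap0 Omega) (LapD Omega)
    [set u | op_dom (LapD Omega) u /\ Hk0 Omega 2 (wlaplacian u)]
    (L2tilde Omega) /\
  (* (ix) *)
  bilaplacian_iso (Lap Omega) (LapD Omega)
    [set u | op_dom (LapD Omega) u /\ HLaptilde Omega (wlaplacian u)] setT /\
  (* (x) *)
  bilaplacian_iso (LapD Omega) (LapD Omega)
    [set u | op_dom (LapD Omega) u /\ op_dom (LapD Omega) (wlaplacian u)] setT /\
  (* (xi) *)
  bilaplacian_iso (LapN Omega) (LapD Omega)
    [set u | op_dom (LapD Omega) u /\ op_dom (LapN Omega) (wlaplacian u)]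
    (L2hat Omega).
Proof.
have [bO [c c0 cP]] := Omega_adm.
(* The admissibility inequality is squared, since the forms compare squared norms. *)
have PN (u : L2 Omega) : H1hat u -> dot u u <= c ^+ 2 * grad_form u u.
  move=> /cP; rewrite L2normE (eq_bigr (fun i => dot (wgrad u i) (wgrad u i))) => [|i _].
    rewrite -[c in c * _]gtr0_norm// -sqrtr_sqr -sqrtrM ?sqr_ge0// ler_sqrt//.
    by rewrite mulr_ge0 ?sqr_ge0// sumr_ge0// => i _; exact: dot_ge0.
  exact: L2norm_sqr.
have i0 := Lap0_iso N_gt0 bO; have iD := LapD_iso N_gt0 bO.
have iN := LapN_iso N_gt0 bO (sqr_ge0 c) PN; have iL := Lap_iso N_gt0 bO.
have comp := bilaplacian_iso_comp N_gt0 bO.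
(* In each case what remains is the inclusion of the outer domain in the inner target. It is trivial
   when that target is all of L^2, and otherwise comes from an orthogonality built into the outer
   domain. *)
split; first by apply: (comp _ _ iL i0) => u [].
split; first exact: (comp _ _ i0 iL (fun _ _ => I)).
split; first exact: (comp _ _ iL iL (fun _ _ => I)).
split; first exact: (comp _ _ iD iL (fun _ _ => I)).
split; first exact: (comp _ _ iN iL (fun _ _ => I)).
split; first exact: (comp _ _ iL iN (HLaptilde_sub_L2hat N_gt0 bO)).
split; first by apply: (comp _ _ iN iN) => u [[]].
split; first exact: (comp _ _ i0 iD (fun _ _ => I)).
split; first exact: (comp _ _ iL iD (fun _ _ => I)).
split; first exact: (comp _ _ iD iD (fun _ _ => I)).
exact: (comp _ _ iN iD (fun _ _ => I)).
Qed.
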